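(* Fix $h\geq 4$. The following decision problem is NP-hard: given a graph $G$ that is both VPT and split and has no dominated stable vertices, decide whether $G\in[h,2,1]\setminus[h-1,2,1]$.
   Context: All graphs are finite, simple and connected. A graph is split if its vertex set partitions into a stable set $S$ and a clique $K$; the vertices of $S$ are stable vertices. A stable vertex $s\in S$ is dominated if there is $s'\in S$, $s'\ne s$, with $N(s)\subseteq N(s')$. $[h,2,1]$ denotes the class of graphs that are vertex-intersection graphs of a family of paths in a tree of maximum degree at most $h$ (two vertices adjacent iff their paths share at least one vertex), and VPT $=[\infty,2,1]$ is the class of vertex-intersection graphs of paths in a tree. *)

(* Defs.v *)
From mathcomp Require Import all_boot.
Set Implicit Arguments. Unset Strict Implicit. Unset Printing Implicit Defensive.

Definition simple_graph (n : nat) (e : rel 'I_n) : Prop :=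
  irreflexive e /\ symmetric e.

Definition connected_graph (n : nat) (e : rel 'I_n) : Prop :=
  0 < n /\ forall u v : 'I_n, connect e u v.

Definition acyclic (m : nat) (T : rel 'I_m) : Prop :=
  ~ exists (x : 'I_m) (p : seq 'I_m),
      [/\ 2 <= size p, uniq (x :: p), path T x p & T (last x p) x].

Definition is_tree (m : nat) (T : rel 'I_m) : Prop :=
  [/\ simple_graph T, connected_graph T & acyclic T].

Definition max_degree_le (m : nat) (T : rel 'I_m) (h : nat) : Prop :=
  forall x : 'I_m, #|[set y | T x y]| <= h.

Definition tree_path (m : nat) (T : rel 'I_m) (p : seq 'I_m) : bool :=
  if p is x :: q then uniq p && path T x q else false.

Definition path_model (n m : nat) (e : rel 'I_n) (T : rel 'I_m)
    (P : 'I_n -> seq 'I_m) : Prop :=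
  (forall v, tree_path T (P v)) /\
  (forall u v, u != v -> e u v = has (fun x => x \in P u) (P v)).

Definition in_h21 (h : nat) (n : nat) (e : rel 'I_n) : Prop :=
  exists (m : nat) (T : rel 'I_m) (P : 'I_n -> seq 'I_m),
    [/\ is_tree T, max_degree_le T h & path_model e T P].

Definition is_VPT (n : nat) (e : rel 'I_n) : Prop :=
  exists (m : nat) (T : rel 'I_m) (P : 'I_n -> seq 'I_m),
    is_tree T /\ path_model e T P.

Definition split_partition (n : nat) (e : rel 'I_n) (S : {set 'I_n}) : Prop :=
  (forall u v, u \in S -> v \in S -> ~~ e u v) /\
  (forall u v, u \notin S -> v \notin S -> u != v -> e u v).

Definition dominated (n : nat) (e : rel 'I_n) (S : {set 'I_n}) (s : 'I_n) : Prop :=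
  exists2 s', s' \in S & s' != s /\ (forall x, e s x -> e s' x).

Definition promise (n : nat) (e : rel 'I_n) : Prop :=
  [/\ simple_graph e, connected_graph e, is_VPT e &
      exists S : {set 'I_n}, split_partition e S /\
        (forall s, s \in S -> ~ dominated e S s)].

Definition enc_graph (n : nat) (e : rel 'I_n) : seq bool :=
  nseq n true ++ false :: [seq e i j | i <- enum 'I_n, j <- enum 'I_n].

Inductive move := MoveL | MoveR | Stay.

Definition tsym := option bool.  (* None = blank *)

Record TM := {
  tm_q : nat;  (* states are 'I_(tm_q.+1); start state ord0 *)
  tm_halt : 'I_tm_q.+1 -> bool;
  tm_delta : 'I_tm_q.+1 -> tsym -> 'I_tm_q.+1 * tsym * move
}.

(* configuration: state, left part of tape (nearest cell first),
   scanned symbol, right part of tape (nearest cell first). *)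
Definition config (M : TM) : Type :=
  ('I_(tm_q M).+1 * seq tsym * tsym * seq tsym)%type.

Definition tm_init (M : TM) (x : seq bool) : config M :=
  match map Some x with
  | [::] => (ord0, [::], None, [::])
  | a :: r => (ord0, [::], a, r)
  end.

Definition tm_step (M : TM) (c : config M) : config M :=
  let: (s, l, a, r) := c in
  if tm_halt s then c else
  let: (s', w, mv) := tm_delta s a in
  match mv with
  | Stay => (s', l, w, r)
  | MoveL => match l with
             | [::] => (s', [::], None, w :: r)
             | b :: l' => (s', l', b, w :: r)
             end
  | MoveR => match r with
             | [::] => (s', w :: l, None, [::])
             | b :: r' => (s', w :: l, b, r')
             end
  end.

(* output: the maximal blank-free word starting at the head *)
Fixpoint read_word (t : seq tsym) : seq bool :=
  match t with
  | Some b :: t' => b :: read_word t'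
  | _ => [::]
  end.

Arguments tm_step : clear implicits.
Definition halted_with (M : TM) (c : config M) (y : seq bool) : Prop :=
  let: (s, _, a, r) := c in tm_halt s /\ read_word (a :: r) = y.

Definition poly_time_computes (M : TM) (f : seq bool -> seq bool) : Prop :=
  exists c k : nat, forall x : seq bool,
    exists t : nat, t <= c * (size x) ^ k + c /\
      @halted_with M (iter t (tm_step M) (tm_init M x)) (f x).

Definition poly_time_computable (f : seq bool -> seq bool) : Prop :=
  exists M : TM, poly_time_computes M f.

Definition pair_enc (x w : seq bool) : seq bool :=
  flatten [seq [:: b; b] | b <- x] ++ [:: false; true] ++ w.

Definition in_NP (L : seq bool -> Prop) : Prop :=
  exists (V : seq bool -> bool) (c k : nat),
    poly_time_computable (fun z => [:: V z]) /\
    forall x, L x <-> exists w, size w <= c * (size x) ^ k + c /\ V (pair_enc x w).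

Definition NP_hard_promise (Yes No : seq bool -> Prop) : Prop :=
  forall L, in_NP L ->
    exists f, poly_time_computable f /\
      forall x, (L x -> Yes (f x)) /\ (~ L x -> No (f x)).

Definition yes_inst (h : nat) (s : seq bool) : Prop :=
  exists (n : nat) (e : rel 'I_n),
    [/\ s = enc_graph e, promise e, in_h21 h e & ~ in_h21 h.-1 e].

Definition no_inst (h : nat) (s : seq bool) : Prop :=
  exists (n : nat) (e : rel 'I_n),
    [/\ s = enc_graph e, promise e & ~ (in_h21 h e /\ ~ in_h21 h.-1 e)].

(* Main.v *)
(** The computation tableau of the verifier of an NP language is written as a
    3-CNF formula, and the formula as a graph H with the usual palette, literal
    and clause vertices; since h >= 4, a clause is a triangle whose vertices are
    restricted to the colours "false" and two others.  From H one builds the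
    split graph G whose stable vertices are the vertices of H and whose clique
    vertices are the ordered edges of H, each adjacent to its two ends.

    In a path model of G the paths of the clique share a tree node c (Helly), and
    stable vertices that are adjacent in H live in different branches at c:
    otherwise one of their paths would separate the other one from c, and so
    dominate it.  Hence a model in a tree of maximum degree d colours H with d
    colours; conversely an h-colouring of H places the stable vertices at the
    leaves of h caterpillars hung at c.  The palette is a clique on h vertices,
    so G is never in [h-1,2,1].

    The vertices of G are tuples of numbers bounded by a polynomial and their
    adjacency is a quantifier-free condition on those numbers, so the adjacency
    matrix is printed by nested loops over unary counters.  The counters are
    stacks interleaved on the tape, and loop programs are compiled to Turing
    machines. *)

From Stdlib Require Import ZArith Lia FunctionalExtensionality.
Require Import Defs.
From mathcomp Require Import all_boot.
From mathcomp Require Import zify_ssreflect.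
Set Implicit Arguments. Unset Strict Implicit. Unset Printing Implicit Defensive.

(** * Turing machines on function tapes *)

(** NP-hardness is proved from its definition, so the reduction has to be an actual machine with a
    time bound, and both answers must yield instances that satisfy the promise. The second point
    holds by construction: every vertex of H has two distinct neighbours, so for stable vertices s
    and s' there is an edge from s to some v other than s', and the clique vertex of that edge sees
    s but not s'. Satisfiability decides nothing but the membership in [h,2,1]. The constant 4 comes
    from the clause gadget: the triangle needs the colour of falsity and two more, and none of the
    three may be the colour of truth. The tableau relies on the verifier answering on every word:
    its clauses force the symbols of the run on the guessed word to be true, so it is enough to
    forbid, in the last row, a head that scans the answer [false]. *)

Definition tape := Z -> tsym.

Definition upd (T : tape) (p : Z) (w : tsym) : tape :=
  fun z => if Z.eqb z p then w else T z.

Lemma upd_id T p : upd T p (T p) = T.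
Proof.
by apply: functional_extensionality => z; rewrite /upd; case: Z.eqb_spec => [->|].
Qed.

Lemma upd_eq T p w : upd T p w p = w.
Proof. by rewrite /upd Z.eqb_refl. Qed.

Lemma upd_neq T p w z : z <> p -> upd T p w z = T z.
Proof. by rewrite /upd; case: Z.eqb_spec. Qed.

Definition shift (mv : move) (p : Z) : Z :=
  match mv with MoveL => (p - 1)%Z | MoveR => (p + 1)%Z | Stay => p end.

Definition gstep (Q : Type) (halt : Q -> bool)
    (delta : Q -> tsym -> Q * tsym * move) (c : Q * tape * Z) : Q * tape * Z :=
  let: (q, T, p) := c in
  if halt q then c else
  let: (q', w, mv) := delta q (T p) in (q', upd T p w, shift mv p).

Definition tape_of (l : seq tsym) (a : tsym) (r : seq tsym) (p : Z) : tape :=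
  fun z => if (z <? p)%Z then nth None l (Z.to_nat (p - z - 1))
           else if (z =? p)%Z then a
           else nth None r (Z.to_nat (z - p - 1)).

(* Trailing blanks are forgotten by [tape_of], so the head may create cells
   on the fly without changing the tape. *)
Definition cfg_tape (M : TM) (c : config M) (p : Z) : 'I_(tm_q M).+1 * tape * Z :=
  let: (s, l, a, r) := c in (s, tape_of l a r p, p).

Ltac zcases := repeat match goal with
  | |- context [Z.ltb ?a ?b] => case: (Z.ltb_spec a b)
  | |- context [Z.eqb ?a ?b] => case: (Z.eqb_spec a b)
  end.

(** A configuration does not record where its head stands, so the position after the step is
    existential. *)
Lemma tm_step_gstep (M : TM) (c : config M) (p : Z) :
  exists p', cfg_tape (tm_step M c) p' =
             gstep (@tm_halt M) (@tm_delta M) (cfg_tape c p).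
Proof.
case: c => [[[s l] a] r] /=.
have -> : tape_of l a r p p = a.
  by rewrite /tape_of Z.ltb_irrefl Z.eqb_refl.
case: (tm_halt s); first by exists p.
case: (tm_delta s a) => [[s' w] mv].
exists (shift mv p).
case: mv => /=.
(* This covers at once an existing left neighbour and a blank cell created at the end of the
   list. *)
- suff E b l' : tape_of l a r p (p - 1)%Z = b ->
      (forall i, nth None l' i = nth None l i.+1) ->
      tape_of l' b (w :: r) (p - 1) = upd (tape_of l a r p) p w.
    case: l E => [|b l'] E /=; rewrite E //; try by case.
    + by rewrite /tape_of; zcases; try lia; move=> *; rewrite nth_nil.
    + by rewrite /tape_of; zcases; try lia; move=> *; have -> : Z.to_nat (p - (p - 1) - 1) = 0 by lia.
  move=> Eb El; apply: functional_extensionality => z.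
  rewrite /upd; case: Z.eqb_spec => [->|zp].
    rewrite /tape_of; zcases; try lia; move=> *.
    by have -> : Z.to_nat (p - (p - 1) - 1) = 0 by lia.
  case: (Z.eqb_spec z (p - 1)) => [->|zp1].
    by rewrite {1}/tape_of Z.ltb_irrefl Z.eqb_refl Eb.
  rewrite /tape_of; zcases; try lia; move=> *.
    by rewrite El; congr (nth _ _ _); lia.
  by have -> : Z.to_nat (z - (p - 1) - 1) = (Z.to_nat (z - p - 1)).+1 by lia.
- suff E b r' : tape_of l a r p (p + 1)%Z = b ->
      (forall i, nth None r' i = nth None r i.+1) ->
      tape_of (w :: l) b r' (p + 1) = upd (tape_of l a r p) p w.
    case: r E => [|b r'] E /=; rewrite E //; try by case.
    + by rewrite /tape_of; zcases; try lia; move=> *; rewrite nth_nil.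
    + by rewrite /tape_of; zcases; try lia; move=> *; have -> : Z.to_nat (p + 1 - p - 1) = 0 by lia.
  move=> Eb El; apply: functional_extensionality => z.
  rewrite /upd; case: Z.eqb_spec => [->|zp].
    rewrite /tape_of; zcases; try lia; move=> *.
    by have -> : Z.to_nat (p + 1 - p - 1) = 0 by lia.
  case: (Z.eqb_spec z (p + 1)) => [->|zp1].
    by rewrite {1}/tape_of Z.ltb_irrefl Z.eqb_refl Eb.
  rewrite /tape_of; zcases; try lia; move=> *.
    by have -> : Z.to_nat (p + 1 - z - 1) = (Z.to_nat (p - z - 1)).+1 by lia.
  by rewrite El; congr (nth _ _ _); lia.
- rewrite /tape_of /upd; congr (_, _, _); apply: functional_extensionality => z.
  by zcases; try lia.
Qed.

Lemma tm_iter_gstep (M : TM) (c : config M) (p : Z) n :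
  exists p', cfg_tape (iter n (tm_step M) c) p' =
             iter n (gstep (@tm_halt M) (@tm_delta M)) (cfg_tape c p).
Proof.
elim: n => [|n [p' IH]]; first by exists p.
have [p'' E] := tm_step_gstep (iter n (tm_step M) c) p'.
by exists p''; rewrite !iterS E IH.
Qed.

Definition word_tape (x : seq bool) : tape :=
  fun z => if (z <? 0)%Z then None else onth x (Z.to_nat z).

Lemma onth_nth_map (T : Type) (x : seq T) i : onth x i = nth None (map Some x) i.
Proof. by elim: x i => [|a x IH] [|i] //=. Qed.

Lemma tm_init_tape (M : TM) (x : seq bool) :
  cfg_tape (tm_init M x) 0 = (ord0, word_tape x, 0%Z).
Proof.
rewrite /tm_init; case: x => [|a x] /=; congr (_, _, _);
  apply: functional_extensionality => z; rewrite /word_tape /tape_of;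
  zcases; rewrite ?nth_nil //; try lia; move=> *.
- by have -> : Z.to_nat z = 0 by lia.
- by rewrite onth_nth_map nth_nil.
- by have -> : Z.to_nat z = 0 by lia.
- have -> : Z.to_nat z = (Z.to_nat (z - 0 - 1)).+1 by lia.
  by rewrite /= onth_nth_map.
Qed.

(** The bound is [i <= size y] and not [<]: the cell after the word has to be blank, or [read_word]
    would read on. *)
Lemma read_word_of_tape (y : seq bool) (t : seq tsym) :
  (forall i, i <= size y -> nth None t i = onth y i) -> read_word t = y.
Proof.
elim: y t => [|b y IH] t E.
  by case: t E => [|[b|] t] // E; have := E 0 isT.
case: t E => [|a t] E; first by have := E 0 isT.
have := E 0 isT; rewrite /= => ->; congr (_ :: _).
by apply: IH => i lei; have := E i.+1 lei.
Qed.

(** * Machines whose halting states carry an exit value *)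

Record mach (F : finType) := Mach {
  mQ : finType; mq0 : mQ;
  mdelta : mQ -> tsym -> mQ * tsym * move;
  mhalt : mQ -> option F }.

Arguments mq0 {F}.

Inductive reach (F : finType) (M : mach F) :
    nat -> mQ M * tape * Z -> mQ M * tape * Z -> Prop :=
| Reach0 c : reach 0 c c
| ReachS n q T p q' w mv c : mhalt q = None -> mdelta q (T p) = (q', w, mv) ->
    reach n (q', upd T p w, shift mv p) c -> reach n.+1 (q, T, p) c.

(** The step count is an upper bound, which lets the times of composed machines be rounded up. *)
Definition run (F : finType) (M : mach F) (T : tape) (p : Z) (n : nat) (f : F)
    (T' : tape) (p' : Z) : Prop :=
  exists q n', [/\ n' <= n, reach n' (mq0 M, T, p) (q, T', p') & mhalt q = Some f].

Lemma run_le (F : finType) (M : mach F) T p n m f T' p' :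
  n <= m -> run M T p n f T' p' -> run M T p m f T' p'.
Proof. by move=> nm [q [n' [le r h]]]; exists q, n'; split=> //; apply: leq_trans nm. Qed.

Lemma reach_trans (F : finType) (M : mach F) n m c1 c2 c3 :
  reach (M := M) n c1 c2 -> reach m c2 c3 -> reach (n + m) c1 c3.
Proof.
by elim=> // n' q T p q' w mv c hq d _ IH r; rewrite addSn; apply: ReachS hq d (IH r).
Qed.

Definition mret (F : finType) (f : F) : mach F :=
  @Mach F unit tt (fun q s => (q, s, Stay)) (fun _ => Some f).

Lemma run_ret (F : finType) (f : F) T p : run (mret f) T p 0 f T p.
Proof. by exists tt, 0; split=> //; constructor. Qed.

Definition mact (F : finType) (g : tsym -> F * tsym * move) : mach F :=
  @Mach F (option F) None
    (fun _ s => let: (f, w, mv) := g s in (Some f, w, mv)) id.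

Lemma run_act (F : finType) (g : tsym -> F * tsym * move) T p f w mv :
  g (T p) = (f, w, mv) -> run (mact g) T p 1 f (upd T p w) (shift mv p).
Proof.
move=> E; exists (Some f), 1; split=> //.
by apply: (@ReachS _ (mact g) 0 None T p (Some f) w mv) => //=; [rewrite E|constructor].
Qed.

Section Switch.
Variables (F G : finType) (M : mach F) (N : F -> mach G).
(** The exit value f of M selects the continuation [N f]; the states of the continuations form a
    dependent sum. The handover is one idle step that rewrites the scanned symbol, which is the
    [.+1] in the run times. *)
Definition mswitch : mach G :=
  @Mach G (mQ M + {f : F & mQ (N f)})%type (inl (mq0 M))
    (fun q s => match q with
      | inl q => match mhalt q with
          | Some f => (inr (Tagged (fun f => mQ (N f)) (mq0 (N f))), s, Stay)
          | None => let: (q', w, mv) := mdelta q s in (inl q', w, mv)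
          end
      | inr (existT f q) =>
          let: (q', w, mv) := mdelta q s in
          (inr (Tagged (fun f => mQ (N f)) q'), w, mv)
      end)
    (fun q => match q with inl _ => None | inr (existT f q) => mhalt q end).

Lemma run_switch T p n f T' p' n' g T'' p'' :
  run M T p n f T' p' -> run (N f) T' p' n' g T'' p'' ->
  run mswitch T p (n + n'.+1) g T'' p''.
Proof.
move=> [q [k [lek r h]]] [q2 [k2 [lek2 r2 h2]]].
exists (inr (Tagged (fun f => mQ (N f)) q2)), (k + k2.+1); split=> //; first lia.
have L c d m : reach m c d ->
    reach (M := mswitch) m (inl c.1.1, c.1.2, c.2) (inl d.1.1, d.1.2, d.2).
  elim=> [[[a b] e]|m' a b e a' w mv c' ha da _ IH]; first by constructor.
  by apply: (@ReachS _ mswitch _ _ _ _ (inl a') w mv) => //=; rewrite ha da.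
have R c d m : reach m c d -> reach (M := mswitch) m
    (inr (Tagged (fun f => mQ (N f)) c.1.1), c.1.2, c.2)
    (inr (Tagged (fun f => mQ (N f)) d.1.1), d.1.2, d.2).
  elim=> [[[a b] e]|m' a b e a' w mv c' ha da _ IH]; first by constructor.
  apply: (@ReachS _ mswitch _ _ _ _ (inr (Tagged (fun f => mQ (N f)) a')) w mv) => //=.
  by rewrite da.
apply: reach_trans (L _ _ _ r) _ => /=.
apply: (@ReachS _ mswitch _ _ _ _ (inr (Tagged (fun f => mQ (N f)) (mq0 (N f)))) (T' p') Stay) => //=.
  by rewrite h.
by rewrite upd_id; apply: R r2.
Qed.
End Switch.

Section While.
Variables (F : finType) (M : mach (option F)).
(** Exit [None] restarts the body, exit [Some f] leaves the loop with value f. *)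
Definition mwhile : mach F :=
  @Mach F (mQ M) (mq0 M)
    (fun q s => match mhalt q with
      | Some None => (mq0 M, s, Stay)
      | _ => mdelta q s end)
    (fun q => match mhalt q with Some (Some f) => Some f | _ => None end).

Lemma while_reach n c d : reach (M := M) n c d -> reach (M := mwhile) n c d.
Proof.
elim=> [c'|m a b e a' w mv c' ha da _ IH]; first by constructor.
by apply: (@ReachS _ mwhile _ _ _ _ a' w mv) => //=; rewrite ha.
Qed.

Lemma run_while_stop T p n f T' p' :
  run M T p n (Some f) T' p' -> run mwhile T p n f T' p'.
Proof.
move=> [q [k [lek r h]]]; exists q, k; split=> //=; last by rewrite h.
exact: while_reach.
Qed.

Lemma run_while_next T p n T' p' n' f T'' p'' :
  run M T p n None T' p' -> run mwhile T' p' n' f T'' p'' ->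
  run mwhile T p (n + n'.+1) f T'' p''.
Proof.
move=> [q [k [lek r h]]] [q2 [k2 [lek2 r2 h2]]].
exists q2, (k + k2.+1); split=> //; first lia.
apply: reach_trans (while_reach r) _.
by apply: (@ReachS _ mwhile _ _ _ _ (mq0 M) (T' p') Stay) => //=; rewrite ?h // upd_id.
Qed.
End While.

Definition mseq (G : finType) (M : mach unit) (N : mach G) : mach G :=
  mswitch M (fun _ => N).

Lemma run_seq (G : finType) (M : mach unit) (N : mach G) T p n T' p' n' g T'' p'' :
  run M T p n tt T' p' -> run N T' p' n' g T'' p'' ->
  run (mseq M N) T p (n + n'.+1) g T'' p''.
Proof. by move=> r1 r2; apply: run_switch r1 r2. Qed.

(** * Translation into the given machine model *)

Section ToTM.
Variable M : mach unit.

(** The start state of a [TM] has to be [ord0], while [enum_rank] gives no control over the index of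
    [mq0 M]. So [ord0] is an additional state that decodes to [mq0 M] and is never entered again. *)
Definition dec_state (i : 'I_(#|mQ M|).+1) : mQ M :=
  if unlift ord0 i is Some j then enum_val j else mq0 M.

Definition enc_state (q : mQ M) : 'I_(#|mQ M|).+1 := lift ord0 (enum_rank q).

Lemma enc_stateK q : dec_state (enc_state q) = q.
Proof. by rewrite /dec_state /enc_state liftK enum_rankK. Qed.

Definition tm_of : TM := @Build_TM #|mQ M|
  (fun i => isSome (mhalt (dec_state i)))
  (fun i s => let: (q', w, mv) := mdelta (dec_state i) s in (enc_state q', w, mv)).

Lemma tm_of_reach n c d (i : 'I_(#|mQ M|).+1) : reach n c d -> dec_state i = c.1.1 ->
  exists2 j, dec_state j = d.1.1 &
    iter n (gstep (@tm_halt tm_of) (@tm_delta tm_of)) (i, c.1.2, c.2) = (j, d.1.2, d.2).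
Proof.
move=> r; elim: r i => {n c d} [c|n q T p q' w mv c hq dq _ IH] i /= di.
  by exists i.
have [j dj E] := IH (enc_state q') (enc_stateK q').
exists j => //; rewrite -iterS iterSr -E /=; congr (iter n _ _).
by rewrite di hq dq.
Qed.

Lemma tm_of_computes (f : seq bool -> seq bool) (c k : nat) :
  (forall x, exists n T p, [/\ n <= c * size x ^ k + c,
      run M (word_tape x) 0 n tt T p &
      forall i, i <= size (f x) -> T (p + Z.of_nat i)%Z = onth (f x) i]) ->
  poly_time_computable f.
Proof.
move=> H; exists tm_of, c, k => x.
have [n [T [p [len [q [n' [len' r hq]]] E]]]] := H x.
exists n'; split; first exact: leq_trans len.
have d0 : dec_state ord0 = mq0 M by rewrite /dec_state unlift_none.
have [j dj Ej] := tm_of_reach r d0.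
have [p' Ec] := tm_iter_gstep (tm_init tm_of x) 0 n'.
move: Ec; rewrite tm_init_tape Ej /=.
case: (iter _ _ _) => [[[s l] a] r'] /= [-> ET Ep]; split; first by rewrite dj /= hq.
change (read_word (a :: r') = f x).
apply: read_word_of_tape => i lei; rewrite -E // -ET -{}Ep /tape_of.
case: i lei => [|i] _; zcases; try lia; move=> //= *.
by congr (nth _ _ _); lia.
Qed.
End ToTM.

(** * Walks along the tape with a fixed stride *)

Definition sg (d : bool) : Z := if d then 1%Z else (-1)%Z.
Definition mvd (d : bool) : move := if d then MoveR else MoveL.

Lemma shift_mvd d p : shift (mvd d) p = (p + sg d)%Z.
Proof. by case: d. Qed.

Definition mmove (d : bool) (n : nat) : mach unit :=
  iter n (mseq (mact (fun s => (tt, s, mvd d)))) (mret tt).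

Lemma run_move d n T p : run (mmove d n) T p (2 * n) tt T (p + sg d * Z.of_nat n)%Z.
Proof.
elim: n p => [|n IH] p.
  have -> : (p + sg d * Z.of_nat 0)%Z = p by lia.
  exact: run_ret.
rewrite /mmove iterS -/(mmove d n).
have r1 := @run_act unit (fun s => (tt, s, mvd d)) T p _ _ _ erefl.
rewrite upd_id shift_mvd in r1.
apply: run_le (run_seq r1 (eq_ind _ (fun z => run _ T (p + sg d) _ tt T z) (IH _) _ _)).
  lia.
lia.
Qed.

Definition walk_next (d : bool) (k : nat) (b : bool) : mach (option unit) :=
  if b then mseq (mmove d k) (mret None) else mret (Some tt).
Definition mwalk (d : bool) (k : nat) : mach unit :=
  mwhile (mswitch (mact (fun s => (isSome s, s, Stay))) (walk_next d k)).

Lemma run_walk d k T p m :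
  (forall i, i < m -> isSome (T (p + sg d * Z.of_nat (k * i))%Z)) ->
  T (p + sg d * Z.of_nat (k * m))%Z = None ->
  run (mwalk d k) T p (m * (2 * k + 4) + 2) tt T (p + sg d * Z.of_nat (k * m))%Z.
Proof.
elim: m p => [|m IH] p Hs Hn.
  have E : (p + sg d * Z.of_nat (k * 0))%Z = p by lia.
  rewrite E in Hn *; apply: run_while_stop.
  have r1 := @run_act bool (fun s => (isSome s, s, Stay)) T p _ _ _ erefl.
  rewrite upd_id /= Hn in r1.
  by apply: run_le (run_switch (N := walk_next d k) r1 (run_ret _ _ _)).
have r1 := @run_act bool (fun s => (isSome s, s, Stay)) T p _ _ _ erefl.
have H0 := Hs 0 isT.
have E : (p + sg d * Z.of_nat (k * 0))%Z = p by lia.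
rewrite E in H0; rewrite upd_id /= H0 in r1.
have r2 := run_seq (run_move d k T p) (run_ret (None : option unit) T _).
pose p1 := (p + sg d * Z.of_nat k)%Z.
have Ep i : (p1 + sg d * Z.of_nat (k * i))%Z = (p + sg d * Z.of_nat (k * i.+1))%Z.
  by rewrite mulnS /p1; case: (d); cbn [sg negb]; lia.
have r3 := IH p1; rewrite Ep in r3.
apply: run_le (run_while_next (run_switch (N := walk_next d k) r1 r2) (r3 _ Hn)); first nia.
by move=> i lti; rewrite Ep; apply: Hs.
Qed.

(** * Stacks stored on the tape *)

Definition state := nat -> seq bool.
Definition set (s : state) (j : nat) (l : seq bool) : state :=
  fun i => if i == j then l else s i.

Section Tracks.
Variable K : nat.

(* Stack 0 occupies the cells 0, 1, 2, ...; the stacks 1, ..., K-1 are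
   interleaved with stride K to the left of a gap of blank cells that contains
   the home cell -1 and stops every walk back. *)
Definition tdir (j : nat) : bool := j == 0.
Definition tstr (j : nat) : nat := if j == 0 then 1 else K.
Definition toff (j : nat) : nat := if j == 0 then 1 else K + j.
Definition pos (j i : nat) : Z :=
  (-1 + sg (tdir j) * Z.of_nat (toff j + tstr j * i))%Z.

Definition rep (s : state) (T : tape) : Prop :=
  (forall j i, j < K -> T (pos j i) = onth (s j) i) /\
  (forall z, (- Z.of_nat K - 1 <= z < 0)%Z -> T z = None).

Lemma pos_inj j i j' i' : j < K -> j' < K -> pos j i = pos j' i' -> j = j' /\ i = i'.
Proof.
rewrite /pos /tdir /toff /tstr => jK j'K; case: eqP => [->|nj]; case: eqP => [->|nj']; cbn [sg] => E;
  try lia.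
have {}E : i * K + j = i' * K + j' by lia.
have K0 : 0 < K by lia.
have := f_equal (divn^~ K) E; rewrite !divnMDl // !divn_small // !addn0 => Ei.
by move: E; rewrite Ei; lia.
Qed.

Lemma pos_gap j i z : (- Z.of_nat K - 1 <= z < 0)%Z -> z <> pos j i.
Proof. by rewrite /pos /tdir /toff /tstr; case: eqP => [_|nj]; cbn [sg]; nia. Qed.

Lemma onth_rcons (T : Type) (l : seq T) b i :
  onth (rcons l b) i = if i == size l then Some b else onth l i.
Proof. by elim: l i => [|a l IH] [|i] //=; rewrite ?IH // onth_nth_map nth_nil. Qed.

Lemma onth_size (T : Type) (l : seq T) i : size l <= i -> onth l i = None.
Proof. by elim: l i => [|a l IH] [|i] //= /IH. Qed.

Lemma onth_lt (T : Type) (l : seq T) i : isSome (onth l i) = (i < size l).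
Proof. by elim: l i => [|a l IH] [|i] //=; rewrite IH. Qed.

Lemma rep_push s T j b : j < K -> rep s T ->
  rep (set s j (rcons (s j) b)) (upd T (pos j (size (s j))) (Some b)).
Proof.
move=> jK [Ht Hg]; split=> [j' i j'K|z Hz]; last first.
  by rewrite upd_neq ?Hg //; apply: pos_gap.
rewrite /set /upd; case: Z.eqb_spec => [/pos_inj [] // -> ->|N].
  by rewrite eqxx onth_rcons eqxx.
rewrite Ht //; case: eqP => [Ej|//]; rewrite onth_rcons Ej; case: eqP => [Ei|//].
by case: N; rewrite Ej Ei.
Qed.

Definition popl (l : seq bool) := take (size l).-1 l.

Lemma popl_rcons l b : popl (rcons l b) = l.
Proof. by rewrite /popl size_rcons -cats1 take_size_cat. Qed.

Lemma rep_pop s T j l b : j < K -> rep s T -> s j = rcons l b ->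
  rep (set s j l) (upd T (pos j (size l)) None).
Proof.
move=> jK [Ht Hg] E; split=> [j' i j'K|z Hz]; last first.
  by rewrite upd_neq ?Hg //; apply: pos_gap.
rewrite /set /upd; case: Z.eqb_spec => [/pos_inj [] // -> ->|N].
  by rewrite eqxx onth_size.
rewrite Ht //; case: eqP => [Ej|//]; rewrite Ej E onth_rcons; case: eqP => [Ei|//].
by case: N; rewrite Ej Ei.
Qed.

Definition mgoto (j : nat) : mach unit := mseq (mmove (tdir j) (toff j)) (mwalk (tdir j) (tstr j)).
(** The first stride is unconditional because the cell where the return starts is filled after a
    push and blank after a pop. The walk then stops in the gap, at distance [toff j - tstr j] from
    the home cell. *)
Definition mhome (j : nat) : mach unit :=
  mseq (mmove (~~ tdir j) (tstr j))
  (mseq (mwalk (~~ tdir j) (tstr j)) (mmove (~~ tdir j) (toff j - tstr j))).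

Lemma toff_le j : j < K -> toff j <= 2 * K. 
Proof. by rewrite /toff; case: eqP; lia. Qed.
Lemma tstr_le j : j < K -> tstr j <= K. 
Proof. by rewrite /tstr; case: eqP; lia. Qed.

Lemma run_goto s T j : j < K -> rep s T ->
  run (mgoto j) T (-1) (4 * K + 3 + size (s j) * (2 * K + 4)) tt T (pos j (size (s j))).
Proof.
move=> jK [Ht Hg].
have Ep i : (-1 + sg (tdir j) * Z.of_nat (toff j) +
             sg (tdir j) * Z.of_nat (tstr j * i))%Z = pos j i.
  by rewrite /pos; case: (tdir j); cbn [sg negb]; lia.
have r2 := @run_walk (tdir j) (tstr j) T (-1 + sg (tdir j) * Z.of_nat (toff j))%Z (size (s j)).
rewrite Ep in r2.
have r := run_seq (run_move (tdir j) (toff j) T (-1)) (r2 _ _).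
apply: run_le (r _ _).
- have := toff_le jK; have := tstr_le jK; nia.
- by move=> i lti; rewrite Ep Ht // onth_lt.
- by rewrite Ht // onth_size.
Qed.

Lemma run_home T j m : j < K -> (forall i, i < m -> isSome (T (pos j i))) ->
  (forall z, (- Z.of_nat K - 1 <= z < 0)%Z -> T z = None) ->
  run (mhome j) T (pos j m) (6 * K + 4 + m * (2 * K + 4)) tt T (-1).
Proof.
move=> jK Ht Hg.
have r1 := run_move (~~ tdir j) (tstr j) T (pos j m).
set p1 := (X in run _ _ _ _ _ _ X) in r1.
have Ep i : i < m -> (p1 + sg (~~ tdir j) * Z.of_nat (tstr j * i))%Z = pos j (m - i.+1).
  by move=> lti; rewrite /p1 /pos; case: (tdir j); cbn [sg negb]; nia.
have Em : (p1 + sg (~~ tdir j) * Z.of_nat (tstr j * m))%Z =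
          (-1 + sg (tdir j) * (Z.of_nat (toff j) - Z.of_nat (tstr j)))%Z.
  by rewrite /p1 /pos; case: (tdir j); cbn [sg negb]; nia.
have r2 := @run_walk (~~ tdir j) (tstr j) T p1 m.
have r3 := run_move (~~ tdir j) (toff j - tstr j) T (p1 + sg (~~ tdir j) * Z.of_nat (tstr j * m))%Z.
have Eh : (p1 + sg (~~ tdir j) * Z.of_nat (tstr j * m) +
           sg (~~ tdir j) * Z.of_nat (toff j - tstr j))%Z = (-1)%Z.
  by rewrite Em /toff /tstr; case: (tdir j); cbn [sg negb]; case: eqP; lia.
rewrite Eh in r3.
apply: run_le (run_seq r1 (run_seq (r2 _ _) r3)).
- have := toff_le jK; have := tstr_le jK; nia.
- by move=> i lti; rewrite Ep //; apply: Ht; lia.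
- by rewrite Em Hg // /toff /tstr /tdir; case: eqP; cbn [sg negb]; lia.
Qed.

Definition unit_cost (B : nat) : nat := (40 * K + 60) * (B + 1).

Definition mpush (j : nat) (b : bool) : mach unit :=
  mseq (mgoto j) (mseq (mact (fun _ => (tt, Some b, Stay))) (mhome j)).

Lemma run_push s T j b B : j < K -> rep s T -> size (s j) <= B ->
  exists2 T', rep (set s j (rcons (s j) b)) T' & run (mpush j b) T (-1) (unit_cost B) tt T' (-1).
Proof.
move=> jK R sB; have R' := rep_push b jK R; eexists; first exact: R'.
have r2 := @run_act unit (fun _ => (tt, Some b, Stay)) T (pos j (size (s j))) _ _ _ erefl.
have [Ht Hg] := R'.
have r3 := @run_home _ j (size (s j)) jK _ Hg.
apply: run_le (run_seq (run_goto jK R) (run_seq r2 (r3 _))).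
  rewrite /unit_cost; nia.
by move=> i lti; rewrite Ht // onth_lt /set eqxx size_rcons; lia.
Qed.

Definition pop_next (j : nat) (a : option bool) : mach (option bool) :=
  if a is Some b then mseq (mhome j) (mret (Some b))
  else mseq (mmove (~~ tdir j) (toff j - tstr j)) (mret None).
(** The scanned cell is erased before its content is acted upon. On an empty stack the stride back
    from the bottom ends in the gap, where erasing changes nothing and the blank that is read
    signals emptiness. *)
Definition mpop (j : nat) : mach (option bool) :=
  mseq (mgoto j) (mseq (mmove (~~ tdir j) (tstr j))
  (mswitch (mact (fun a : option bool => (a, None, Stay))) (pop_next j))).

Lemma run_pop_some s T j l b B : j < K -> rep s T -> s j = rcons l b -> size l <= B ->
  exists2 T', rep (set s j l) T' & run (mpop j) T (-1) (unit_cost B) (Some b) T' (-1).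
Proof.
move=> jK R E sB; have R' := rep_pop jK R E; eexists; first exact: R'.
have r1 := run_goto jK R.
have r2 := run_move (~~ tdir j) (tstr j) T (pos j (size (s j))).
have Ep : (pos j (size (s j)) + sg (~~ tdir j) * Z.of_nat (tstr j))%Z = pos j (size l).
  by rewrite E size_rcons /pos; case: (tdir j); cbn [sg negb]; nia.
rewrite Ep in r2.
have r3 := @run_act _ (fun a : option bool => (a, None, Stay)) T (pos j (size l)) _ _ _ erefl.
have EX : T (pos j (size l)) = Some b by case: R => -> // _; rewrite E onth_rcons eqxx.
rewrite EX in r3.
have [Ht Hg] := R'.
have r4 := @run_home _ j (size l) jK _ Hg.
have r := run_seq r1 (run_seq r2 (run_switch (N := pop_next j) r3 (run_seq (r4 _) (run_ret _ _ _)))).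
apply: run_le (r _).
  have := tstr_le jK; rewrite /unit_cost E size_rcons; nia.
by move=> i lti; rewrite Ht // onth_lt /set eqxx.
Qed.

Lemma run_pop_none s T j B : j < K -> rep s T -> s j = [::] ->
  run (mpop j) T (-1) (unit_cost B) None T (-1).
Proof.
move=> jK R E; have r1 := run_goto jK R.
have r2 := run_move (~~ tdir j) (tstr j) T (pos j (size (s j))).
set p1 := (X in run _ _ _ _ _ _ X) in r2.
have Ep : p1 = (-1 + sg (tdir j) * (Z.of_nat (toff j) - Z.of_nat (tstr j)))%Z.
  by rewrite /p1 E /pos muln0 addn0; case: (tdir j); cbn [sg negb]; lia.
have r3 := @run_act _ (fun a : option bool => (a, None, Stay)) T p1 _ _ _ erefl.
have EX : T p1 = None.
  case: R => _ Hg; apply: Hg.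
  by rewrite Ep /toff /tstr /tdir; case: eqP; cbn [sg negb]; lia.
rewrite -{2}EX upd_id EX in r3.
have r4 := run_move (~~ tdir j) (toff j - tstr j) T p1.
have Eh : (p1 + sg (~~ tdir j) * Z.of_nat (toff j - tstr j))%Z = (-1)%Z.
  by rewrite Ep /toff /tstr; case: (tdir j); cbn [sg negb]; case: eqP; lia.
rewrite Eh in r4.
apply: run_le (run_seq r1 (run_seq r2 (run_switch (N := pop_next j) r3 (run_seq r4 (run_ret _ _ _))))).
have := tstr_le jK; have := toff_le jK; rewrite /unit_cost E mul0n; nia.
Qed.

Definition probe_next (v o u : nat) (a : option bool) : mach (option bool) :=
  mseq (mmove true (u + K * o)) (mseq (mmove false v) (mseq (mhome v) (mret a))).
(** Cells of equal height in two stacks on the left lie at a fixed distance, so the cell of stack u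
    at height [size (s v) + o] is reached from the first free cell of stack v by a bounded move.
    This one probe both compares heights (blank or not) and reads a bit at an index given in unary;
    stack 0, on the other side, is excluded. *)
Definition mprobe (v o u : nat) : mach (option bool) :=
  mseq (mgoto v) (mseq (mmove true v) (mseq (mmove false (u + K * o))
  (mswitch (mact (fun a : option bool => (a, a, Stay))) (probe_next v o u)))).

Lemma run_probe s T v (o : bool) u B : 0 < v < K -> 0 < u < K -> rep s T -> size (s v) <= B ->
  run (mprobe v o u) T (-1) (unit_cost B) (onth (s u) (size (s v) + o)) T (-1).
Proof.
move=> /andP [v0 vK] /andP [u0 uK] R sB; have r1 := run_goto vK R.
have r2 := run_move true v T (pos v (size (s v))).
set p2 := (X in run _ _ _ _ _ _ X) in r2.
have r3 := run_move false (u + K * o) T p2.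
set p3 := (X in run _ _ _ _ _ _ X) in r3.
have E3 : p3 = pos u (size (s v) + o).
  rewrite /p3 /p2 /pos /tdir /toff /tstr.
  have -> : (u == 0) = false by lia.
  have -> : (v == 0) = false by lia.
  cbn [sg]; nia.
have r4 := @run_act _ (fun a : option bool => (a, a, Stay)) T p3 _ _ _ erefl.
have [Ht Hg] := R.
have EX : T p3 = onth (s u) (size (s v) + o) by rewrite E3 Ht.
rewrite upd_id /= EX in r4.
have r5 := run_move true (u + K * o) T p3.
have r6 := run_move false v T (p3 + sg true * Z.of_nat (u + K * o))%Z.
have E6 : (p3 + sg true * Z.of_nat (u + K * o) + sg false * Z.of_nat v)%Z = pos v (size (s v)).
  by rewrite /p3 /p2; cbn [sg]; lia.
rewrite E6 in r6.
have r7 := @run_home T v (size (s v)) vK _ Hg.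
have r := run_seq r1 (run_seq r2 (run_seq r3 (run_switch (N := probe_next v o u) r4
  (run_seq r5 (run_seq r6 (run_seq (r7 _) (run_ret _ _ _))))))).
apply: run_le (r _).
  have oK : K * o <= K by case: (o); lia.
  rewrite /unit_cost; nia.
by move=> i lti; rewrite Ht // onth_lt.
Qed.

End Tracks.

(** * A loop language compiled to Turing machines *)

Inductive test :=
  TConst of bool | TLt of bool & nat & nat | TBit of nat & nat
| TNot of test | TAnd of test & test.

Fixpoint teval (t : test) (s : state) : bool :=
  match t with
  | TConst b => b
  | TLt o v u => size (s v) + o < size (s u)
  | TBit v u => onth (s u) (size (s v)) == Some true
  | TNot t => ~~ teval t s
  | TAnd t1 t2 => teval t1 s && teval t2 s
  end.

Fixpoint tcost (t : test) : nat :=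
  match t with
  | TConst _ => 0 | TLt _ _ _ => 1 | TBit _ _ => 1
  | TNot t => (tcost t).+1 | TAnd t1 t2 => (tcost t1 + tcost t2).+1
  end.

Fixpoint twf (K : nat) (t : test) : bool :=
  match t with
  | TConst _ => true
  | TLt _ v u | TBit v u => (0 < v < K) && (0 < u < K)
  | TNot t => twf K t | TAnd t1 t2 => twf K t1 && twf K t2
  end.

(** [For v w] counts with the height of v up to the height of w, and [Unload] consumes a stack and
    branches on its bits. There is no unbounded loop, so meaning and cost are defined by recursion
    on the program. *)
Inductive cmd :=
  Skip | Push of nat & bool | Seq of cmd & cmd | If of test & cmd & cmd
| Unload of nat & cmd & cmd | For of nat & nat & cmd.

Definition push (j : nat) (b : bool) (s : state) : state := set s j (rcons (s j) b).
Definition pop (j : nat) (s : state) : state := set s j (popl (s j)).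

(* The number of rounds of a loop is fixed at its start; [wf] makes this agree
   with the compiled machine, which tests the stacks before every round. *)
Fixpoint exec (c : cmd) (s : state) : state :=
  match c with
  | Skip => s
  | Push j b => push j b s
  | Seq c1 c2 => exec c2 (exec c1 s)
  | If t c1 c2 => if teval t s then exec c1 s else exec c2 s
  | Unload j c0 c1 =>
      foldl (fun s' b => exec (if b then c1 else c0) (pop j s')) s (rev (s j))
  | For v w c =>
      set (iter (size (s w) - size (s v)) (fun s' => push v true (exec c s')) s) v [::]
  end.

Fixpoint iter_cost (A : Type) (F : A -> A) (g : A -> nat) (n : nat) (a : A) : nat :=
  if n is n'.+1 then g a + 3 + iter_cost F g n' (F a) else 0.

Fixpoint fold_cost (A : Type) (F : A -> bool -> A) (g : A -> bool -> nat)
    (l : seq bool) (a : A) : nat :=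
  if l is b :: l' then g a b + 3 + fold_cost F g l' (F a b) else 0.

(** A unit of cost is one [slot] of machine steps. A [For] also pays for clearing its counter, which
    ends at height at most [size (s w) + size (s v)]. *)
Fixpoint cost (c : cmd) (s : state) : nat :=
  match c with
  | Skip => 1
  | Push j b => 1
  | Seq c1 c2 => cost c1 s + cost c2 (exec c1 s) + 1
  | If t c1 c2 => tcost t + (if teval t s then cost c1 s else cost c2 s) + 1
  | Unload j c0 c1 =>
      fold_cost (fun s' b => exec (if b then c1 else c0) (pop j s'))
        (fun s' b => cost (if b then c1 else c0) (pop j s')) (rev (s j)) s + 3
  | For v w c =>
      iter_cost (fun s' => push v true (exec c s')) (cost c) (size (s w) - size (s v)) s
      + size (s w) + size (s v) + 4
  end.

Fixpoint mods (c : cmd) : seq nat :=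
  match c with
  | Skip => [::] | Push j _ => [:: j]
  | Seq c1 c2 | If _ c1 c2 => mods c1 ++ mods c2
  | Unload j c0 c1 => j :: mods c0 ++ mods c1
  | For v _ c => v :: mods c
  end.

Fixpoint wf (K : nat) (c : cmd) : bool :=
  match c with
  | Skip => true
  | Push j _ => j < K
  | Seq c1 c2 => wf K c1 && wf K c2
  | If t c1 c2 => [&& twf K t, wf K c1 & wf K c2]
  | Unload j c0 c1 => [&& j < K, wf K c0, wf K c1 & j \notin mods c0 ++ mods c1]
  | For v w c => [&& 0 < v < K, 0 < w < K, v != w, wf K c,
                     v \notin mods c & w \notin mods c]
  end.

Lemma exec_frame c s r : r \notin mods c -> exec c s r = s r.
Proof.
elim: c s => //= [j b|c1 I1 c2 I2|t c1 I1 c2 I2|j c0 I0 c1 I1|v w c IH] s.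
- by rewrite inE /push /set => /negbTE ->.
- by rewrite mem_cat negb_or => /andP [h1 h2]; rewrite I2 ?I1.
- by rewrite mem_cat negb_or => /andP [h1 h2]; case: ifP; rewrite (I1, I2).
- rewrite inE negb_or mem_cat negb_or => /andP [/negbTE rj /andP [h0 h1]].
  move: (rev (s j)) => l; elim: l s => //= b l IH s; rewrite IH.
  by case: b; rewrite (I0, I1) // /pop /set rj.
- rewrite inE negb_or => /andP [/negbTE rv h]; rewrite /set rv.
  by elim: (size (s w) - size (s v)) => //= n En; rewrite /push /set rv IH.
Qed.

Lemma size_popl l : size (popl l) <= size l.
Proof. by rewrite /popl size_take; case: ifP => //; lia. Qed.

(** Every pushed symbol is paid for by a unit of cost, so the cost bounds the growth of the stacks
    as well as the time. *)
Lemma exec_size c s r : size (exec c s r) <= size (s r) + cost c s.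
Proof.
elim: c s => /= [|j b|c1 I1 c2 I2|t c1 I1 c2 I2|j c0 I0 c1 I1|v w c IH] s.
- lia.
- by rewrite /push /set; case: eqP => [->|_]; rewrite ?size_rcons; lia.
- by have := I1 s; have := I2 (exec c1 s); lia.
- by case: ifP => _; [have := I1 s|have := I2 s]; lia.
- move: (rev (s j)) => l; elim: l s => /= [|b l IH] s; first lia.
  apply: leq_trans (IH _) _.
  suff : size (exec (if b then c1 else c0) (pop j s) r) <=
         size (s r) + cost (if b then c1 else c0) (pop j s) by lia.
  have : size (pop j s r) <= size (s r).
    by rewrite /pop /set; case: eqP => [->|_] //; apply: size_popl.
  by case: b; [have := I1 (pop j s)|have := I0 (pop j s)]; lia.
- rewrite {1}/set; case: eqP => _ /=; first lia.
  suff H n s' : size (iter n (fun s' => push v true (exec c s')) s' r) <=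
      size (s' r) + iter_cost (fun s' => push v true (exec c s')) (cost c) n s'.
    by have := H (size (s w) - size (s v)) s; lia.
  elim: n s' => [|n IHn] s'; first by rewrite /=; lia.
  rewrite iterSr; apply: leq_trans (IHn _) _ => /=.
  suff : size (push v true (exec c s') r) <= size (s' r) + cost c s' + 1 by lia.
  have := IH s'; rewrite /push /set; case: eqP => [->|_]; rewrite ?size_rcons; lia.
Qed.

(** * Compilation of programs *)

Section Compile.
Variable K : nat.

Definition and_next (M : mach bool) (b : bool) : mach bool := if b then M else mret false.

Fixpoint mtest (t : test) : mach bool :=
  match t with
  | TConst b => mret b
  | TLt o v u => mswitch (mprobe K v o u) (fun a => mret (isSome a))
  | TBit v u => mswitch (mprobe K v false u) (fun a => mret (a == Some true))
  | TNot t => mswitch (mtest t) (fun b => mret (~~ b))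
  | TAnd t1 t2 => mswitch (mtest t1) (and_next (mtest t2))
  end.

Lemma run_test t s T B : twf K t -> rep K s T -> (forall j, j < K -> size (s j) <= B) ->
  run (mtest t) T (-1) (tcost t * (unit_cost K B + 3)) (teval t s) T (-1).
Proof.
move=> + R sB; elim: t => /= [b|o v u|v u|t IH|t1 I1 t2 I2].
- by move=> _; exact: run_ret.
- move=> /andP [hv hu]; have r := run_probe o hv hu R (sB v _).
  rewrite -onth_lt.
  apply: run_le (run_switch (N := fun a => mret (isSome a)) (r _) (run_ret _ _ _)); lia.
- move=> /andP [hv hu]; have r := run_probe false hv hu R (sB v _).
  rewrite addn0 in r.
  apply: run_le (run_switch (N := fun a => mret (a == Some true)) (r _) (run_ret _ _ _)); lia.
- move=> /IH r; apply: run_le (run_switch (N := fun b => mret (~~ b)) r (run_ret _ _ _)); lia.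
- move=> /andP [/I1 r1 /I2 r2]; case: (teval t1 s) r1 => r1 /=.
    apply: run_le (run_switch (N := and_next (mtest t2)) r1 r2); lia.
  apply: run_le (run_switch (N := and_next (mtest t2)) r1 (run_ret _ _ _)); lia.
Qed.

Definition if_next (M N : mach unit) (b : bool) : mach unit := if b then M else N.
Definition unload_next (M N : mach unit) (a : option bool) : mach (option unit) :=
  if a is Some b then mseq (if b then N else M) (mret None) else mret (Some tt).
Definition for_next (v : nat) (M : mach unit) (a : option bool) : mach (option unit) :=
  if a is Some b then mseq M (mseq (mpush K v true) (mret None)) else mret (Some tt).

Definition munload (j : nat) (M N : mach unit) : mach unit :=
  mwhile (mswitch (mpop K j) (unload_next M N)).

Fixpoint mcmd (c : cmd) : mach unit :=
  match c with
  | Skip => mret tt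
  | Push j b => mpush K j b
  | Seq c1 c2 => mseq (mcmd c1) (mcmd c2)
  | If t c1 c2 => mswitch (mtest t) (if_next (mcmd c1) (mcmd c2))
  | Unload j c0 c1 => munload j (mcmd c0) (mcmd c1)
  | For v w c => mseq (mwhile (mswitch (mprobe K v false w) (for_next v (mcmd c))))
                      (munload v (mret tt) (mret tt))
  end.

Definition slot (B : nat) : nat := unit_cost K B + 4.

Lemma run_clear s T v B : v < K -> rep K s T -> size (s v) <= B ->
  exists2 T', rep K (set s v [::]) T' &
    run (munload v (mret tt) (mret tt)) T (-1) ((size (s v)).+1 * slot B) tt T' (-1).
Proof.
move=> vK; move E: (s v) => l; elim/last_ind: l s T E => [|l b IH] s T E R sB.
  exists T.
    have -> // : set s v [::] = s.
    by apply: functional_extensionality => i; rewrite /set; case: eqP => // ->.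
  apply: run_while_stop.
  apply: run_le (run_switch (N := unload_next _ _) (run_pop_none B vK R E) (run_ret _ _ _)).
  rewrite /slot; lia.
rewrite size_rcons in sB.
have [T1 R1 r1] := run_pop_some vK R E (ltnW sB).
have [|//||T2 R2 r2] := IH (set s v l) T1; first by rewrite /set eqxx.
  exact: ltnW.
exists T2.
  have <- // : set (set s v l) v [::] = set s v [::].
  by apply: functional_extensionality => i; rewrite /set; case: eqP.
have rb : run (if b then mret tt else mret tt) T1 (-1) 0 tt T1 (-1).
  by case: (b); exact: run_ret.
have r3 := run_switch (N := unload_next (mret tt) (mret tt)) r1
   (run_seq rb (run_ret (None : option unit) _ _)).
apply: run_le (run_while_next r3 r2).
rewrite /slot size_rcons; lia.
Qed.

(** The cost is added to the initial heights because the time of a primitive depends on the current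
    heights: by [exec_size] no stack exceeds B at any moment, and the condition passes to every part
    of the program. *)
Lemma run_cmd c s T B : wf K c -> rep K s T ->
  (forall j, j < K -> size (s j) + cost c s <= B) ->
  exists2 T', rep K (exec c s) T' & run (mcmd c) T (-1) (cost c s * slot B) tt T' (-1).
Proof.
elim: c s T => /= [|j b|c1 I1 c2 I2|t c1 I1 c2 I2|j c0 I0 c1 I1|v w c IH] s T.
- by move=> _ R _; exists T => //; apply: run_le (run_ret _ _ _); lia.
- move=> jK R sB; have [|T' R' r'] := @run_push K s T j b B jK R.
    by have := sB j jK; lia.
  by exists T' => //; apply: run_le r'; rewrite /slot; lia.
- move=> /andP [w1 w2] R sB.
  have [|T1 R1 r1] := I1 s T w1 R; first by move=> j jK; have := sB j jK; lia.
  have [|T2 R2 r2] := I2 _ T1 w2 R1.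
    by move=> j jK; have := sB j jK; have := exec_size c1 s j; lia.
  exists T2 => //; apply: run_le (run_seq r1 r2); rewrite /slot; nia.
- move=> /and3P [wt w1 w2] R sB.
  have rt : run (mtest t) T (-1) (tcost t * (unit_cost K B + 3)) (teval t s) T (-1).
    by apply: run_test => // j jK; have := sB j jK; lia.
  case: (teval t s) sB rt => sB rt.
    have [|T1 R1 r1] := I1 s T w1 R; first by move=> j jK; have := sB j jK; lia.
    exists T1 => //; apply: run_le (run_switch (N := if_next _ _) rt r1); rewrite /slot; nia.
  have [|T1 R1 r1] := I2 s T w2 R; first by move=> j jK; have := sB j jK; lia.
  exists T1 => //; apply: run_le (run_switch (N := if_next _ _) rt r1); rewrite /slot; nia.
- move=> /and4P [jK w0 w1]; rewrite mem_cat negb_or => /andP [j0 j1] R sB.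
  set F := fun (s' : state) b => _; set g := fun (s' : state) b => _.
  suff H l : forall s T, rev (s j) = l -> rep K s T ->
     (forall i, i < K -> size (s i) + (fold_cost F g l s + 3) <= B) ->
     exists2 T', rep K (foldl F s l) T' &
       run (munload j (mcmd c0) (mcmd c1)) T (-1) ((fold_cost F g l s + 3) * slot B) tt T' (-1).
    exact: H.
  elim: l {s T R sB} => [|b l IH] s T E R sB /=.
    exists T => //; apply: run_while_stop.
    have {}E : s j = [::] by rewrite -[s j]revK E.
    apply: run_le (run_switch (N := unload_next _ _) (run_pop_none B jK R E) (run_ret _ _ _)).
    rewrite /slot; lia.
  have {}E : s j = rcons (rev l) b by rewrite -[s j]revK E rev_cons.
  have sl : size (rev l) <= B by have := sB j jK; rewrite E size_rcons; lia.
  have [T1 R1 r1] := run_pop_some jK R E sl.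
  have E1 : set s j (rev l) = pop j s by rewrite /pop E popl_rcons.
  rewrite E1 in R1.
  have Ic : exists2 T', rep K (F s b) T' &
      run (if b then mcmd c1 else mcmd c0) T1 (-1) (g s b * slot B) tt T' (-1).
    have Hs i : i < K -> size (pop j s i) + g s b <= B.
      move=> iK; have := sB i iK; rewrite /= /pop /set.
      by case: eqP => [->|_]; [have := size_popl (s j)|]; lia.
    by rewrite /F; case: (b) Hs => Hs; [apply: I1|apply: I0].
  have [T2 R2 r2] := Ic.
  (* By well-formedness the branches leave stack j alone, so the rounds still to be done are the
     contents of the stack. *)
  have E2 : rev (F s b j) = l.
    rewrite /F; have -> : exec (if b then c1 else c0) (pop j s) j = pop j s j.
      by case: (b); rewrite exec_frame.
    by rewrite -E1 /set eqxx revK.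
  have [|T3 R3 r3] := IH (F s b) T2 E2 R2.
    move=> i iK; have := sB i iK => /=.
    have : size (F s b i) <= size (pop j s i) + g s b.
      by rewrite /F /g; apply: exec_size.
    have : size (pop j s i) <= size (s i).
      by rewrite /pop /set; case: eqP => [->|_] //; apply: size_popl.
    lia.
  exists T3 => //.
  have r4 := run_switch (N := unload_next (mcmd c0) (mcmd c1)) r1
    (run_seq r2 (run_ret (None : option unit) _ _)).
  apply: run_le (run_while_next r4 r3); rewrite /slot; nia.
- move=> /and5P [/andP [v0 vK] hw vw wc /andP [vc wmc]] R sB.
  set F := (fun s' : state => push v true (exec c s')) in sB *.
  have Fv s' : F s' v = rcons (s' v) true.
    by rewrite /F /push /set eqxx exec_frame.
  have Fw s' : F s' w = s' w.
    by rewrite /F /push /set eq_sym (negbTE vw) exec_frame.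
  have [wK0 wK] := andP hw.
  have H n : forall s T, size (s w) - size (s v) = n -> rep K s T ->
     (forall i, i < K -> size (s i) + iter_cost F (cost c) n s <= B) ->
     exists2 T', rep K (iter n F s) T' &
       run (mwhile (mswitch (mprobe K v false w) (for_next v (mcmd c)))) T (-1)
         ((iter_cost F (cost c) n s + 1) * slot B) tt T' (-1).
    elim: n {s T R sB} => [|n IHn] s T E R sB.
      exists T => //; apply: run_while_stop.
      have := @run_probe K s T v false w B _ hw R; rewrite v0 vK => /(_ isT) r.
      have {}r := r _; rewrite addn0 onth_size in r; last lia.
      apply: run_le (run_switch (N := for_next _ _) (r _) (run_ret _ _ _)).
        rewrite /slot; lia.
      by have := sB v vK; lia.
    have := @run_probe K s T v false w B _ hw R; rewrite v0 vK => /(_ isT) r.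
    have {}r := r _; rewrite addn0 in r.
    have : isSome (onth (s w) (size (s v))) by rewrite onth_lt; lia.
    case Eo: onth r => [b|//] r _.
    have [|T1 R1 r1] := IH s T wc R.
      by move=> i iK; have := sB i iK => /=; lia.
    have [|T2 R2 r2] := run_push true vK R1 (B := B).
      by have := sB v vK; have := exec_size c s v => /=; lia.
    have E2 : size (F s w) - size (F s v) = n by rewrite Fv Fw size_rcons; lia.
    have [|T3 R3 r3] := IHn (F s) T2 E2 R2.
      move=> i iK; have := sB i iK; rewrite /=.
      have : size (F s i) <= size (s i) + cost c s + 1.
        have := exec_size c s i; rewrite /F /push /set.
        by case: eqP => [->|_]; rewrite ?size_rcons; lia.
      lia.
    rewrite iterSr; exists T3 => //.
    have r4 := run_switch (N := for_next v (mcmd c)) (r _)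
      (run_seq r1 (run_seq r2 (run_ret (None : option unit) _ _))).
    apply: run_le (run_while_next (r4 _) r3); first by rewrite /slot /=; nia.
    by have := sB v vK; lia.
  have [|T1 R1 r1] := H _ s T erefl R.
    by move=> i iK; have := sB i iK; lia.
  have Sv n : size (iter n F s v) = size (s v) + n.
    by elim: n => [|n IHn] /=; rewrite ?addn0 // Fv size_rcons IHn; lia.
  have [|T2 R2 r2] := @run_clear _ T1 v B vK R1.
    by rewrite Sv; have := sB v vK; have := sB w wK; lia.
  exists T2 => //; apply: run_le (run_seq r1 r2).
  by rewrite Sv /slot; nia.
Qed.

End Compile.

(** * Polynomially bounded functions *)

Definition polyb (g : nat -> nat) : Prop :=
  exists c k, forall n, g n <= c * n.+1 ^ k.

Lemma polyb_le f g : (forall n, f n <= g n) -> polyb g -> polyb f.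
Proof. by move=> fg [c [k H]]; exists c, k => n; apply: leq_trans (fg n) (H n). Qed.

Lemma polyb_const a : polyb (fun _ => a).
Proof. by exists a, 0 => n; rewrite expn0 muln1. Qed.

Lemma polyb_id : polyb id.
Proof. by exists 1, 1 => n; rewrite expn1 mul1n. Qed.

Lemma polyb_add f g : polyb f -> polyb g -> polyb (fun n => f n + g n).
Proof.
move=> [c [k H]] [d [l G]]; exists (c + d), (k + l) => n.
rewrite mulnDl leq_add //.
  by apply: leq_trans (H n) _; rewrite leq_mul2l leq_pexp2l ?orbT // leq_addr.
by apply: leq_trans (G n) _; rewrite leq_mul2l leq_pexp2l ?orbT // leq_addl.
Qed.

Lemma polyb_mul f g : polyb f -> polyb g -> polyb (fun n => f n * g n).
Proof.
move=> [c [k H]] [d [l G]]; exists (c * d), (k + l) => n.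
by rewrite expnD mulnACA leq_mul.
Qed.

Lemma leq_expl m n k : m <= n -> m ^ k <= n ^ k.
Proof. by case: k => // k mn; rewrite leq_exp2r. Qed.

Lemma polyb_comp f g : polyb f -> polyb g -> polyb (fun n => f (g n)).
Proof.
move=> [c [k H]] [d [l G]]; exists (c * d.+1 ^ k), (l * k) => n.
apply: leq_trans (H _) _; rewrite -mulnA leq_mul2l expnM -expnMn leq_expl ?orbT //.
have : 0 < n.+1 ^ l by rewrite expn_gt0.
have := G n; nia.
Qed.

Lemma polyb_exp f k : polyb f -> polyb (fun n => f n ^ k).
Proof.
move=> pf; elim: k => [|k IH]; first exact: polyb_const.
by apply: polyb_le (polyb_mul pf IH) => n; rewrite expnS.
Qed.

(** The form with [n.+1] is closed under sums and products because its base is positive; the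
    constant term of the target form takes care of n = 0. *)
Lemma polyb_standard g : polyb g -> exists c k, forall n, g n <= c * n ^ k + c.
Proof.
move=> [c [k H]]; exists (c * 2 ^ k), k => -[|n].
  have : 0 < 2 ^ k by rewrite expn_gt0.
  by have := H 0; rewrite exp1n; nia.
apply: leq_trans (H _) _; apply: leq_trans (leq_addr _ _).
by rewrite -mulnA leq_mul2l -expnMn leq_expl ?orbT //; lia.
Qed.

(** * Cost bounds from the heights of the controlling stacks *)

Fixpoint pushes (c : cmd) : seq nat :=
  match c with
  | Skip => [::] | Push j _ => [:: j]
  | Seq c1 c2 | If _ c1 c2 | Unload _ c1 c2 => pushes c1 ++ pushes c2
  | For _ _ c => pushes c
  end.

Fixpoint bounds (c : cmd) : seq nat :=
  match c with
  | Skip | Push _ _ => [::]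
  | Seq c1 c2 | If _ c1 c2 => bounds c1 ++ bounds c2
  | Unload j c1 c2 => j :: bounds c1 ++ bounds c2
  | For v w c => v :: w :: bounds c
  end.

(** A polynomial in a single bound V for all stacks that control a loop; an [If] is charged for both
    branches. *)
Fixpoint scost (c : cmd) (V : nat) : nat :=
  match c with
  | Skip | Push _ _ => 1
  | Seq c1 c2 => scost c1 V + scost c2 V + 1
  | If t c1 c2 => tcost t + (scost c1 V + scost c2 V) + 1
  | Unload j c1 c2 => V * (scost c1 V + scost c2 V + 3) + 3
  | For v w c => V * (scost c V + 3) + (V + V) + 4
  end.

Lemma polyb_scost c : polyb (scost c).
Proof.
have A := polyb_add; have C := polyb_const; have M := polyb_mul.
elim: c => /= [|j b|c1 I1 c2 I2|t c1 I1 c2 I2|j c0 I0 c1 I1|v w c IH]; try exact: C.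
- by apply: (A _ _ (A _ _ _ _)).
- by apply: (A _ _ (A _ _ _ (A _ _ _ _))).
- by apply: (A _ _ (M _ _ polyb_id (A _ _ (A _ _ _ _) _))).
- by apply: (A _ _ (A _ _ (M _ _ polyb_id (A _ _ _ _)) (A _ _ polyb_id polyb_id))).
Qed.

Lemma exec_nongrowing c s r : r \notin pushes c -> size (exec c s r) <= size (s r).
Proof.
elim: c s => //= [j b|c1 I1 c2 I2|t c1 I1 c2 I2|j c0 I0 c1 I1|v w c IH] s.
- by rewrite inE /push /set => /negbTE ->.
- by rewrite mem_cat negb_or => /andP [h1 h2]; apply: leq_trans (I2 _ h2) (I1 _ h1).
- by rewrite mem_cat negb_or => /andP [h1 h2]; case: ifP => _; [apply: I1|apply: I2].
- rewrite mem_cat negb_or => /andP [h0 h1].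
  move: (rev (s j)) => l; elim: l s => //= b l IH s; apply: leq_trans (IH _) _.
  have : size (pop j s r) <= size (s r).
    by rewrite /pop /set; case: eqP => [->|_] //; apply: size_popl.
  by apply: leq_trans; case: b; [apply: I1|apply: I0].
- move=> h; rewrite /set; case: eqP => // rv.
  elim: (size (s w) - size (s v)) => //= n En; apply: leq_trans En.
  by rewrite /push /set; case: eqP => // _; apply: IH.
Qed.

(** A stack that controls a loop is never the target of a [Push], so it does not grow and V remains
    a bound for it inside nested loops. Counters do grow, up to the height of their limit, but they
    are cleared on exit; for this reason [pushes] does not list them. *)
Lemma cost_scost K c V s : wf K c -> (forall r, r \in bounds c -> r \notin pushes c) ->
  (forall r, r \in bounds c -> size (s r) <= V) -> cost c s <= scost c V.
Proof.
elim: c s => //= [c1 I1 c2 I2|t c1 I1 c2 I2|j c0 I0 c1 I1|v w c IH] s.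
- move=> /andP [w1 w2] d b.
  have d1 r : r \in bounds c1 -> r \notin pushes c1.
    by move=> h; have := d r; rewrite !mem_cat h negb_or => /(_ isT) /andP [].
  have d2 r : r \in bounds c2 -> r \notin pushes c1 /\ r \notin pushes c2.
    by move=> h; have := d r; rewrite !mem_cat h orbT negb_or => /(_ isT) /andP [].
  rewrite leq_add2r leq_add //.
    by apply: I1 => // r h; apply: b; rewrite mem_cat h.
  apply: (I2 _ w2 (fun r h => (d2 r h).2)) => r h.
  by apply: leq_trans (exec_nongrowing _ (d2 r h).1) _; apply: b; rewrite mem_cat h orbT.
- move=> /and3P [_ w1 w2] d b.
  have h1 : cost c1 s <= scost c1 V.
    apply: I1 => // r h; last by apply: b; rewrite mem_cat h.
    by have := d r; rewrite !mem_cat h negb_or => /(_ isT) /andP [].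
  have h2 : cost c2 s <= scost c2 V.
    apply: I2 => // r h; last by apply: b; rewrite mem_cat h orbT.
    by have := d r; rewrite !mem_cat h orbT negb_or => /(_ isT) /andP [].
  by case: ifP => _; lia.
- move=> /and4P [_ w0 w1 _] d b.
  have d0 r : r \in bounds c0 -> r \notin pushes c0 ++ pushes c1.
    by move=> h; apply: d; rewrite inE mem_cat h orbT.
  have d1 r : r \in bounds c1 -> r \notin pushes c0 ++ pushes c1.
    by move=> h; apply: d; rewrite inE mem_cat h !orbT.
  set F := (X in fold_cost X); set g := (X in fold_cost _ X).
  suff H l s' : (forall r, r \in bounds c0 ++ bounds c1 -> size (s' r) <= V) ->
      fold_cost F g l s' <= size l * (scost c0 V + scost c1 V + 3).
    rewrite leq_add2r; apply: leq_trans (H _ _ _) _.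
      by move=> r h; apply: b; rewrite inE h orbT.
    by rewrite size_rev leq_mul2r b ?orbT ?inE ?eqxx.
  elim: l s' => //= a l IH s' bs'.
  have bp r : r \in bounds c0 ++ bounds c1 -> size (pop j s' r) <= V.
    move=> /bs'; rewrite /pop /set; case: eqP => [->|_] // h.
    exact: leq_trans (size_popl _) h.
  have h1 : g s' a <= scost c0 V + scost c1 V.
    rewrite /g; case: (a).
      apply: leq_trans (leq_addl _ _); apply: I1 => // r h.
        by have := d1 _ h; rewrite mem_cat negb_or => /andP [].
      by apply: bp; rewrite mem_cat h orbT.
    apply: leq_trans (leq_addr _ _); apply: I0 => // r h.
      by have := d0 _ h; rewrite mem_cat negb_or => /andP [].
    by apply: bp; rewrite mem_cat h.
  rewrite mulSn; apply: leq_add; first by rewrite leq_add2r.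
  apply: IH => r h; apply: leq_trans (bp r h).
  have : r \notin pushes c0 ++ pushes c1.
    by apply: d; rewrite inE h orbT.
  by rewrite mem_cat negb_or /F => /andP [n0 n1]; case: (a); apply: exec_nongrowing.
- move=> /and5P [_ _ vw wc /andP [vc wmc]] d b.
  have bv : size (s v) <= V by apply: b; rewrite inE eqxx.
  have bw : size (s w) <= V by apply: b; rewrite !inE eqxx orbT.
  set F := (X in iter_cost X).
  have Fv s' : size (F s' v) = (size (s' v)).+1.
    by rewrite /F /push /set eqxx exec_frame // size_rcons.
  have Fw s' : F s' w = s' w.
    by rewrite /F /push /set eq_sym (negbTE vw) exec_frame.
  (* The counter v is exempt from the bound on the other stacks: its height plus the number of
     remaining rounds stays at most V. *)
  suff H n s' : (forall r, r \in bounds c -> r != v -> size (s' r) <= V) ->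
      size (s' v) + n <= V ->
      iter_cost F (cost c) n s' <= n * (scost c V + 3).
    have : iter_cost F (cost c) (size (s w) - size (s v)) s <= V * (scost c V + 3).
      case: (leqP (size (s w)) (size (s v))) => hvw.
        by have -> : size (s w) - size (s v) = 0 by lia.
      apply: leq_trans (H _ _ _ _) _.
      - by move=> r h _; apply: b; rewrite !inE h !orbT.
      - lia.
      - by rewrite leq_mul2r; apply/orP; right; lia.
    lia.
  elim: n s' => //= n IHn s' bs bn.
  have h1 : cost c s' <= scost c V.
    apply: IH => // r h; first by apply: d; rewrite !inE h !orbT.
    by case: (eqVneq r v) => [->|rv]; [lia|apply: bs].
  rewrite mulSn; apply: leq_add; first lia.
  apply: IHn; last by rewrite Fv; lia.
  move=> r h rv; apply: leq_trans (bs r h rv).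
  rewrite /F /push /set (negbTE rv); apply: exec_nongrowing.
  by apply: d; rewrite !inE h !orbT.
Qed.

Definition init_state (x : seq bool) : state := set (fun _ => [::]) 0 x.

Lemma rep_init K x : 0 < K -> rep K (init_state x) (word_tape x).
Proof.
move=> K0; split=> [j i jK|z Hz]; rewrite /word_tape; last by zcases => //; lia.
rewrite /pos /tdir /toff /tstr /init_state /set; case: eqP => [_|nj]; cbn [sg].
  zcases; first lia.
  by move=> _; congr onth; lia.
by zcases; [rewrite onth_size|nia].
Qed.

(** The machine steps from cell 0 to the home cell, runs the program and steps back, so the head
    ends at the bottom of stack 0 and the output is read from there. Heights never exceed [n + g n],
    which makes the time polynomial. *)
Theorem cmd_poly_time K c (g : nat -> nat) : 0 < K -> wf K c -> polyb g ->
  (forall x, cost c (init_state x) <= g (size x)) ->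
  poly_time_computable (fun x => exec c (init_state x) 0).
Proof.
move=> K0 wc pg hg.
pose M := mseq (mmove false 1) (mseq (mcmd K c) (mmove true 1)).
pose time n := g n * slot K (n + g n) + 6.
have pt : polyb time.
  apply: polyb_add (polyb_const _); apply: polyb_mul => //.
  rewrite /slot /unit_cost; apply: polyb_add (polyb_const _).
  apply: polyb_mul (polyb_const _) (polyb_add _ (polyb_const _)).
  exact: polyb_add polyb_id pg.
have [a [k ht]] := polyb_standard pt.
apply: (@tm_of_computes M _ a k) => x.
have [|T R r] := @run_cmd K c (init_state x) (word_tape x)
    (size x + g (size x)) wc (rep_init x K0).
  by move=> j jK; rewrite leq_add //; rewrite /init_state /set; case: ifP.
exists (time (size x)), T, 0%Z; split; first exact: ht.
  have r0 : run (mmove false 1) (word_tape x) 0 2 tt (word_tape x) (-1).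
    exact: run_move.
  have r1 : run (mmove true 1) T (-1) 2 tt T 0 by exact: run_move.
  apply: run_le (run_seq r0 (run_seq r r1)).
  rewrite /time; have := hg x; nia.
move=> i _; have [Ht _] := R; rewrite -(Ht 0 i K0); congr T.
by rewrite /pos /tdir /toff /tstr eqxx; cbn [sg]; lia.
Qed.

(** * Path models of incidence split graphs *)

Section Trees.
Variables (m : nat) (T : rel 'I_m).
Hypothesis treeT : is_tree T.

Definition noedge (a b : 'I_m) : rel 'I_m :=
  fun x y => T x y && ~~ ((x == a) && (y == b) || (x == b) && (y == a)).

Definition within (A : pred 'I_m) : rel 'I_m := fun x y => [&& T x y, A x & A y].

Lemma T_sym : symmetric T. Proof. by case: treeT => -[]. Qed.
Lemma T_irr : irreflexive T. Proof. by case: treeT => -[]. Qed.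

Lemma connect_mono (e e' : rel 'I_m) : subrel e e' -> subrel (connect e) (connect e').
Proof. by move=> ee' x y; apply: connect_sub => u v /ee' /connect1. Qed.

Lemma within_csym A : connect_sym (within A).
Proof. by apply: sym_connect_sym => x y; rewrite /within T_sym [A x && _]andbC. Qed.

(** Otherwise a simple path from a to b that avoids the edge ab closes a cycle with it. *)
Lemma tree_bridge a b : T a b -> ~~ connect (noedge a b) a b.
Proof.
move=> Tab; apply/negP => /connectP [p pp lp].
case/shortenP: pp lp => q pq uq _ lq; case: treeT => _ _; apply.
exists a, q; split=> //.
- case: q pq lq uq => [|y [|z q]] //= => [_ E|/andP [h _] E]; first by rewrite E T_irr in Tab.
  by move: h; rewrite -E /noedge !eqxx andbF.
- by apply: sub_path pq => x y /andP [].
- by rewrite -lq T_sym.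
Qed.

Lemma within_noedge (A : pred 'I_m) a b :
  ~~ A a || ~~ A b -> subrel (within A) (noedge a b).
Proof.
move=> h x y /and3P [Txy Ax Ay]; rewrite /noedge Txy /=.
by apply: contraTN h => /orP [] /andP [/eqP <- /eqP <-]; rewrite Ax Ay.
Qed.

Lemma sub_within (A B : pred 'I_m) : subpred A B -> subrel (within A) (within B).
Proof. by move=> AB x y /and3P [Txy /AB Bx /AB By]; rewrite /within Txy Bx. Qed.

Lemma tree_pathE p : tree_path T p = [&& p != [::], uniq p & sorted T p].
Proof. by case: p => [|x p]. Qed.

Lemma tree_path_connected p a b : sorted T p -> a \in p -> b \in p ->
  connect (within (mem p)) a b.
Proof.
case: p => [//|x q] /= pq ha hb.
have pq' : path (within (mem (x :: q))) x q.
  apply: (sub_in_path (P := mem (x :: q)) _ _ pq); last by apply/allP => u.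
  by move=> u v hu hv Tuv; apply/and3P; split.
have C := path_connect pq'.
by apply: connect_trans (C _ hb); rewrite within_csym; apply: C.
Qed.

(** Let w be the predecessor of y on p. A connection of x with z off y, extended along p from w to x
    and from z to y, would join w with y without the edge wy, which is a bridge. *)
Lemma tree_sep p x y z : tree_path T p ->
  index x p < index y p < index z p -> z \in p -> ~~ connect (within (predC1 y)) x z.
Proof.
rewrite tree_pathE => /and3P [_ up sp] /andP [xy yz] hz; apply/negP => xz.
have hy : y \in p by rewrite -index_mem; apply: ltn_trans yz _; rewrite index_mem.
have hx : x \in p by rewrite -index_mem; apply: ltn_trans xy _; rewrite index_mem.
case/splitPr: hy up sp xy yz hx hz => p1 p2 up sp xy yz hx hz.
move: up; rewrite cat_uniq /= => /and4P [u1 /norP [yp1 d12] yp2 u2].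
have iy : index y (p1 ++ y :: p2) = size p1.
  by rewrite index_cat (negbTE yp1) /= eqxx addn0.
have x1 : x \in p1.
  move: xy; rewrite iy index_cat; case: ifP => // _; lia.
have z2 : z \in p2.
  move: yz; rewrite iy index_cat; case: ifP => hz1.
    by move: hz1; rewrite -index_mem; lia.
  by move: hz; rewrite mem_cat hz1 inE /=; case: eqP => [->|//]; rewrite /= eqxx; lia.
case/lastP: p1 sp u1 yp1 d12 x1 {xy yz iy hx hz} => [|p0 w] // sp u1 yp1 d12 x1.
have s1 : sorted T (rcons p0 w) by case: (cat_sorted2 sp).
have s2 : sorted T (y :: p2) by case: (cat_sorted2 sp).
have Twy : T w y.
  by move: sp; rewrite cat_rcons => /cat_sorted2 [_] /= /andP [].
have := tree_bridge Twy; apply/negP/negPn.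
have wp2 : w \notin y :: p2.
  rewrite inE negb_or; apply/andP; split.
    by apply: contraNneq yp1 => <-; rewrite mem_rcons inE eqxx.
  by apply: contra d12 => h; apply/hasP; exists w => //; rewrite mem_rcons inE eqxx.
apply: connect_trans (connect_trans (_ : connect _ w x) (_ : connect _ x z)) (_ : connect _ z y).
- apply: connect_mono (within_noedge _) _ _ (tree_path_connected s1 _ x1).
    by rewrite /= yp1 orbT.
  by rewrite mem_rcons inE eqxx.
- by apply: connect_mono (within_noedge _) _ _ xz; rewrite /= eqxx orbT.
- apply: connect_mono (within_noedge _) _ _ (tree_path_connected s2 _ _).
  + by rewrite /= wp2.
  + by rewrite inE z2 orbT.
  + by rewrite inE eqxx.
Qed.

Lemma last_exit (I : pred 'I_m) x q : path T x q -> has I (x :: q) -> ~~ I (last x q) ->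
  exists a b q', [/\ I a, T a b, path T b q', last b q' = last x q & ~~ has I (b :: q')].
Proof.
elim: q x => [|y q IH] x /=; first by rewrite orbF => _ ->.
move=> /andP [Txy pq] hI nl; case: (boolP (has I (y :: q))) => [h|nh].
  by have [a [b [q' [? ? ? ? ?]]]] := IH y pq h nl; exists a, b, q'.
by exists x, y, q; split=> //; move: hI nh => /= /orP [|->].
Qed.

(* A path from a point common to the first paths to the next path P' leaves
   their intersection along an edge ab; the path P missing b and meeting P'
   would close a cycle through that edge. *)
Lemma helly (Ps : seq (seq 'I_m)) :
  (forall p, p \in Ps -> tree_path T p) ->
  (forall p q, p \in Ps -> q \in Ps -> exists2 x, x \in p & x \in q) ->
  exists c, forall p, p \in Ps -> c \in p.
Proof.
have [_ [m0 conT] _] := treeT.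
elim: Ps => [|P' Ps IH] tp cap; first by exists (Ordinal m0).
have [||i0 hi0] := IH.
- by move=> p hp; apply: tp; rewrite inE hp orbT.
- by move=> p q hp hq; apply: cap; rewrite inE (hp, hq) orbT.
pose I x := all (fun p : seq 'I_m => x \in p) Ps.
suff [c cP' cI] : exists2 c, c \in P' & I c.
  by exists c => p; rewrite inE => /orP [/eqP -> //|hp]; apply: (allP cI).
have [||z0 z0P' _] := cap P' P'; rewrite ?inE ?eqxx //.
case: (boolP (I z0)) => [|nz0]; first by exists z0.
have [q pq lq] := connectP (conT i0 z0).
have [||a [b [q' [Ia Tab pq' lq' nq']]]] := @last_exit I i0 q pq.
- by apply/hasP; exists i0; rewrite ?inE ?eqxx //; apply/allP.
- by rewrite -lq.
case: (boolP (a \in P')) => aP'; first by exists a.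
have [P hP bP] : exists2 P, P \in Ps & b \notin P.
  move: nq' => /= /norP [nb _]; move: nb; rewrite /I -has_predC => /hasP [P hP h].
  by exists P.
have [z zP zP'] : exists2 z, z \in P & z \in P'.
  by apply: cap; rewrite inE ?eqxx // hP orbT.
have aP : a \in P by apply: (allP Ia).
have sP : sorted T P.
  by have := tp P; rewrite inE hP orbT tree_pathE => /(_ isT) /and3P [].
have sP' : sorted T P'.
  by have := tp P'; rewrite inE eqxx tree_pathE => /(_ isT) /and3P [].
exfalso; have := tree_bridge Tab; apply/negP/negPn.
apply: connect_trans (connect_trans (_ : connect _ a z) (_ : connect _ z z0)) (_ : connect _ z0 b).
- by apply: connect_mono (within_noedge _) _ _ (tree_path_connected sP aP zP); rewrite /= bP orbT.
- by apply: connect_mono (within_noedge _) _ _ (tree_path_connected sP' zP' z0P'); rewrite /= aP'.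
- have sq : sorted T (b :: q') by [].
  have z0q : z0 \in b :: q' by rewrite lq -lq' mem_last.
  have bq : b \in b :: q' by rewrite inE eqxx.
  apply: connect_mono (within_noedge _) _ _ (tree_path_connected sq z0q bq).
  apply/orP; left; apply: contra nq' => h; apply/hasP; by exists a.
Qed.
End Trees.

(** * From path models to colourings *)

Definition incidence (n : nat) (e : rel 'I_n) (K : pred 'I_n) (src tgt : 'I_n -> 'I_n) :=
  [/\ irreflexive e,
      forall u v, K u -> K v -> u != v -> e u v,
      forall u v, ~~ K u -> ~~ K v -> ~~ e u v,
      forall k s, K k -> ~~ K s ->
        e k s = ((s == src k) || (s == tgt k)) /\ e s k = e k s
    & forall k, K k -> [/\ ~~ K (src k), ~~ K (tgt k) & src k != tgt k]].

(** Beyond the absence of domination this asks for a second stable vertex; it keeps the common node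
    of the clique off all stable paths and gives every stable vertex a neighbour. *)
Definition undominated (n : nat) (e : rel 'I_n) (K : pred 'I_n) :=
  (forall s s', ~~ K s -> ~~ K s' -> s != s' -> exists2 k, K k & e k s && ~~ e k s') /\
  (forall s, ~~ K s -> exists2 s', ~~ K s' & s' != s).

Definition colorable (n : nat) (K : pred 'I_n) (src tgt : 'I_n -> 'I_n) (h : nat) :=
  exists col : 'I_n -> nat, (forall s, ~~ K s -> col s < h) /\
    (forall k, K k -> col (src k) != col (tgt k)).

(* The paths of the clique share a node c; the colour of a stable vertex is the
   branch at c that contains its path. *)
Lemma h21_colorable n e K src tgt h :
  @incidence n e K src tgt -> undominated e K -> in_h21 h e -> colorable K src tgt h.
Proof.
move=> [irr KK SS KS ends] [nd two] [m [T [P [treeT degT [tpP eP]]]]].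
have meet u v x : u != v -> x \in P u -> x \in P v -> e u v.
  by move=> uv xu xv; rewrite eP //; apply/hasP; exists x.
have KnS k s : K k -> ~~ K s -> k != s by move=> Kk; apply: contraNneq => <-.
have Pne v : exists x, x \in P v.
  by have := tpP v; case: (P v) => [//|x q] _; exists x; rewrite inE eqxx.
have [c hc] : exists c, forall k, K k -> c \in P k.
  have [||c hc] := @helly m T treeT [seq P k | k <- enum 'I_n & K k].
  - by move=> p /mapP [k _ ->].
  - move=> p q /mapP [k + ->] /mapP [l + ->]; rewrite !mem_filter => /andP [Kk _] /andP [Kl _].
    case: (eqVneq k l) => [->|kl]; first by have [x hx] := Pne l; exists x.
    by have := KK _ _ Kk Kl kl; rewrite eP // => /hasP [x xl xk]; exists x.
  by exists c => k Kk; apply/hc/map_f; rewrite mem_filter Kk mem_enum.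
(* A stable path through c would meet every clique path, but some clique vertex sees another stable
   vertex s' and not s. *)
have cS s : ~~ K s -> c \notin P s.
  move=> Ks; have [s' Ks' ss'] := two s Ks; have [k Kk /andP [_]] := nd _ _ Ks' Ks ss'.
  by apply: contra => cs; apply: meet (KnS _ _ Kk Ks) (hc k Kk) cs.
pose av := within T (predC1 c).
pose P0 s := head c (P s).
have P0in s : P0 s \in P s by have := tpP s; rewrite /P0; case: (P s) => //= x q; rewrite inE eqxx.
have inS s x : ~~ K s -> x \in P s -> connect av x (P0 s).
  move=> Ks xs; have sP : sorted T (P s) by have := tpP s; rewrite tree_pathE => /and3P [].
  apply: connect_mono (tree_path_connected treeT sP xs (P0in s)).
  by apply: sub_within => y ys; apply: contraTneq (ys : y \in P s) => ->; apply: cS.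
(* A branch at c is named by its neighbour of c; a simple path from c to [P0 s] leaves c for good at
   its first edge. *)
have brex s : ~~ K s -> exists y, T c y && connect av y (P0 s).
  move=> Ks; have [_ [_ conT] _] := treeT; have [q pq lq] := connectP (conT c (P0 s)).
  case/shortenP: pq lq => q' pq' uq' _ lq'.
  case: q' pq' uq' lq' => [|y q'] /= => [_ _ E|/andP [Tcy pq'] /andP [cq' _] E].
    by have := cS s Ks; rewrite -E P0in.
  exists y; rewrite Tcy /=.
  have l1 : P0 s \in y :: q' by rewrite E mem_last.
  have y1 : y \in y :: q' by rewrite inE eqxx.
  apply: connect_mono (tree_path_connected treeT (pq' : sorted T (y :: q')) y1 l1).
  by apply: sub_within => z zq; apply: contraTneq (zq : z \in y :: q') => ->.
pose br s := odflt c [pick y | T c y && connect av y (P0 s)].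
have brP s : ~~ K s -> T c (br s) && connect av (br s) (P0 s).
  move=> Ks; rewrite /br; case: pickP => [y //|/= none].
  by have [y] := brex s Ks; rewrite none.
exists (fun s => index (br s) (enum [set y | T c y])); split=> [s Ks|k Kk].
  apply: leq_trans (degT c); rewrite cardE index_mem mem_enum inE.
  by have /andP [] := brP s Ks.
have [Ku Kv uv] := ends k Kk; set u := src k in Ku uv *; set v := tgt k in Kv uv *.
apply/negP => /eqP Ecol.
have inbr s : ~~ K s -> br s \in enum [set y | T c y].
  by move=> Ks; rewrite mem_enum inE; have /andP [] := brP s Ks.
have Ebr : br u = br v by rewrite -(nth_index c (inbr u Ku)) Ecol nth_index ?inbr.
have avuv : connect av (P0 u) (P0 v).
  have /andP [_ cu] := brP u Ku; have /andP [_ cv] := brP v Kv.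
  by apply: connect_trans cv; rewrite -Ebr within_csym.
have [a au ak] : exists2 a, a \in P u & a \in P k.
  have [+ _] := KS k u Kk Ku; rewrite eqxx eP ?KnS // => /hasP [a]; by exists a.
have [b bv bk] : exists2 b, b \in P v & b \in P k.
  have [+ _] := KS k v Kk Kv; rewrite eqxx orbT eP ?KnS // => /hasP [b]; by exists b.
have avab : connect av a b.
  apply: connect_trans (connect_trans (inS u a Ku au) avuv) _.
  by rewrite within_csym //; apply: inS.
have ck := hc k Kk.
have ne x y : x \in P k -> x != y -> index x (P k) != index y (P k).
  move=> xk; apply: contra => /eqP E; rewrite -(nth_index c xk) E nth_index //.
  by rewrite -index_mem -E index_mem.
(* Some clique vertex l sees s' but not s: follow [P l] from c to [P s'] and then [P s'] to y.
   Neither path contains a node x of [P s], so x does not separate c from y. *)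
have between s s' x y : ~~ K s -> ~~ K s' -> s != s' -> x \in P s -> y \in P s' ->
    connect (within T (predC1 x)) c y.
  move=> Ks Ks' ss' xs ys'; rewrite eq_sym in ss'.
  have [l Kl /andP [ls' nls]] := nd _ _ Ks' Ks ss'.
  move: ls'; rewrite eP ?KnS // => /hasP [z zs' zl].
  have sl : sorted T (P l) by have := tpP l; rewrite tree_pathE => /and3P [].
  have ss : sorted T (P s') by have := tpP s'; rewrite tree_pathE => /and3P [].
  apply: (@connect_trans _ _ z).
    apply: connect_mono (tree_path_connected treeT sl (hc l Kl) zl).
    apply: sub_within => w wl; apply: contraNneq nls => wx.
    by apply: meet (KnS _ _ Kl Ks) (wl : w \in P l) _; rewrite wx.
  apply: connect_mono (tree_path_connected treeT ss zs' ys').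
  apply: sub_within => w ws'; apply: contraNneq (SS _ _ Ks' Ks) => wx.
  by apply: meet ss' (ws' : w \in P s') _; rewrite wx.
have cb := between u v a b Ku Kv uv au bv.
have ca : connect (within T (predC1 b)) c a by apply: between Kv Ku _ bv au; rewrite eq_sym.
have cona : c != a by apply: contraNneq (cS u Ku) => ->.
have conb : c != b by apply: contraNneq (cS v Kv) => ->.
have anb : a != b.
  by apply: contraNneq (SS _ _ Ku Kv) => E; apply: meet uv au _; rewrite E.
(* Of the distinct nodes a, b, c of [P k] one lies between the other two and separates them by
   [tree_sep]; but a and b are connected off c, b and c off a, a and c off b. *)
have sep x y z : y \in P k -> z \in P k -> x \in P k ->
    connect (within T (predC1 y)) x z ->
    ~~ (index x (P k) < index y (P k) < index z (P k)) /\
    ~~ (index z (P k) < index y (P k) < index x (P k)).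
  move=> yk zk xk con; split; apply/negP => lt.
    by have := tree_sep treeT (tpP k) lt zk; rewrite con.
  by have := tree_sep treeT (tpP k) lt xk; rewrite within_csym // con.
have [A1 A2] := sep _ _ _ ck bk ak avab.
have [B1 B2] := sep _ _ _ ak bk ck cb.
have [C1 C2] := sep _ _ _ bk ak ck ca.
have := ne _ _ ck cona; have := ne _ _ ck conb; have := ne _ _ ak anb.
move: A1 A2 B1 B2 C1 C2.
move: (index a (P k)) (index b (P k)) (index c (P k)) => x y z.
by clear; case: (ltngtP x y); case: (ltngtP x z); case: (ltngtP y z) => //; lia.
Qed.

(** * Trees given by a parent map *)

Section ParentTree.
Variables (N : finType) (r : N) (par : N -> N) (ht : N -> nat).
Hypothesis par_ht : forall x, x != r -> ht (par x) < ht x.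

Definition padj : rel N :=
  fun x y => (x != r) && (par x == y) || (y != r) && (par y == x).

Definition ptree : rel 'I_#|N| := fun a b => padj (enum_val a) (enum_val b).

Lemma padj_sym : symmetric padj.
Proof. by move=> x y; rewrite /padj orbC. Qed.

Lemma padj_ht x y : padj x y -> ht y <= ht x -> y = par x.
Proof.
move=> /orP [/andP [_ /eqP //]|/andP [/par_ht lt /eqP E]] le.
by move: lt; rewrite E; lia.
Qed.

(** On a cycle, both neighbours of a node of maximal height would be its parent and hence equal. For
    connectedness, [ht] measures the climb to the root. *)
Lemma ptree_is_tree : is_tree ptree.
Proof.
split.
- split=> [a|a b]; last exact: padj_sym.
  rewrite /ptree /padj orbb; apply/negP => /andP [/par_ht + /eqP E].
  by rewrite E ltnn.
- split; first by apply/card_gt0P; exists r.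
  have sym : connect_sym ptree by apply: sym_connect_sym => a b; apply: padj_sym.
  suff H n x : ht x <= n -> connect ptree (enum_rank x) (enum_rank r).
    move=> a b; rewrite -[a]enum_valK -[b]enum_valK.
    by apply: connect_trans (H _ _ (leqnn _)) _; rewrite sym; apply: (H _ _ (leqnn _)).
  elim: n x => [|n IH] x hx; case: (eqVneq x r) => [-> //|xr].
    by have := par_ht xr; lia.
  apply: connect_trans (connect1 _) (IH (par x) _); last by have := par_ht xr; lia.
  by rewrite /ptree !enum_rankK /padj xr eqxx.
- move=> [x [p [sp up pp lp]]].
  have cyc : cycle ptree (x :: p) by rewrite /= rcons_path pp.
  pose f (a : 'I_#|N|) := ht (enum_val a).
  have xx : x \in x :: p by rewrite inE eqxx.
  case: (@arg_maxnP _ x [in x :: p] f xx) => z zp zmax.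
  have [i q Eq] := rot_to zp.
  have cq : cycle ptree (z :: q) by rewrite -Eq rot_cycle.
  have uq : uniq (z :: q) by rewrite -Eq rot_uniq.
  have sq : 2 <= size q by rewrite -ltnS -[(size q).+1]/(size (z :: q)) -Eq size_rot.
  have memq y : y \in z :: q -> f y <= f z by move=> hy; apply: zmax; rewrite -(mem_rot i) Eq.
  case: q {Eq} cq uq sq memq => [|y q] //.
  case/lastP: q => [|q w] // cq uq _ memq.
  move: cq; rewrite /= rcons_path last_rcons => /andP [zy /andP [_ wz]].
  have Ey : enum_val y = par (enum_val z).
    by apply: padj_ht zy _; apply: memq; rewrite !inE eqxx orbT.
  have Ew : enum_val w = par (enum_val z).
    apply: padj_ht; first by rewrite padj_sym.
    by apply: memq; rewrite !inE mem_rcons inE eqxx !orbT.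
  have yw : y = w by apply: enum_val_inj; rewrite Ey Ew.
  by move: uq; rewrite yw /= mem_rcons inE eqxx /= andbF.
Qed.

Lemma ptree_degree h : (forall x, #|[set y | padj x y]| <= h) -> max_degree_le ptree h.
Proof.
move=> H a; apply: leq_trans (H (enum_val a)).
rewrite -(card_imset _ (@enum_val_inj _ [in N])); apply: subset_leq_card.
by apply/subsetP => _ /imsetP [b + ->]; rewrite !inE.
Qed.

Lemma ptree_path p : p != [::] -> uniq p -> sorted padj p ->
  tree_path ptree (map enum_rank p).
Proof.
case: p => // x p _ up pp.
change (uniq (map enum_rank (x :: p)) && path ptree (enum_rank x) (map enum_rank p)).
rewrite map_inj_uniq ?up //; last exact: enum_rank_inj.
rewrite path_map; apply: sub_path pp => u v.
by rewrite /ptree /= !enum_rankK.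
Qed.
End ParentTree.

Lemma sorted_join (T : Type) (e : rel T) x p q : symmetric e ->
  path e x p -> path e x q -> sorted e (rev p ++ x :: q).
Proof.
move=> es; elim: p x q => [|y p IH] x q //= /andP [exy pp] pq.
by rewrite rev_cons cat_rcons; apply: IH => //=; rewrite es exy.
Qed.

(** * From colourings to path models *)

Section Caterpillar.
Variables (h n : nat).

(* The centre, and for every colour i < h+1 a spine with one leaf per spine
   node; the spine keeps every degree outside the centre at most 3. *)
Definition node : finType := option ('I_h.+1 * 'I_n.+1 * bool).

Definition npar (x : node) : node :=
  match x with
  | None => None
  | Some (i, j, true) => Some (i, j, false)
  | Some (i, j, false) => if val j is j'.+1 then Some (i, inord j', false) else None
  end.

Definition nht (x : node) : nat := if x is Some (i, j, b) then j + 1 + b else 0.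

Lemma npar_ht x : x != None -> nht (npar x) < nht x.
Proof.
case: x => [[[i [j ltj]] []]|] //= _; first lia.
by case: j ltj => [|j] ltj //=; rewrite ?inordK; lia.
Qed.

Notation nadj := (padj None npar).

Lemma card_set3 (T : finType) (a b c : T) : #|[set a; b; c]| <= 3.
Proof.
by apply: leq_trans (leq_card_setU _ _) _; rewrite cards1 addn1 ltnS cards2; case: (_ != _).
Qed.

(** By [1 < h] the three possible neighbours of a spine node, namely its parent, its leaf and its
    successor, fit under the degree h+1 of the centre. At the end of a spine [inord j.+1] is a
    default value, harmless in an upper bound. *)
Lemma nadj_degree (x : node) : 1 < h -> #|[set y | nadj x y]| <= h.+1.
Proof.
move=> h1; case: x => [[[i j] b]|].
  apply: leq_trans (_ : 3 <= h.+1) => //.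
  apply: leq_trans (card_set3 (npar (Some (i, j, b))) (Some (i, j, true))
    (Some (i, inord j.+1, false))).
  apply: subset_leq_card; apply/subsetP => y; rewrite !inE => /orP [/andP [_ /eqP ->]|].
    by rewrite eqxx.
  case: y => [[[i' j'] []]|] //= => [/eqP [-> -> _]|]; first by rewrite eqxx orbT.
  case Ej: (val j') => [|j''] //= => /eqP [-> E _].
  apply/orP; right; apply/eqP; congr (Some (_, _, _)); apply: val_inj.
  have := ltn_ord j'; rewrite /= in Ej *; rewrite Ej => lt.
  by rewrite -E !inordK // ltnW.
apply: leq_trans (_ : #|[set (Some (i, ord0, false) : node) | i : 'I_h.+1]| <= _); last first.
  by apply: leq_trans (leq_imset_card _ _) _; rewrite card_ord.
apply: subset_leq_card; apply/subsetP => y; rewrite !inE /padj /=.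
case: y => [[[i j] []]|] //=; case Ej: (val j) => [|j'] //= _.
apply/imsetP; exists i => //; congr (Some (_, _, _)); exact: val_inj.
Qed.

Definition spine (i : 'I_h.+1) (j : nat) : seq node :=
  [seq Some (i, inord k, false) | k <- iota 0 j.+1].

Definition leaf (i : 'I_h.+1) (s : 'I_n.+1) : node := Some (i, s, true).

(** The way from the centre, itself left out, to the leaf of s on branch i. Spine node s carries the
    leaf of vertex s, so no leaf is shared by two vertices. *)
Definition down (i : 'I_h.+1) (s : 'I_n.+1) : seq node :=
  rcons (spine i s) (leaf i s).

Lemma spine_path i j : j <= n ->
  path nadj None (spine i j) /\ last None (spine i j) = Some (i, inord j, false).
Proof.
elim: j => [|j IH] jn; first by rewrite /spine /padj /= inordK.
have [pj lj] := IH (ltnW jn).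
have -> : spine i j.+1 = rcons (spine i j) (Some (i, inord j.+1, false)).
  by rewrite /spine -[j.+2]addn1 iotaD map_cat cats1.
rewrite rcons_path last_rcons pj lj; split=> //=.
by apply/orP; right; rewrite /= inordK // eqxx.
Qed.

Lemma down_path i s : path nadj None (down i s).
Proof.
have [p l] := spine_path i (ltn_ord s : s <= n).
rewrite rcons_path p l inord_val /=.
by apply/orP; right; rewrite /= eqxx.
Qed.

Lemma down_uniq i s : uniq (down i s).
Proof.
rewrite rcons_uniq; apply/andP; split.
  by apply/negP => /mapP [k _].
rewrite map_inj_in_uniq ?iota_uniq // => k l; rewrite !mem_iota /= => hk hl [].
move=> E; have := f_equal (@nat_of_ord _) E; rewrite !inordK //.
  by apply: leq_trans hl (ltn_ord s).
by apply: leq_trans hk (ltn_ord s).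
Qed.

Lemma mem_down i s x : x \in down i s -> exists j b, x = Some (i, j, b).
Proof.
rewrite mem_rcons inE => /orP [/eqP ->|/mapP [k _ ->]]; first by exists s, true.
by exists (inord k), false.
Qed.

Lemma leaf_in_down i s i' s' : (leaf i' s' \in down i s) = (i' == i) && (s' == s).
Proof.
rewrite mem_rcons inE orbC; case: (boolP (_ \in spine i s)) => [/mapP [k _]|_] //=.
by apply/eqP/andP => [[-> ->]|[/eqP -> /eqP ->]].
Qed.
End Caterpillar.

(** The path of a clique vertex runs from the leaf of its source up to the centre and down to the
    leaf of its target; it is a path because the two colours differ. The path of a stable vertex is
    its leaf alone, and the only leaves on a clique path are its two ends. *)
Lemma colorable_h21 n e K src tgt h : 0 < n -> 2 < h ->
  @incidence n e K src tgt -> colorable K src tgt h -> in_h21 h e.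
Proof.
case: n e K src tgt => // n e K src tgt _.
case: h => // h h2 [irr KK SS KS ends] [col0 [colh colp]].
pose col s : 'I_h.+1 := inord (col0 s).
have colne k : K k -> col (src k) != col (tgt k).
  move=> Kk; have [Ks Kt _] := ends k Kk; apply: contra (colp k Kk) => /eqP E.
  by have := f_equal (@nat_of_ord _) E; rewrite !inordK ?colh // => ->.
pose PN v : seq (node h n) := if K v then
    rev (down (col (src v)) (src v)) ++ None :: down (col (tgt v)) (tgt v)
  else [:: leaf (col v) v].
have treeT := ptree_is_tree (@npar_ht h n).
exists #|node h n|, (ptree None (@npar h n)), (fun v => map enum_rank (PN v)); split=> //.
  by apply: ptree_degree => x; apply: nadj_degree.
have hasE u v : has (fun x => x \in map enum_rank (PN u)) (map enum_rank (PN v)) =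
                has (fun x => x \in PN u) (PN v).
  rewrite has_map; apply: eq_has => x /=; rewrite mem_map //; exact: enum_rank_inj.
have leafK k s : K k -> (leaf (col s) s \in PN k) = (s == src k) || (s == tgt k).
  move=> Kk; rewrite /PN Kk mem_cat mem_rev leaf_in_down in_cons leaf_in_down orFb.
  by congr orb; apply/andP/eqP => [[_ /eqP]//|->].
split=> [v|u v uv]; last rewrite hasE.
  apply: ptree_path; rewrite /PN; case: ifP => Kv //.
  - by case: (rev _).
  - rewrite cat_uniq rev_uniq down_uniq cons_uniq down_uniq andbT andTb; apply/andP; split.
      apply/hasPn => x; rewrite in_cons => /orP [/eqP ->|/mem_down [j [b ->]]];
        rewrite mem_rev; first by apply/negP => /mem_down [j [b]].
      apply/negP => /mem_down [j' [b' [E _ _]]].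
      by have := colne v Kv; rewrite E eqxx.
    by apply/negP => /mem_down [j [b]].
  - by apply: sorted_join (down_path _ _) (down_path _ _) => x y; apply: padj_sym.
case: (boolP (K u)) => Ku; case: (boolP (K v)) => Kv.
- rewrite KK //; apply/esym/hasP; exists None; rewrite /PN ?Ku ?Kv mem_cat inE eqxx /= orbT //.
- have [-> _] := KS u v Ku Kv; rewrite -leafK //.
  by rewrite [in RHS]/PN (negbTE Kv) /= orbF.
- have [E ->] := KS v u Kv Ku; rewrite E -leafK // [in RHS]/PN (negbTE Ku).
  apply/idP/hasP => [h1|[x]]; first by exists (leaf (col u) u); rewrite ?inE.
  by move=> h1; rewrite inE => /eqP E1; move: h1; rewrite E1 /PN Kv.
- rewrite (negbTE (SS _ _ Ku Kv)) /PN (negbTE Ku) (negbTE Kv) /= orbF inE.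
  by apply/esym/negP => /eqP [_ E]; rewrite E eqxx in uv.
Qed.

Lemma incidence_promise n e K src tgt :
  0 < n -> @incidence n e K src tgt -> undominated e K -> promise e.
Proof.
move=> n0 I und; have [irr KK SS KS ends] := I; have [nd two] := und.
have KnS k s : K k -> ~~ K s -> k != s by move=> Kk; apply: contraNneq => <-.
have sym : symmetric e.
  move=> u v; case: (boolP (K u)) => Ku; case: (boolP (K v)) => Kv.
  - by case: (eqVneq u v) => [-> //|uv]; rewrite !KK // eq_sym.
  - by have [_ ->] := KS u v Ku Kv.
  - by have [_ ->] := KS v u Kv Ku.
  - by rewrite (negbTE (SS _ _ Ku Kv)) (negbTE (SS _ _ Kv Ku)).
have toK u : exists2 k, K k & connect e u k.
  case: (boolP (K u)) => Ku; first by exists u.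
  have [s Ks us] := two u Ku; rewrite eq_sym in us.
  have [k Kk /andP [ku _]] := nd u s Ku Ks us.
  by exists k => //; apply: connect1; rewrite sym.
have csym : connect_sym e by apply: sym_connect_sym.
split=> //.
- split=> // u v; have [k Kk uk] := toK u; have [l Kl vl] := toK v.
  apply: connect_trans uk _; rewrite csym; apply: connect_trans vl _.
  by case: (eqVneq l k) => [-> //|lk]; apply: connect1; apply: KK.
(* To be VPT no colour has to be saved: each stable vertex gets a colour of its own, and [n.+3]
   satisfies the requirement [2 < h] of the caterpillars. *)
- have [|m [T [P [tT _ PM]]]] := @colorable_h21 n e K src tgt n.+3 n0 isT I.
    exists (@nat_of_ord _); split=> [s _|k Kk]; first by have := ltn_ord s; lia.
    by have [_ _ ] := ends k Kk.
  by exists m, T, P.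
- exists [set s | ~~ K s]; split.
    split=> u v; rewrite !inE; first exact: SS.
    by rewrite !negbK => Ku Kv; apply: KK.
  move=> s; rewrite inE => Ks [s']; rewrite inE => Ks' [ss' dom]; rewrite eq_sym in ss'.
  have [k Kk /andP [ks ks']] := nd s s' Ks Ks' ss'.
  by move: ks'; rewrite sym dom // sym.
Qed.

(** * Programs that print a graph *)

Lemma set_set s i l l' : set (set s i l) i l' = set s i l'.
Proof. by apply: functional_extensionality => r; rewrite /set; case: eqP. Qed.

Lemma set_id s i l : s i = l -> set s i l = s.
Proof. by move=> <-; apply: functional_extensionality => r; rewrite /set; case: eqP => [->|]. Qed.

Lemma set_eq s i l : set s i l i = l.
Proof. by rewrite /set eqxx. Qed.

Lemma set_neq s i l j : j != i -> set s i l j = s j.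
Proof. by rewrite /set => /negbTE ->. Qed.

(** The contents o of the output stack are arbitrary, so what is printed does not depend on what was
    printed before, and the rest of the state is restored; hence outputs of successive programs
    concatenate. *)
Definition emits (r : nat) (c : cmd) (s : state) (w : seq bool) : Prop :=
  forall o, exec c (set s r o) = set s r (o ++ w).

Lemma emits_exec r c s w : emits r c s w -> exec c s = set s r (s r ++ w).
Proof. by move=> /(_ (s r)); rewrite [set s r (s r)]set_id. Qed.

Lemma emits_push r b s : emits r (Push r b) s [:: b].
Proof. by move=> o; rewrite /= /push set_eq set_set cats1. Qed.

Lemma emits_skip r s : emits r Skip s [::].
Proof. by move=> o; rewrite /= cats0. Qed.

Lemma emits_seq r c1 c2 s w1 w2 : emits r c1 s w1 -> emits r c2 s w2 ->
  emits r (Seq c1 c2) s (w1 ++ w2).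
Proof. by move=> e1 e2 o; rewrite /= e1 e2 catA. Qed.

Lemma teval_set0 K t s o : twf K t -> teval t (set s 0 o) = teval t s.
Proof.
elim: t => //= [b v u|v u|t IH|t1 I1 t2 I2].
- by move=> /andP [/andP [v0 _] /andP [u0 _]]; rewrite !set_neq // -lt0n.
- by move=> /andP [/andP [v0 _] /andP [u0 _]]; rewrite !set_neq // -lt0n.
- by move=> /IH ->.
- by move=> /andP [/I1 -> /I2 ->].
Qed.

Lemma emits_if K t c1 c2 s w1 w2 : twf K t -> (teval t s -> emits 0 c1 s w1) ->
  (~~ teval t s -> emits 0 c2 s w2) ->
  emits 0 (If t c1 c2) s (if teval t s then w1 else w2).
Proof.
move=> wt e1 e2 o; rewrite /= (teval_set0 _ _ wt).
by case: (boolP (teval t s)) => h; [rewrite e1|rewrite e2].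
Qed.

Lemma emits_for r v w c s (f : nat -> seq bool) :
  v != r -> w != r -> v != w -> s v = [::] ->
  (forall i, i < size (s w) -> emits r c (set s v (nseq i true)) (f i)) ->
  emits r (For v w c) s (flatten (map f (iota 0 (size (s w))))).
Proof.
move=> v0' w0' vw sv ec o /=.
rewrite [set s r o w]set_neq // [set s r o v]set_neq // sv subn0.
set F := fun s' : state => _.
suff H i : i <= size (s w) -> iter i F (set s r o) =
    set (set s v (nseq i true)) r (o ++ flatten (map f (iota 0 i))).
  rewrite H //; apply: functional_extensionality => r'; rewrite /set.
  by case: (eqVneq r' v) => [->|//]; rewrite (negbTE v0') sv.
elim: i => [|i IH] lei; first by rewrite /= cats0 [set s v _]set_id.
rewrite iterS IH ?(ltnW lei) // /F ec // /push.
apply: functional_extensionality => r'; rewrite /set (negbTE v0') eqxx.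
case: (eqVneq r' v) => [->|_].
  by rewrite (negbTE v0') -cats1 -[[:: true]]/(nseq 1 true) -nseqD addn1.
by rewrite -[i.+1]addn1 iotaD map_cat flatten_cat /= cats0 catA.
Qed.

(** * Nested loops over tuples of numbers *)

Fixpoint tuples (k N : nat) : seq (seq nat) :=
  if k is k'.+1 then flatten [seq [seq i :: l | l <- tuples k' N] | i <- iota 0 N]
  else [:: [::]].

Lemma mem_tuples k N l : (l \in tuples k N) = (size l == k) && all (fun i => i < N) l.
Proof.
elim: k l => [|k IH] l /=; first by rewrite inE; case: l.
apply/allpairsP/idP => [[[i l'] /= []]|].
  by rewrite mem_iota IH add0n => /andP [_ iN] /andP [/eqP <- al] -> /=; rewrite eqxx iN.
case: l => [|i l] //=; rewrite eqSS => /and3P [sl iN al].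
by exists (i, l) => /=; rewrite mem_iota IH sl al iN.
Qed.

Lemma uniq_tuples k N : uniq (tuples k N).
Proof.
elim: k => //= k IH; apply: allpairs_uniq => //; first exact: iota_uniq.
by move=> [i l] [j l'] _ _ /= [-> ->].
Qed.

Arguments tuples : simpl never.

Lemma flatten_map_allpairs (A B C D : Type) (f : C -> seq D) (g : A -> B -> C) s t :
  flatten (map f [seq g x y | x <- s, y <- t]) =
  flatten [seq flatten [seq f (g x y) | y <- t] | x <- s].
Proof. by elim: s => //= x s IH; rewrite map_cat flatten_cat IH -map_comp. Qed.

Definition loops (rs : seq nat) (w : nat) (c : cmd) : cmd := foldr (fun r => For r w) c rs.

Definition setl (s : state) (rs : seq nat) (l : seq nat) : state :=
  foldl (fun s p => set s p.1 (nseq p.2 true)) s (zip rs l).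

Lemma setl_notin s rs l r : r \notin rs -> setl s rs l r = s r.
Proof.
rewrite /setl; elim: rs s l => [|r' rs IH] s [|i l] //=.
by rewrite inE negb_or => /andP [rr' h]; rewrite IH // set_neq.
Qed.

Lemma setl_nth s rs l i : uniq rs -> size l = size rs -> i < size rs ->
  setl s rs l (nth 0 rs i) = nseq (nth 0 l i) true.
Proof.
rewrite /setl; elim: rs s l i => [|r rs IH] s [|a l] [|i] //= /andP [nr ur] [sl] lti.
  by rewrite -/(setl _ rs l) setl_notin // set_eq.
exact: IH.
Qed.

(** [tuples] is in lexicographic order, the order in which nested counters run through their
    values. *)
Lemma emits_loops r0 rs w c s (f : seq nat -> seq bool) :
  uniq rs -> r0 \notin rs -> w != r0 -> w \notin rs -> (forall r, r \in rs -> s r = [::]) ->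
  (forall l, l \in tuples (size rs) (size (s w)) -> emits r0 c (setl s rs l) (f l)) ->
  emits r0 (loops rs w c) s (flatten (map f (tuples (size rs) (size (s w))))).
Proof.
elim: rs s f => [|r rs IH] s f /=.
  by move=> _ _ _ _ _ H; rewrite cats0; apply: (H [::]); rewrite mem_tuples.
move=> /andP [nr ur]; rewrite !inE !negb_or => /andP [rr0 n0] w0 /andP [wr nw] sr H.
rewrite [tuples _ _]/(allpairs _ _ _) flatten_map_allpairs.
apply: (emits_for (f := fun i => flatten [seq f (i :: l) | l <- tuples (size rs) (size (s w))]));
  rewrite ?w0 // 1?eq_sym //.
  by apply: sr; rewrite inE eqxx.
move=> i lti; have Ew : set s r (nseq i true) w = s w by rewrite set_neq.
rewrite -Ew; apply: IH => //.
  move=> r' hr'; rewrite set_neq; last by apply: contraNneq nr => <-.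
  by apply: sr; rewrite inE hr' orbT.
by rewrite Ew => l hl; apply: (H (i :: l)); apply: allpairs_f => //; rewrite mem_iota.
Qed.

Definition seqs (cs : seq cmd) : cmd := foldr Seq Skip cs.

Lemma emits_seqs r (A : Type) (l : seq A) (c : A -> cmd) s (f : A -> seq bool) :
  (forall a, emits r (c a) s (f a)) -> emits r (seqs (map c l)) s (flatten (map f l)).
Proof. by move=> H; elim: l => [|a l IH] /=; [apply: emits_skip|apply: emits_seq]. Qed.

Lemma flatten_map_if (A B : Type) (P : pred A) (f : A -> seq B) l :
  flatten [seq if P x then f x else [::] | x <- l] = flatten [seq f x | x <- l & P x].
Proof. by elim: l => //= x l ->; case: (P x). Qed.

(** The graph lives on the positions of the list vs. Its encoding falls into a unary count, a
    separator and the rows, each a concatenation over vs, which is the shape of what loops print. *)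
Lemma enc_graph_nth (V : eqType) (adj : rel V) (vs : seq V) (x0 : V) :
  enc_graph (fun i j : 'I_(size vs) => adj (nth x0 vs i) (nth x0 vs j)) =
  flatten [seq [:: true] | v <- vs] ++
  [:: false] ++ flatten [seq flatten [seq [:: adj u v] | v <- vs] | u <- vs].
Proof.
rewrite /enc_graph flatten_map1 /=; congr (_ ++ _ :: _); first by elim: vs => //= v vs <-.
have E (B : Type) (f : V -> B) :
    [seq f (nth x0 vs i) | i : 'I_(size vs) <- enum 'I_(size vs)] = map f vs.
  have -> : map f vs = map f (mkseq (nth x0 vs) (size vs)) by rewrite mkseq_nth.
  by rewrite /mkseq -val_enum_ord -!map_comp.
rewrite -E; congr flatten; apply: eq_map => i.
by rewrite flatten_map1 -E.
Qed.

(** * Conditions on tableau positions as tests on stack heights *)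

Definition teq (o : bool) (v u : nat) : test :=
  if o then TAnd (TNot (TLt true v u)) (TLt false v u)
  else TAnd (TNot (TLt false v u)) (TNot (TLt false u v)).

Definition tor (t1 t2 : test) : test := TNot (TAnd (TNot t1) (TNot t2)).

Lemma teval_teq o v u s : teval (teq o v u) s = (size (s v) + o == size (s u)).
Proof. by case: o => /=; lia. Qed.

Lemma teval_tor t1 t2 s : teval (tor t1 t2) s = teval t1 s || teval t2 s.
Proof. by rewrite /= negb_and !negbK. Qed.

(* Times and columns of the tableau range over [0, N); the machine starts at
   column O, [pX] lists the columns up to the guessed word, which ends before E. *)
Record params := Params { pN : nat; pO : nat; pE : nat; pX : seq bool }.

(* Stack 0 is the input and the output, 1 the reversed input, 2 is [pX], 3 and 4
   have heights |x| and |x| + 1, 5 to 7 have heights [pO], [pE] and [pN], 8 stays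
   empty, 9 to 16 hold the coordinates of two vertices of the split graph, and
   the stacks from 17 on are loop counters of the setup. *)
Definition env (P : params) (s : state) : Prop :=
  [/\ s 2 = pX P, size (s 5) = pO P, size (s 6) = pE P, size (s 7) = pN P & s 8 = [::]].

(** Guards select the positions (t, a) at which a clause is instantiated: borders, stretches of the
    initial row, the last row. They form a datatype because each needs both a meaning, [gsem], and a
    program test, [gtest]. *)
Inductive guard :=
  GTrue | GLeft | GRight | GLBlank | GHead of bool | GIn of bool | GGuess | GMono
| GRBlank | GFinal.

Definition pbit (P : params) (a : nat) : bool := onth (pX P) a == Some true.

Definition gsem (P : params) (g : guard) (t a : nat) : bool :=
  match g with
  | GTrue => true
  | GLeft => a == 0
  | GRight => a + 1 == pN P
  | GLBlank => (t == 0) && (a < pO P)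
  | GHead b => (t == 0) && (a == pO P) && (pbit P a == b)
  | GIn b => (t == 0) && ((pO P < a) && (a < size (pX P))) && (pbit P a == b)
  | GGuess => (t == 0) && (~~ (a < size (pX P)) && (a < pE P))
  | GMono => (t == 0) && ~~ (a < size (pX P))
  | GRBlank => (t == 0) && ~~ (a < pE P)
  | GFinal => t + 1 == pN P
  end.

Definition gtest (g : guard) (rt ra : nat) : test :=
  let bit b := if b then TBit ra 2 else TNot (TBit ra 2) in
  let start := teq false rt 8 in
  match g with
  | GTrue => TConst true
  | GLeft => teq false ra 8
  | GRight => teq true ra 7
  | GLBlank => TAnd start (TLt false ra 5)
  | GHead b => TAnd (TAnd start (teq false ra 5)) (bit b)
  | GIn b => TAnd (TAnd start (TAnd (TLt false 5 ra) (TLt false ra 2))) (bit b)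
  | GGuess => TAnd start (TAnd (TNot (TLt false ra 2)) (TLt false ra 6))
  | GMono => TAnd start (TNot (TLt false ra 2))
  | GRBlank => TAnd start (TNot (TLt false ra 6))
  | GFinal => teq true rt 7
  end.

Lemma gtestE P g rt ra s : env P s ->
  teval (gtest g rt ra) s = gsem P g (size (s rt)) (size (s ra)).
Proof.
move=> [E2 E5 E6 E7 E8].
have Z r : teval (teq false r 8) s = (size (s r) == 0) by rewrite teval_teq E8 addn0.
have B b : teval (if b then TBit ra 2 else TNot (TBit ra 2)) s = (pbit P (size (s ra)) == b).
  by rewrite /pbit; case: b => /=; rewrite E2; case: (_ == Some true).
by case: g => [||||b|b||||]; rewrite /gtest; cbn [teval];
   rewrite ?B ?Z ?teval_teq ?E2 ?E5 ?E6 ?E7 ?addn0.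
Qed.

(** * The graph H and its incidence split graph *)

Section Reduction.
Variables (h : nat) (VT : finType).

(* [(b, v, dt, da)]: in a clause at (t, a), the literal with sign b of the
   variable v at (t + dt, a + da). *)
Definition lit := (bool * VT * bool * bool)%type.
Definition clause := (guard * ('I_3 -> lit))%type.
Variable CL : seq clause.


Definition clause_at (j : 'I_(size CL)) : clause := tnth (in_tuple CL) j.

(** Palette, literals, and corners of clause triangles. The set of tags does not depend on the
    input, so loops over tags are unrolled in the program; only the two coordinates are run-time
    numbers. *)
Definition htag : finType := ('I_h + VT * bool + 'I_(size CL) * 'I_3)%type.
Definition hvertex : eqType := (htag * (nat * nat))%type.

Definition hvalid (P : params) (u : hvertex) : bool :=
  let: (tag, (t, a)) := u in
  match tag with
  | inl (inl i) => (t == 0) && (a == 0)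
  | inl (inr _) => true
  | inr (j, k) => gsem P (clause_at j).1 t a
  end.

(** One direction of the adjacency. Palette vertex 0 stands for truth and 1 for falsity: a literal
    sees the palette from 2 on, a clause corner sees 0 and everything from 4 on, which leaves 1, 2,
    3 to the triangle. A corner also sees its literal, so a corner coloured false rules out a false
    literal. *)
Definition hpre (u v : hvertex) : bool :=
  let: (tag, (t, a)) := u in let: (tag', (t', a')) := v in
  match tag, tag' with
  | inl (inl i), inl (inl i') => i != i'
  | inl (inl i), inl (inr _) => 1 < i
  | inl (inl i), inr _ => (val i == 0) || (3 < i)
  | inl (inr (v, b)), inl (inr (v', b')) => ((v == v') && (b != b')) && ((t == t') && (a == a'))
  | inr (j, k), inr (j', k') => ((j == j') && (k != k')) && ((t == t') && (a == a'))
  | inr (j, k), inl (inr (v, b)) =>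
      let: (b0, v0, dt, da) := (clause_at j).2 k in
      ((v == v0) && (b == b0)) && ((t + dt == t') && (a + da == a'))
  | _, _ => false
  end.

Definition hadj (P : params) (u v : hvertex) : bool :=
  hvalid P u && (hvalid P v && (hpre u v || hpre v u)).

Definition tvalid (tag : htag) (rt ra : nat) : test :=
  match tag with
  | inl (inl i) => TAnd (teq false rt 8) (teq false ra 8)
  | inl (inr _) => TConst true
  | inr (j, k) => gtest (clause_at j).1 rt ra
  end.

Definition tpre (tag : htag) (rt ra : nat) (tag' : htag) (rt' ra' : nat) : test :=
  match tag, tag' with
  | inl (inl i), inl (inl i') => TConst (i != i')
  | inl (inl i), inl (inr _) => TConst (1 < i)
  | inl (inl i), inr _ => TConst ((val i == 0) || (3 < i))
  | inl (inr (v, b)), inl (inr (v', b')) =>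
      TAnd (TConst ((v == v') && (b != b'))) (TAnd (teq false rt rt') (teq false ra ra'))
  | inr (j, k), inr (j', k') =>
      TAnd (TConst ((j == j') && (k != k'))) (TAnd (teq false rt rt') (teq false ra ra'))
  | inr (j, k), inl (inr (v, b)) =>
      let: (b0, v0, dt, da) := (clause_at j).2 k in
      TAnd (TConst ((v == v0) && (b == b0))) (TAnd (teq dt rt rt') (teq da ra ra'))
  | _, _ => TConst false
  end.

Definition tadj (tag : htag) (rt ra : nat) (tag' : htag) (rt' ra' : nat) : test :=
  TAnd (tvalid tag rt ra) (TAnd (tvalid tag' rt' ra')
    (tor (tpre tag rt ra tag' rt' ra') (tpre tag' rt' ra' tag rt ra))).

Definition tsame (tag : htag) (rt ra : nat) (tag' : htag) (rt' ra' : nat) : test :=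
  TAnd (TConst (tag == tag')) (TAnd (teq false rt rt') (teq false ra ra')).

Definition hval (s : state) (tag : htag) (rt ra : nat) : hvertex :=
  (tag, (size (s rt), size (s ra))).

Lemma tvalidE P s tag rt ra : env P s -> teval (tvalid tag rt ra) s = hvalid P (hval s tag rt ra).
Proof.
move=> E; case: tag => [[i|v]|[j k]] //; last exact: gtestE.
by have [_ _ _ _ E8] := E; rewrite /tvalid; cbn [teval]; rewrite !teval_teq E8 !addn0.
Qed.

Lemma tpreE s tag rt ra tag' rt' ra' : teval (tpre tag rt ra tag' rt' ra') s =
  hpre (hval s tag rt ra) (hval s tag' rt' ra').
Proof.
case: tag => [[i|[v b]]|[j k]]; case: tag' => [[i'|[v' b']]|[j' k']] //; rewrite /tpre /hpre /hval.
- by cbn [teval]; rewrite !teval_teq !addn0.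
- by case: ((clause_at j).2 k) => [[[b0 v0] dt] da]; cbn [teval]; rewrite !teval_teq.
- by cbn [teval]; rewrite !teval_teq !addn0.
Qed.

Lemma tadjE P s tag rt ra tag' rt' ra' : env P s ->
  teval (tadj tag rt ra tag' rt' ra') s = hadj P (hval s tag rt ra) (hval s tag' rt' ra').
Proof.
by move=> E; rewrite /tadj; cbn [teval]; rewrite teval_tor !(tvalidE _ _ _ E) !tpreE.
Qed.

Lemma tsameE s tag rt ra tag' rt' ra' :
  teval (tsame tag rt ra tag' rt' ra') s = (hval s tag rt ra == hval s tag' rt' ra').
Proof. by rewrite /tsame; cbn [teval]; rewrite !teval_teq !addn0 /hval !xpair_eqE. Qed.

(* A vertex of the split graph is a pair (u, v): the stable vertex u if u = v,
   and otherwise the clique vertex of the edge uv. *)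
Definition gvertex : eqType := (hvertex * hvertex)%type.

Definition gvalid (P : params) (p : gvertex) : bool :=
  ((p.1 == p.2) && hvalid P p.1) || hadj P p.1 p.2.

Definition gadj (p q : gvertex) : bool :=
  (~~ (p.1 == p.2) && (~~ (q.1 == q.2) && ~~ ((p.1 == q.1) && (p.2 == q.2)))) ||
  ((~~ (p.1 == p.2) && ((q.1 == q.2) && ((q.1 == p.1) || (q.1 == p.2)))) ||
   ((p.1 == p.2) && (~~ (q.1 == q.2) && ((p.1 == q.1) || (p.1 == q.2))))).

Definition tgvalid (tags : htag * htag) (r : nat) : test :=
  tor (TAnd (tsame tags.1 r (r + 1) tags.2 (r + 2) (r + 3)) (tvalid tags.1 r (r + 1)))
      (tadj tags.1 r (r + 1) tags.2 (r + 2) (r + 3)).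

Definition tgadj (x : htag * htag) (r : nat) (y : htag * htag) (q : nat) : test :=
  let p12 := tsame x.1 r (r + 1) x.2 (r + 2) (r + 3) in
  let q12 := tsame y.1 q (q + 1) y.2 (q + 2) (q + 3) in
  tor (TAnd (TNot p12) (TAnd (TNot q12)
         (TNot (TAnd (tsame x.1 r (r + 1) y.1 q (q + 1))
                     (tsame x.2 (r + 2) (r + 3) y.2 (q + 2) (q + 3))))))
  (tor (TAnd (TNot p12) (TAnd q12
         (tor (tsame y.1 q (q + 1) x.1 r (r + 1)) (tsame y.1 q (q + 1) x.2 (r + 2) (r + 3)))))
       (TAnd p12 (TAnd (TNot q12)
         (tor (tsame x.1 r (r + 1) y.1 q (q + 1)) (tsame x.1 r (r + 1) y.2 (q + 2) (q + 3)))))).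

Definition gval (s : state) (tags : htag * htag) (r : nat) : gvertex :=
  (hval s tags.1 r (r + 1), hval s tags.2 (r + 2) (r + 3)).

Lemma tgvalidE P s tags r : env P s -> teval (tgvalid tags r) s = gvalid P (gval s tags r).
Proof.
by move=> E; rewrite /tgvalid teval_tor (tadjE _ _ _ _ _ _ E); cbn [teval];
   rewrite tsameE (tvalidE _ _ _ E).
Qed.

Lemma tgadjE s x r y q : teval (tgadj x r y q) s = gadj (gval s x r) (gval s y q).
Proof.
by rewrite /tgadj; do 2!rewrite ?teval_tor; cbn [teval]; rewrite ?teval_tor !tsameE.
Qed.

Definition tags : seq (htag * htag) := enum {: htag * htag}.

Definition row_prog (x : htag * htag) (y : htag * htag) : cmd :=
  loops [:: 13; 14; 15; 16] 7
    (If (tgvalid y 13) (If (tgadj x 9 y 13) (Push 0 true) (Push 0 false)) Skip).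
Definition size_prog (x : htag * htag) : cmd :=
  loops [:: 9; 10; 11; 12] 7 (If (tgvalid x 9) (Push 0 true) Skip).
Definition matrix_prog (x : htag * htag) : cmd :=
  loops [:: 9; 10; 11; 12] 7 (If (tgvalid x 9) (seqs (map (row_prog x) tags)) Skip).
Definition out_prog : cmd :=
  Seq (seqs (map size_prog tags)) (Seq (Push 0 false) (seqs (map matrix_prog tags))).

Definition mkv (x : htag * htag) (l : seq nat) : gvertex :=
  ((x.1, (nth 0 l 0, nth 0 l 1)), (x.2, (nth 0 l 2, nth 0 l 3))).
Definition gall (N : nat) : seq gvertex := [seq mkv x l | x <- tags, l <- tuples 4 N].
Definition gvs (P : params) : seq gvertex := [seq p <- gall (pN P) | gvalid P p].

Lemma twf_teq K o v u : 0 < v < K -> 0 < u < K -> twf K (teq o v u).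
Proof. by move=> hv hu; case: o; rewrite /= hv hu. Qed.

Lemma twf_gtest K g rt ra : 8 < K -> 0 < rt < K -> 0 < ra < K -> twf K (gtest g rt ra).
Proof.
move=> K8 ht ha; have q o v r : 0 < v < K -> 0 < r < 9 -> twf K (teq o v r).
  by move=> hv hr; apply: twf_teq => //; lia.
have b c : twf K (if c then TBit ra 2 else TNot (TBit ra 2)) by case: c => /=; lia.
case: g => [||||c|c||||]; rewrite /gtest; cbn [twf]; rewrite ?b ?q // ?andbT /=; lia.
Qed.

Lemma twf_tvalid K tag rt ra : 8 < K -> 0 < rt < K -> 0 < ra < K -> twf K (tvalid tag rt ra).
Proof.
move=> K8 ht ha; case: tag => [[i|v]|[j k]] //; last exact: twf_gtest.
by rewrite /tvalid; cbn [twf]; rewrite !twf_teq //; lia.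
Qed.

Lemma twf_tpre K tag rt ra tag' rt' ra' : 0 < rt < K -> 0 < ra < K -> 0 < rt' < K ->
  0 < ra' < K -> twf K (tpre tag rt ra tag' rt' ra').
Proof.
move=> h1 h2 h3 h4.
case: tag => [[i|[v b]]|[j k]]; case: tag' => [[i'|[v' b']]|[j' k']] //; rewrite /tpre.
- by cbn [twf]; rewrite !twf_teq.
- by case: ((clause_at j).2 k) => [[[b0 v0] dt] da]; cbn [twf]; rewrite !twf_teq.
- by cbn [twf]; rewrite !twf_teq.
Qed.

Lemma twf_tor K t1 t2 : twf K (tor t1 t2) = twf K t1 && twf K t2.
Proof. by []. Qed.

Lemma twf_tadj K tag rt ra tag' rt' ra' : 8 < K -> 0 < rt < K -> 0 < ra < K -> 0 < rt' < K ->
  0 < ra' < K -> twf K (tadj tag rt ra tag' rt' ra').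
Proof.
by move=> K8 h1 h2 h3 h4; rewrite /tadj; cbn [twf]; rewrite twf_tor !twf_tvalid // !twf_tpre.
Qed.

Lemma twf_tsame K tag rt ra tag' rt' ra' : 0 < rt < K -> 0 < ra < K -> 0 < rt' < K ->
  0 < ra' < K -> twf K (tsame tag rt ra tag' rt' ra').
Proof. by move=> h1 h2 h3 h4; rewrite /tsame; cbn [twf]; rewrite !twf_teq. Qed.

Lemma twf_tgvalid K x r : 8 < K -> 0 < r -> r + 3 < K -> twf K (tgvalid x r).
Proof.
move=> K8 r0 rK; rewrite /tgvalid twf_tor; cbn [twf].
by rewrite twf_tsame ?twf_tvalid ?twf_tadj //; lia.
Qed.

Lemma twf_tgadj K x r y q : 0 < r -> r + 3 < K -> 0 < q -> q + 3 < K -> twf K (tgadj x r y q).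
Proof.
move=> r0 rK q0 qK; rewrite /tgadj !twf_tor; cbn [twf]; rewrite !twf_tor.
by rewrite !twf_tsame //; lia.
Qed.

Lemma wf_loops K rs w c : uniq rs -> all (fun r => 0 < r < K) rs -> 0 < w < K ->
  w \notin rs -> w \notin mods c -> all (fun r => r \notin mods c) rs -> wf K c ->
  wf K (loops rs w c).
Proof.
move=> + + hw + wc + wfc; elim: rs => //= r rs IH.
rewrite inE negb_or => /andP [nr ur] /andP [hr ar] /andP [wr nw] /andP [rc arc].
have M r' : r' \notin rs -> r' \notin mods c -> r' \notin mods (loops rs w c).
  move=> h1 h2; elim: (rs) h1 => //= a l IHl; rewrite !inE !negb_or => /andP [-> /IHl] /=.
  by [].
by rewrite hr hw eq_sym wr IH // !M.
Qed.

Lemma wf_seqs K (A : Type) (c : A -> cmd) l : (forall a, wf K (c a)) -> wf K (seqs (map c l)).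
Proof. by move=> H; elim: l => //= a l ->; rewrite H. Qed.

Lemma all_mods_seqs (A : Type) (c : A -> cmd) (Q : pred nat) l :
  (forall a, all Q (mods (c a))) -> all Q (mods (seqs (map c l))).
Proof. by move=> H; elim: l => //= a l IH; rewrite all_cat H IH. Qed.

Lemma all_pushes_seqs (A : Type) (c : A -> cmd) (Q : pred nat) l :
  (forall a, all Q (pushes (c a))) -> all Q (pushes (seqs (map c l))).
Proof. by move=> H; elim: l => //= a l IH; rewrite all_cat H IH. Qed.

Lemma all_bounds_seqs (A : Type) (c : A -> cmd) (Q : pred nat) l :
  (forall a, all Q (bounds (c a))) -> all Q (bounds (seqs (map c l))).
Proof. by move=> H; elim: l => //= a l IH; rewrite all_cat H IH. Qed.

Lemma out_prog_wf K : 16 < K -> wf K out_prog.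
Proof.
move=> K16; cbn [wf out_prog]; apply/and3P; split; [|lia|].
- apply: wf_seqs => x; apply: wf_loops => //; try (by rewrite /=; lia).
  by cbn [wf]; rewrite twf_tgvalid //; lia.
- apply: wf_seqs => x.
  have M r : r \notin [:: 0; 13; 14; 15; 16] -> r \notin mods (seqs (map (row_prog x) tags)).
    move=> hr; apply/negP => hm.
    have /allP := @all_mods_seqs _ (row_prog x) [in [:: 0; 13; 14; 15; 16]] tags (fun=> isT).
    by move=> /(_ _ hm) h1; rewrite h1 in hr.
  have M' r : r \notin [:: 0; 13; 14; 15; 16] ->
      r \notin mods (If (tgvalid x 9) (seqs (map (row_prog x) tags)) Skip).
    by move=> hr; cbn [mods]; rewrite cats0 M.
  apply: wf_loops; rewrite ?M' //; try (by rewrite /=; lia).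
    by apply/allP => r; rewrite !inE => hr; apply: M'; rewrite !inE; lia.
  cbn [wf]; rewrite andbT twf_tgvalid ?andTb //; try lia.
  apply: wf_seqs => y; apply: wf_loops => //; try (by rewrite /=; lia).
  by cbn [wf]; rewrite twf_tgvalid ?twf_tgadj //; lia.
Qed.

Lemma out_prog_pushes : all (pred1 0) (pushes out_prog).
Proof.
rewrite /= all_cat /= !all_pushes_seqs // => x; rewrite /= all_cat /= andbT.
by rewrite all_pushes_seqs.
Qed.

Lemma out_prog_bounds : all [in [:: 7; 9; 10; 11; 12; 13; 14; 15; 16]] (bounds out_prog).
Proof.
rewrite /= all_cat !all_bounds_seqs // => x; rewrite /= all_cat /= andbT.
by rewrite all_bounds_seqs.
Qed.

(** The vertex list [gvs] is never stored: each use of it is a fresh round of loops over all pairs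
    of tags and all 4-tuples, filtered by [tgvalid], in the order of [gall]. *)
Lemma out_prog_emits P s : env P s -> (forall r, 8 < r < 17 -> s r = [::]) ->
  emits 0 out_prog s (flatten [seq [:: true] | v <- gvs P] ++
    [:: false] ++ flatten [seq flatten [seq [:: gadj u v] | v <- gvs P] | u <- gvs P]).
Proof.
move=> Es se; have [E2 E5 E6 E7 E8] := Es.
have envl rs l : all (fun r => 8 < r) rs -> forall s, env P s -> env P (setl s rs l).
  move=> hrs s' [F2 F5 F6 F7 F8]; have N r : r < 9 -> r \notin rs.
    by move=> r9; apply/negP => /(allP hrs); lia.
  by split; rewrite setl_notin ?N.
have gv1 x l s' : size l = 4 -> gval (setl s' [:: 9; 10; 11; 12] l) x 9 = mkv x l.
  move=> sl; rewrite /gval /hval /mkv.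
  have H i : i < 4 -> size (setl s' [:: 9; 10; 11; 12] l (nth 0 [:: 9; 10; 11; 12] i)) = nth 0 l i.
    by move=> i4; rewrite setl_nth // size_nseq.
  by rewrite -(H 0) // -(H 1) // -(H 2) // -(H 3).
have gv2 x l s' : size l = 4 -> gval (setl s' [:: 13; 14; 15; 16] l) x 13 = mkv x l.
  move=> sl; rewrite /gval /hval /mkv.
  have H i : i < 4 -> size (setl s' [:: 13; 14; 15; 16] l (nth 0 [:: 13; 14; 15; 16] i)) = nth 0 l i.
    by move=> i4; rewrite setl_nth // size_nseq.
  by rewrite -(H 0) // -(H 1) // -(H 2) // -(H 3).
(* The counters of a row are distinct from the outer ones, so the first vertex keeps its value while
   the row is printed. *)
have gv3 x l l' s' : size l = 4 ->
    gval (setl (setl s' [:: 9; 10; 11; 12] l) [:: 13; 14; 15; 16] l') x 9 = mkv x l.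
  by move=> sl; rewrite -(gv1 x l s' sl) /gval /hval !(@setl_notin _ [:: 13; 14; 15; 16]).
have T4 l : l \in tuples 4 (pN P) -> size l = 4.
  by rewrite mem_tuples => /andP [/eqP].
apply: emits_seq; [|apply: emits_seq; first exact: emits_push].
- rewrite -flatten_map_if /gall flatten_map_allpairs; apply: emits_seqs => x.
  rewrite -E7; apply: (@emits_loops 0 [:: 9; 10; 11; 12] 7) => //.
    by move=> r; rewrite !inE => hr; apply: se; lia.
  rewrite E7 => l /T4 sl.
  have El := envl [:: 9; 10; 11; 12] l isT s Es.
  have := @emits_if 17 (tgvalid x 9) (Push 0 true) Skip (setl s [:: 9; 10; 11; 12] l) [:: true] [::].
  rewrite (tgvalidE _ _ El) gv1 //; apply.
  + by rewrite twf_tgvalid.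
  + by move=> _; exact: emits_push.
  + by move=> _; exact: emits_skip.
- rewrite -flatten_map_if /gall flatten_map_allpairs; apply: emits_seqs => x.
  rewrite -E7; apply: (@emits_loops 0 [:: 9; 10; 11; 12] 7) => //.
    by move=> r; rewrite !inE => hr; apply: se; lia.
  rewrite E7 => l /T4 sl.
  set s1 := setl s [:: 9; 10; 11; 12] l.
  have El := envl [:: 9; 10; 11; 12] l isT s Es.
  have := @emits_if 17 (tgvalid x 9) (seqs (map (row_prog x) tags)) Skip s1
     (flatten [seq [:: gadj (mkv x l) v] | v <- gvs P]) [::].
  rewrite (tgvalidE _ _ El) gv1 //; apply; first by rewrite twf_tgvalid.
    move=> _; rewrite -flatten_map_if /gall flatten_map_allpairs; apply: emits_seqs => y.
    have E7' : size (s1 7) = pN P by case: El.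
    rewrite -E7'; apply: (@emits_loops 0 [:: 13; 14; 15; 16] 7) => //.
      move=> r; rewrite !inE => hr; rewrite /s1 setl_notin ?inE; last lia.
      by apply: se; lia.
    rewrite E7' => l' /T4 sl'; set s2 := setl s1 _ l'.
    have El' := envl [:: 13; 14; 15; 16] l' isT s1 El.
    have := @emits_if 17 (tgvalid y 13) (If (tgadj x 9 y 13) (Push 0 true) (Push 0 false)) Skip s2
      [:: gadj (mkv x l) (mkv y l')] [::].
    rewrite (tgvalidE _ _ El') gv2 //; apply; first by rewrite twf_tgvalid.
      move=> _; have := @emits_if 17 (tgadj x 9 y 13) (Push 0 true) (Push 0 false) s2
         [:: true] [:: false].
      rewrite tgadjE gv2 // gv3 //.
      have -> b : (if b then [:: true] else [:: false]) = [:: b] by case: b.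
      apply; first by rewrite twf_tgadj.
        by move=> _; exact: emits_push.
      by move=> _; exact: emits_push.
    by move=> _; exact: emits_skip.
  by move=> _; exact: emits_skip.
Qed.

End Reduction.

(** * Colourings, satisfying assignments and path models *)

Section Correctness.
Variables (h : nat) (VT : finType) (CL : seq (clause VT)) (P : params).
Hypotheses (h3 : 3 < h) (N0 : 0 < pN P).


Definition inrange (u : hvertex h CL) : bool := (u.2.1 < pN P) && (u.2.2 < pN P).

Lemma mem_gall (p : gvertex h CL) : (p \in gall h CL (pN P)) = inrange p.1 && inrange p.2.
Proof.
apply/allpairsP/idP => [[[x l] [_ hl ->]]|].
  move: hl; rewrite mem_tuples; case: l => [|t [|a [|t' [|a' []]]]] //=.
  by move=> /and5P [h1 h2 h3' h4 _]; rewrite /inrange /= h1 h2 h3' h4.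
case: p => [[x [t a]] [y [t' a']]]; rewrite /inrange /= => /andP [/andP [h1 h2] /andP [h3' h4]].
exists ((x, y), [:: t; a; t'; a']); split; [by rewrite mem_enum| |by []].
by rewrite mem_tuples /= h1 h2 h3' h4.
Qed.

Lemma uniq_gvs : uniq (gvs h CL P).
Proof.
apply: filter_uniq; apply: allpairs_uniq; rewrite ?enum_uniq ?uniq_tuples //.
move=> [x l] [x' l'] /allpairsP [[y m] [_ + [-> ->]]].
move=> + /allpairsP [[y' m'] [_ + [-> ->]]]; rewrite !mem_tuples /=.
case: m => [|t [|a [|b [|c []]]]] //= _; case: m' => [|t' [|a' [|b' [|c' []]]]] //= _.
by case: y y' => [? ?] [? ?]; rewrite /mkv /= => -[-> -> -> -> -> ->].
Qed.

Lemma hpre_irr (u : hvertex h CL) : hpre u u = false.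
Proof. by case: u => [[[i|[v b]]|[j k]] [t a]] /=; rewrite ?eqxx. Qed.

Lemma hadj_neq (u v : hvertex h CL) : hadj P u v -> u != v.
Proof. by apply: contraTneq => ->; rewrite /hadj hpre_irr !andbF. Qed.

Lemma hadj_valid (u v : hvertex h CL) : hadj P u v -> hvalid P u /\ hvalid P v.
Proof. by move=> /and3P [-> ->]. Qed.

Definition pal (i : 'I_h) : hvertex h CL := (inl (inl i), (0, 0)).

Lemma pal_inrange i : inrange (pal i).
Proof. by rewrite /inrange /= N0. Qed.

Definition palk (k : nat) (hk : k < h) : hvertex h CL := pal (Ordinal hk).

Lemma palk_neq k l (hk : k < h) (hl : l < h) : k != l -> palk hk != palk hl.
Proof. by apply: contraNneq => -[->]. Qed.

(** The neighbours must lie in range: palette vertices and literals find them in the palette, and a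
    clause corner takes the other two corners rather than its literal, which may fall outside. *)
Lemma two_neighbours (u : hvertex h CL) : hvalid P u -> inrange u -> exists v w,
  [/\ v != w, hadj P u v, hadj P u w & inrange v /\ inrange w].
Proof.
case: u => [[[i|[v b]]|[j k]] [t a]] hu ru.
- have [t0 a0] : t = 0 /\ a = 0 by move: hu => /andP [/eqP -> /eqP ->].
  have A k (hk : k < h) : k != i -> hadj P (inl (inl i), (t, a)) (palk hk).
    by move=> ki; rewrite /hadj hu /= eq_sym -val_eqE /= ki.
  have [k [l [kh lh kl [ki li]]]] : exists k l, [/\ k < h, l < h, k != l & k != i /\ l != i].
    have := h3; case: (i) => [[|[|m]] /= _] h4.
    + by exists 1, 2; split=> //; lia.
    + by exists 0, 2; split=> //; lia.
    + by exists 0, 1; split=> //; lia.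
  by exists (palk kh), (palk lh); rewrite !A // !pal_inrange palk_neq.
- have h2 : 2 < h by lia.
  by exists (palk h2), (palk h3); split; rewrite ?palk_neq ?pal_inrange.
- have A k' : k' != k -> hadj P (inr (j, k), (t, a)) (inr (j, k'), (t, a)).
    by move=> kk; rewrite /hadj /= (hu : gsem _ _ _ _) !eqxx eq_sym kk.
  have [k1 [k2 [k12 k1k k2k]]] : exists k1 k2 : 'I_3, [/\ k1 != k2, k1 != k & k2 != k].
    case: k {hu ru A} => [[|[|[|m]]] hk] //.
    + by exists (@Ordinal 3 1 isT), (@Ordinal 3 2 isT).
    + by exists (@Ordinal 3 0 isT), (@Ordinal 3 2 isT).
    + by exists (@Ordinal 3 0 isT), (@Ordinal 3 1 isT).
  exists (inr (j, k1), (t, a)), (inr (j, k2), (t, a)); rewrite !A //; split=> //.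
  by apply: contraNneq k12 => -[->].
Qed.

(** Only the part of H with both coordinates below [pN P] is coloured, since only this part is
    printed. *)
Definition hcol (c : nat) : Prop := exists col : hvertex h CL -> nat,
  (forall u, hvalid P u -> inrange u -> col u < c) /\
  (forall u v, inrange u -> inrange v -> hadj P u v -> col u != col v).

Lemma not_hcol : ~ hcol h.-1.
Proof.
move=> [col [colb colp]].
have b i : col (pal i) < h.-1 by apply: colb; rewrite ?pal_inrange.
have inj : injective (fun i => Ordinal (b i)).
  move=> i j [E]; apply/eqP/negPn/negP => ij.
  have := colp (pal i) (pal j) (pal_inrange i) (pal_inrange j).
  by rewrite E eqxx /hadj /= ij => /(_ isT).
by have := leq_card _ inj; rewrite !card_ord; lia.
Qed.

(** * The printed graph as an incidence graph *)

Definition gdefault : gvertex h CL := let i := Ordinal (ltnW (ltnW (ltnW h3))) in (pal i, pal i).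

Let n := size (gvs h CL P).
Let lab (i : 'I_n) : gvertex h CL := nth gdefault (gvs h CL P) i.
Let e : rel 'I_n := fun i j => gadj (lab i) (lab j).

Lemma mem_gvs p : (p \in gvs h CL P) = [&& gvalid P p, inrange p.1 & inrange p.2].
Proof. by rewrite mem_filter mem_gall. Qed.

Lemma stable_in u : hvalid P u -> inrange u -> (u, u) \in gvs h CL P.
Proof. by move=> hu ru; rewrite mem_gvs /gvalid /= eqxx hu ru. Qed.

Lemma gdefault_in : gdefault \in gvs h CL P.
Proof. by apply: stable_in; rewrite ?pal_inrange. Qed.

Lemma n0 : 0 < n.
Proof. by rewrite /n; case: (gvs h CL P) gdefault_in. Qed.

Definition idx (p : gvertex h CL) : 'I_n := insubd (Ordinal n0) (index p (gvs h CL P)).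

Lemma idxK p : p \in gvs h CL P -> lab (idx p) = p.
Proof. by move=> hp; rewrite /lab val_insubd index_mem hp nth_index. Qed.

Lemma lab_inj : injective lab.
Proof.
move=> i j E; apply: val_inj; apply/eqP.
by rewrite -(nth_uniq gdefault (ltn_ord i) (ltn_ord j) uniq_gvs) -/(lab i) -/(lab j) E.
Qed.

Lemma lab_in i : lab i \in gvs h CL P.
Proof. by rewrite mem_nth. Qed.

Lemma lab_idx i p : p \in gvs h CL P -> (i == idx p) = (lab i == p).
Proof. by move=> hp; rewrite -{2}(idxK hp) (inj_eq lab_inj). Qed.

Let K i := (lab i).1 != (lab i).2.
Let src i := idx ((lab i).1, (lab i).1).
Let tgt i := idx ((lab i).2, (lab i).2).

Lemma labK i : K i -> [/\ hadj P (lab i).1 (lab i).2, inrange (lab i).1, inrange (lab i).2,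
  ((lab i).1, (lab i).1) \in gvs h CL P & ((lab i).2, (lab i).2) \in gvs h CL P].
Proof.
move=> Ki; have := lab_in i; rewrite mem_gvs /gvalid (negbTE Ki) => /and3P [a r1 r2].
by have [v1 v2] := hadj_valid a; rewrite !stable_in.
Qed.

Lemma labS i : ~~ K i -> [/\ lab i = ((lab i).1, (lab i).1), hvalid P (lab i).1 & inrange (lab i).1].
Proof.
move=> /negPn /eqP Ei; have := lab_in i; rewrite mem_gvs => /and3P [v r _]; split=> //.
  by rewrite {2}Ei; case: (lab i).
by move: v => /orP [/andP [] //|/hadj_valid []].
Qed.

Lemma graph_incidence : incidence e K src tgt.
Proof.
split.
- by move=> i; rewrite /e /gadj; case: (_ == _) => /=; rewrite ?andbF ?eqxx.
- move=> u v; rewrite /K -(inj_eq lab_inj) /e /gadj => /negbTE -> /negbTE ->.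
  by case: (lab u) (lab v) => [a b] [c d]; rewrite xpair_eqE => ->.
- by move=> u v; rewrite /K /e /gadj => /negPn -> /negPn ->.
- move=> k s Kk Ks; have [Es _ _] := labS Ks; have [_ _ _ h1 h2] := labK Kk.
  have Ek : ((lab k).1 == (lab k).2) = false := negbTE Kk.
  have Es' : ((lab s).1 == (lab s).2) = true := negPn Ks.
  rewrite /e /gadj Ek Es' /= !lab_idx // Es !xpair_eqE !andbb /=.
  by rewrite orbF.
- move=> k Kk; have [a _ _ h1 h2] := labK Kk.
  rewrite /K /src /tgt !idxK //= !eqxx; split=> //.
  by rewrite lab_idx // idxK // xpair_eqE (negbTE (hadj_neq a)).
Qed.

Lemma graph_undominated : undominated e K.
Proof.
have [_ _ _ KS _] := graph_incidence.
split=> [s s' Ks Ks' ss'|s Ks].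
- have [Es vs rs] := labS Ks; have [Es' vs' rs'] := labS Ks'.
  have [v [w [vw av aw [rv rw]]]] := two_neighbours vs rs.
  (* Of the two neighbours of s in H one differs from s'; its edge with s is the clique vertex
     sought. *)
  have [x [ax rx xs']] : exists x, [/\ hadj P (lab s).1 x, inrange x & x != (lab s').1].
    case: (eqVneq v (lab s').1) => [E|]; last by exists v.
    by exists w; split=> //; rewrite -E eq_sym.
  have xin : ((lab s).1, x) \in gvs h CL P by rewrite mem_gvs /gvalid /= ax orbT rs rx.
  have Ek := idxK xin; have Kk : K (idx ((lab s).1, x)) by rewrite /K Ek /= (hadj_neq ax).
  exists (idx ((lab s).1, x)) => //.
  have [_ _ _ h1 h2] := labK Kk.
  have [-> _] := KS _ _ Kk Ks; have [-> _] := KS _ _ Kk Ks'.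
  rewrite /src /tgt !lab_idx // Ek /= Es Es' !xpair_eqE !andbb eqxx /= negb_or.
  rewrite -(inj_eq lab_inj) Es Es' xpair_eqE andbb in ss'.
  by rewrite eq_sym ss' eq_sym.
(* Palette vertices 0 and 1 are both stable, and one of them is not s. *)
- have h1 : 1 < h by lia.
  have h0 : 0 < h by lia.
  have in1 : (palk h1, palk h1) \in gvs h CL P by apply: stable_in; rewrite ?pal_inrange.
  have in0 : (palk h0, palk h0) \in gvs h CL P by apply: stable_in; rewrite ?pal_inrange.
  case: (eqVneq (idx (palk h1, palk h1)) s) => [E|ne].
    exists (idx (palk h0, palk h0)); first by rewrite /K idxK //= eqxx.
    by rewrite -E lab_idx // idxK // xpair_eqE (negbTE (palk_neq _ _ _)).
  by exists (idx (palk h1, palk h1)) => //; rewrite /K idxK //= eqxx.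
Qed.

Lemma colorable_hcol c : colorable K src tgt c <-> hcol c.
Proof.
split=> [[col [colb colp]]|[col [colb colp]]].
- exists (fun u => col (idx (u, u))); split=> [u vu ru|u v ru rv a].
    by apply: colb; rewrite /K idxK ?stable_in //= eqxx.
  have xin : (u, v) \in gvs h CL P by rewrite mem_gvs /gvalid /= a orbT ru rv.
  have := colp (idx (u, v)); rewrite /K /src /tgt idxK //= (hadj_neq a).
  exact.
- exists (fun i => col (lab i).1); split=> [s Ks|k Kk].
    by have [_ vs rs] := labS Ks; apply: colb.
  have [a r1 r2 h1 h2] := labK Kk.
  by rewrite /src /tgt !idxK //=; apply: colp.
Qed.

Theorem reduction_graph : exists n (e : rel 'I_n),
  [/\ enc_graph e = flatten [seq [:: true] | v <- gvs h CL P] ++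
        [:: false] ++ flatten [seq flatten [seq [:: gadj u v] | v <- gvs h CL P] | u <- gvs h CL P],
      promise e, ~ in_h21 h.-1 e & in_h21 h e <-> hcol h].
Proof.
exists n, e; have I := graph_incidence; have U := graph_undominated.
split.
- exact: enc_graph_nth.
- exact: incidence_promise n0 I U.
- move=> /(h21_colorable I U) /colorable_hcol; exact: not_hcol.
- rewrite -colorable_hcol; split=> [|C]; first exact: h21_colorable.
  by apply: colorable_h21 n0 _ I C; lia.
Qed.
End Correctness.

(** * Colourings and satisfying assignments *)

Section Colourings.
Variables (h : nat) (VT : finType) (CL : seq (clause VT)) (P : params).
Hypothesis h3 : 3 < h.

Definition assignment := VT -> nat -> nat -> bool.

Definition lit_true (al : assignment) (l : lit VT) (t a : nat) : bool :=
  let: (b, v, dt, da) := l in al v (t + dt) (a + da) == b.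

(** A literal beyond the range has no vertex, so the corner attached to it is unconstrained and its
    clause has to count as satisfied. The tableau argument only invokes clauses at positions where
    all their literals lie in range. *)
Definition lit_outside (l : lit VT) (t a : nat) : bool :=
  let: (b, v, dt, da) := l in (pN P <= t + dt) || (pN P <= a + da).

(** Colours are named by the palette, which is a clique on h vertices and so takes each of the h
    colours once. *)
Lemma hcol_sat : 0 < pN P -> hcol h CL P h -> exists al : assignment,
  forall (j : 'I_(size CL)) t a, t < pN P -> a < pN P -> gsem P (clause_at j).1 t a ->
  exists k, lit_outside ((clause_at j).2 k) t a || lit_true al ((clause_at j).2 k) t a.
Proof.
move=> N0 [col [colb colp]].
pose pi i := col (pal CL i).
have pib i : pi i < h by apply: colb; rewrite ?pal_inrange.
have inj : injective (fun i => Ordinal (pib i)).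
  move=> i j [E]; apply/eqP/negPn/negP => ij.
  have := colp (pal CL i) (pal CL j) (pal_inrange CL N0 i) (pal_inrange CL N0 j).
  by rewrite -/(pi i) -/(pi j) E eqxx /hadj /= ij => /(_ isT).
have onto x : x < h -> exists i, pi i = x.
  move=> xh; exists (invF inj (Ordinal xh)).
  by have := f_equal val (f_invF inj (Ordinal xh)).
pose c0 := @Ordinal h 0 (ltnW (ltnW (ltnW h3))).
pose c1 := @Ordinal h 1 (ltnW (ltnW h3)).
pose lv v b t a : hvertex h CL := (inl (inr (v, b)), (t, a)).
have colL v b t a : t < pN P -> a < pN P -> col (lv v b t a) = pi c0 \/ col (lv v b t a) = pi c1.
  move=> tN aN; have rl : inrange P (lv v b t a) by rewrite /inrange /= tN aN.
  have [i Ei] := onto _ (colb (lv v b t a) isT rl).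
  have i2 : ~~ (1 < i).
    apply/negP => i1; have := colp _ _ (pal_inrange CL N0 i) rl.
    by rewrite -/(pi i) Ei eqxx /hadj /= i1 => /(_ isT).
  rewrite -Ei; case: i i2 {Ei} => [[|[|i]] hi] //= _.
    by left; congr pi; apply: val_inj.
  by right; congr pi; apply: val_inj.
have c01 : pi c0 <> pi c1.
  by move=> E; have /(f_equal val) // : c0 = c1 by apply: inj; apply: val_inj.
have colLL v t a : t < pN P -> a < pN P -> col (lv v true t a) != col (lv v false t a).
  by move=> tN aN; apply: colp; rewrite /inrange /hadj /= ?tN ?aN // !eqxx.
exists (fun v t a => col (lv v true t a) == pi c0) => j t a tN aN gj.
apply/existsP; apply: contraT => /existsPn none.
pose cv k : hvertex h CL := (inr (j, k), (t, a)).
have rc k : inrange P (cv k) by rewrite /inrange /= tN aN.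
have vc k : hvalid P (cv k) by [].
(* When no literal of the clause is outside or true, a corner with the colour of falsity would face
   a literal of the same colour. So the three corners, pairwise adjacent, are left with the two
   colours of palette vertices 2 and 3. *)
have idxc k : exists2 i : 'I_h, col (cv k) = pi i & 1 < i < 4.
  have [i Ei] := onto _ (colb _ (vc k) (rc k)).
  exists i => //.
  have i03 : ~~ ((val i == 0) || (3 < i)).
    apply/negP => hi; have := colp _ _ (pal_inrange CL N0 i) (rc k).
    by rewrite -/(pi i) Ei eqxx /hadj /= hi gj => /(_ isT).
  have i1 : val i != 1.
    apply/negP => /eqP hi; have {}hi : i = c1 by apply: val_inj.
    have := none k; rewrite negb_or.
    case El: ((clause_at j).2 k) => [[[b v] dt] da] /= /andP [].
    rewrite negb_or -!ltnNge => /andP [tN' aN'] nt.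
    have ra : inrange P (lv v b (t + dt) (a + da)) by rewrite /inrange /= tN' aN'.
    have adj : hadj P (cv k) (lv v b (t + dt) (a + da)).
      by rewrite /hadj vc /= El !eqxx.
    have := colp _ _ (rc k) ra adj; rewrite -Ei hi => ne.
    have := colLL v _ _ tN' aN'; move: ne nt.
    case: b {El ra adj} => ne nt nLL.
      have [E|E] := colL v true _ _ tN' aN'; first by rewrite E eqxx in nt.
      by rewrite E eqxx in ne.
    have [E|E] := colL v false _ _ tN' aN'; last by rewrite E eqxx in ne.
    have [E'|E'] := colL v true _ _ tN' aN'; first by rewrite E E' eqxx in nLL.
    by move: nt; rewrite E' eqbF_neg negbK => /eqP E2; case: c01.
  rewrite /= in i03 i1; lia.
have dist k k' : k != k' -> col (cv k) != col (cv k').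
  by move=> kk; apply: colp => //; rewrite /hadj /= gj !eqxx kk.
have [i0 E0 h0] := idxc (@Ordinal 3 0 isT).
have [i1 E1 h1] := idxc (@Ordinal 3 1 isT).
have [i2 E2 h2] := idxc (@Ordinal 3 2 isT).
have ne i i' : pi i != pi i' -> nat_of_ord i != nat_of_ord i'.
  by apply: contraNneq => E; have -> : i = i' by apply: val_inj.
have := dist (@Ordinal 3 0 isT) (@Ordinal 3 1 isT) isT.
have := dist (@Ordinal 3 0 isT) (@Ordinal 3 2 isT) isT.
have := dist (@Ordinal 3 1 isT) (@Ordinal 3 2 isT) isT.
rewrite E0 E1 E2 => /ne + /ne + /ne; lia.
Qed.

Lemma sat_hcol (al : assignment) :
  (forall (j : 'I_(size CL)) t a, gsem P (clause_at j).1 t a ->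
     exists k, lit_true al ((clause_at j).2 k) t a) -> hcol h CL P h.
Proof.
move=> sat.
pose good (j : 'I_(size CL)) t a : 'I_3 :=
  odflt ord0 [pick k | lit_true al ((clause_at j).2 k) t a].
(* The corner [good j t a], at a true literal, gets colour 1; the other two get 2 and 3 cyclically,
   colours that no literal has. *)
pose col (u : hvertex h CL) : nat := match u with
  | (inl (inl i), _) => i
  | (inl (inr (v, b)), (t, a)) => if al v t a == b then 0 else 1
  | (inr (j, k), (t, a)) => ((k + 3 - good j t a) %% 3).+1
  end.
have goodP j t a : gsem P (clause_at j).1 t a -> lit_true al ((clause_at j).2 (good j t a)) t a.
  move=> /sat [k hk]; rewrite /good; case: pickP => [k' //|/= none].
  by rewrite none in hk.
exists col; split=> [[[[i|[v b]]|[j k]] [t a]] hu _ /=|].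
- exact: ltn_ord.
- by case: ifP => _; lia.
- by have := ltn_pmod (k + 3 - good j t a) (isT : 0 < 3); lia.
suff H u v : hvalid P u -> hvalid P v -> hpre u v -> col u != col v.
  by move=> u v _ _ /and3P [hu hv /orP [|]]; [|rewrite eq_sym]; apply: H.
case: u => [[[i|[x b]]|[j k]] [t a]]; case: v => [[[i'|[x' b']]|[j' k']] [t' a']] //=.
- by move=> _ _ i1; case: ifP; lia.
- by move=> _ _; have := ltn_pmod (k' + 3 - good j' t' a') (isT : 0 < 3); lia.
- move=> _ _ /andP [/andP [/eqP <- bb] /andP [/eqP <- /eqP <-]].
  by case: (al x t a) b b' bb => [] [] [].
- move=> gj _; case El: ((clause_at j).2 k) => [[[b0 v0] dt] da].
  move=> /andP [/andP [/eqP -> /eqP ->] /andP [/eqP <- /eqP <-]].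
  have := goodP j t a gj; case: (eqVneq k (good j t a)) => [<-|ne _].
    by rewrite El /= => ->.
  have : nat_of_ord k != good j t a by [].
  have := ltn_ord k; have := ltn_ord (good j t a).
  case: ifP => _; move: (nat_of_ord k) (nat_of_ord (good j t a)) => y z; clear => *.
    by [].
  rewrite eqSS; lia.
- move=> _ _ /andP [/andP [/eqP <- kk] /andP [/eqP <- /eqP <-]].
  have : nat_of_ord k != k' by [].
  have := ltn_ord k; have := ltn_ord k'; have := ltn_ord (good j t a).
  move: (nat_of_ord k) (nat_of_ord k') (nat_of_ord (good j t a)) => x y z; clear => *.
  rewrite eqSS; lia.
Qed.
End Colourings.

(** * The computation tableau *)

Fixpoint holdall (A : Type) (Q : A -> Prop) (l : seq A) : Prop :=
  if l is a :: l' then Q a /\ holdall Q l' else True.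

Lemma holdall_cat A (Q : A -> Prop) l1 l2 :
  holdall Q (l1 ++ l2) <-> holdall Q l1 /\ holdall Q l2.
Proof. by elim: l1 => [|a l IH] /=; [split=> [|[]]|rewrite IH; split=> [[? []]|[[]]]]. Qed.

Lemma holdall_enum (F : finType) A (Q : A -> Prop) (f : F -> A) :
  holdall Q (map f (enum F)) <-> forall x, Q (f x).
Proof.
split=> [H x|H]; last by elim: (enum F) => //= a l IH; split.
have : x \in enum F by rewrite mem_enum.
by elim: (enum F) H => //= a l IH [Qa Hl]; rewrite inE => /orP [/eqP ->|/(IH Hl)].
Qed.

Lemma holdall_tnth A (Q : A -> Prop) (l : seq A) :
  holdall Q l <-> forall j : 'I_(size l), Q (tnth (in_tuple l) j).
Proof.
split=> [|H].
  move=> H j; rewrite (tnth_nth (tnth (in_tuple l) j)) /=.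
  move: (tnth _ _) (nat_of_ord j) (ltn_ord j) => d i {j}.
  by elim: l i H => //= a l IH [|i] [Qa Hl] //= lti; apply: IH.
have {}H d i : i < size l -> Q (nth d l i).
  by move=> lti; have := H (Ordinal lti); rewrite (tnth_nth d).
elim: l H => //= a l IH H; split; first exact: (H a 0).
by apply: IH => d i lti; apply: (H d i.+1).
Qed.

Lemma onth_cat (T : Type) (s1 s2 : seq T) i :
  onth (s1 ++ s2) i = if i < size s1 then onth s1 i else onth s2 (i - size s1).
Proof. by elim: s1 i => [|a s1 IH] [|i] //=. Qed.

(** * Local transitions and clauses *)

Section Tableau.
Variable M : TM.
Notation Q := 'I_(tm_q M).+1.
Definition csym : finType := (option bool * option Q)%type.
Definition cvar : finType := (csym + csym * csym)%type.

(** The new content of a cell from the old contents of it and its two neighbours. Triples with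
    several heads do not occur in a run; they are given some value because there is a clause for
    every triple. *)
Definition next (l c r : csym) : csym :=
  match c with
  | (s, Some q) =>
      if tm_halt q then c else
      let: (q', w, mv) := tm_delta q s in (w, if mv is Stay then Some q' else None)
  | (s, None) =>
      let from_right := if r is (s', Some q) then
          if tm_halt q then None else
          if tm_delta q s' is (q', _, MoveL) then Some q' else None
        else None in
      (s, if l is (s', Some q) then
            if tm_halt q then from_right else
            if tm_delta q s' is (q', _, MoveR) then Some q' else from_right
          else from_right)
  end.

Notation mstep := (gstep (@tm_halt M) (@tm_delta M)).

Definition cell (c : Q * tape * Z) (x : Z) : csym :=
  (c.1.2 x, if (x =? c.2)%Z then Some c.1.1 else None).

Lemma cell_next c x : cell (mstep c) x = next (cell c (x - 1)) (cell c x) (cell c (x + 1)).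
Proof.
case: c => [[q T] p]; rewrite /cell /=.
case hq: (tm_halt q); rewrite /=.
  by zcases => * /=; try lia; rewrite ?hq.
case: (Z.eqb_spec x p) => [->|xp].
  rewrite hq; case: (tm_delta q (T p)) => [[q' w] mv] /=.
  by rewrite upd_eq; case: mv => /=; zcases => //; lia.
case: (Z.eqb_spec (x - 1) p) => [E|xl].
  have -> : (x + 1 =? p)%Z = false by apply/Z.eqb_neq; lia.
  rewrite hq E; case: (tm_delta q (T p)) => [[q' w] mv] /=.
  by rewrite upd_neq //; case: mv => /=; zcases => //; lia.
case: (Z.eqb_spec (x + 1) p) => [E|xr].
  rewrite hq E; case: (tm_delta q (T p)) => [[q' w] mv] /=.
  by rewrite upd_neq //; case: mv => /=; zcases => //; lia.
case: (tm_delta q (T p)) => [[q' w] mv] /=.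
by rewrite upd_neq //; case: mv => /=; zcases => //; lia.
Qed.

Definition blank : csym := (None, None).

Definition mkclause (g : guard) (l1 l2 l3 : lit cvar) : clause cvar :=
  (g, fun k : 'I_3 => nth l1 [:: l1; l2; l3] k).
(** The literal is repeated because the gadget of a clause is always a triangle. *)
Definition unit_clause (g : guard) (s : csym) (b : bool) : clause cvar :=
  let l : lit cvar := (b, inl s, false, false) in mkclause g l l l.

(* [inl s] at (t, a) says that cell a holds s at time t, and [inr (s, s')] that
   the cells a - 1 and a hold s and s'.  All clauses but [GGuess] are Horn
   clauses, which force the true symbols of the run without excluding others. *)
Definition clauses : seq (clause cvar) :=
  [seq mkclause GTrue (false, inl p.1, false, false) (false, inl p.2, false, true)
      (true, inr p, false, true) | p : csym * csym <- enum {: csym * csym}] ++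
  [seq mkclause GTrue (false, inr p.1, false, false) (false, inl p.2, false, true)
      (true, inl (next p.1.1 p.1.2 p.2), true, false)
      | p : csym * csym * csym <- enum {: csym * csym * csym}] ++
  [seq unit_clause (GHead b) (Some b, Some ord0) true | b <- enum {: bool}] ++
  [seq unit_clause (GIn b) (Some b, None) true | b <- enum {: bool}] ++
  [seq unit_clause GFinal (Some false, Some q) false | q : Q <- enum Q] ++
  [:: unit_clause GLeft blank true; unit_clause GRight blank true;
      unit_clause GLBlank blank true; unit_clause GRBlank blank true;
      mkclause GGuess (true, inl (Some true, None), false, false)
        (true, inl (Some false, None), false, false) (true, inl blank, false, false);
      mkclause GMono (false, inl blank, false, false) (true, inl blank, false, true)
        (true, inl blank, false, true)].

(** * The tableau of a run *)

Variables (x : seq bool) (W O : nat).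
Definition word_prefix : seq bool := flatten [seq [:: b; b] | b <- x] ++ [:: false; true].
Definition tab_X : seq bool := nseq O false ++ word_prefix.
(** O exceeds the running time, so the head stays at distance less than O from its start in column
    O, and E is where the longest pair encoding ends. With [E + O + 3] the last column is out of
    reach of the head and beyond the word, and the last row comes after halting. *)
Definition tab_params : params :=
  let E := size tab_X + W in Params (E + O + 3) O E tab_X.

Lemma pair_encE w : pair_enc x w = word_prefix ++ w.
Proof. by rewrite /pair_enc /word_prefix -catA. Qed.

Definition conf (w : seq bool) (t : nat) := iter t mstep (ord0, word_tape (pair_enc x w), 0%Z).
Definition tcell (w : seq bool) (t a : nat) : csym :=
  cell (conf w t) (Z.of_nat a - Z.of_nat O).

Lemma tcell_next w t a : 0 < a ->
  tcell w t.+1 a = next (tcell w t a.-1) (tcell w t a) (tcell w t a.+1).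
Proof.
move=> a0; rewrite /tcell /conf iterS cell_next.
by congr next; congr cell; lia.
Qed.

Lemma tcell0 w a : tcell w 0 a =
  (if a < O then None else onth (word_prefix ++ w) (a - O), if a == O then Some ord0 else None).
Proof.
rewrite /tcell /cell /= pair_encE /word_tape; congr (_, _).
  case: ltnP => aO; zcases; try lia; move=> //.
  by move=> _; congr onth; lia.
by case: eqP => aO; zcases => //; lia.
Qed.

Lemma size_tab_X : size tab_X = O + size word_prefix.
Proof. by rewrite size_cat size_nseq. Qed.

Lemma size_word_prefix : 1 < size word_prefix.
Proof. by rewrite size_cat addn2. Qed.

Lemma pbit_tab a : O <= a < size tab_X ->
  onth word_prefix (a - O) = Some (pbit tab_params a).
Proof.
rewrite size_tab_X => /andP [Oa aX].
have -> : pbit tab_params a = (onth word_prefix (a - O) == Some true).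
  by rewrite /pbit -[pX _]/(nseq O false ++ word_prefix) onth_cat size_nseq ltnNge Oa.
have : isSome (onth word_prefix (a - O)) by rewrite onth_lt; lia.
by case: (onth _ _) => [[]|].
Qed.

(** Here b is the answer, [false] included: the run halts in fewer than O steps with its head on
    b. *)
Definition accepts (w : seq bool) (b : bool) : Prop :=
  exists t0, t0 < O /\ tm_halt (conf w t0).1.1 /\ (conf w t0).1.2 (conf w t0).2 = Some b.

Lemma mstep_halt c : tm_halt c.1.1 -> mstep c = c.
Proof. by case: c => [[q T] p] /= ->. Qed.

Lemma conf_after w t0 t : tm_halt (conf w t0).1.1 -> t0 <= t -> conf w t = conf w t0.
Proof.
move=> ht; elim: t => [|t IH] lt; first by have -> : t0 = 0 by lia.
case: (eqVneq t0 t.+1) => [-> //|ne].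
by rewrite /conf iterS -/(conf w t) IH ?mstep_halt //; lia.
Qed.

Lemma conf_local w t : (Z.abs (conf w t).2 <= Z.of_nat t)%Z /\
  forall z, (Z.of_nat t <= Z.abs z)%Z -> (conf w t).1.2 z = word_tape (pair_enc x w) z.
Proof.
elim: t => [|t [IHp IHt]]; first by split.
rewrite /conf iterS -/(conf w t).
case: (conf w t) IHp IHt => [[q T] p] /= IHp IHt.
case: ifP => _ /=; first by split=> [|z hz]; [lia|apply: IHt; lia].
case: (tm_delta q (T p)) => [[q' v] mv] /=; split; first by case: mv => /=; lia.
by move=> z hz; rewrite upd_neq; [apply: IHt; lia|lia].
Qed.

Lemma head_bound w b t : accepts w b -> (Z.abs (conf w t).2 < Z.of_nat O)%Z.
Proof.
move=> [t0 [lt [ht _]]]; case: (leqP t0 t) => tt.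
  by rewrite (conf_after ht tt); have [] := conf_local w t0; lia.
by have [] := conf_local w t; lia.
Qed.

(** Until halting neither the head nor its changes have come this far, by [conf_local]; afterwards
    nothing moves. *)
Lemma far_cell w b t z : accepts w b -> (Z.of_nat O <= Z.abs z)%Z ->
  cell (conf w t) z = (word_tape (pair_enc x w) z, None).
Proof.
move=> acc hz; have hb := head_bound t acc.
rewrite /cell; have -> : (z =? (conf w t).2)%Z = false by apply/Z.eqb_neq; lia.
congr (_, _); have [t0 [lt [ht _]]] := acc.
case: (leqP t0 t) => tt.
  by rewrite (conf_after ht tt); have [_ H] := conf_local w t0; apply: H; lia.
by have [_ H] := conf_local w t; apply: H; lia.
Qed.

Lemma tcell_left w b t : accepts w b -> tcell w t 0 = blank.
Proof.
move=> acc; rewrite /tcell (far_cell t acc); last lia.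
by have [t0 [lt _]] := acc; rewrite /word_tape; zcases => //; lia.
Qed.

Lemma tcell_right w b t a : accepts w b -> size w <= W -> a + 1 = pN tab_params ->
  tcell w t a = blank.
Proof.
move=> acc sw; rewrite /= size_tab_X => aN; rewrite /tcell (far_cell t acc); last lia.
rewrite /word_tape; zcases => // _; rewrite onth_size // pair_encE size_cat; lia.
Qed.

Lemma final_head w b : accepts w b -> forall q a,
  tcell w (pN tab_params).-1 a <> (Some (~~ b), Some q).
Proof.
move=> [t0 [lt [ht hb]]] q a; rewrite /tcell (conf_after ht); last by rewrite /=; lia.
rewrite /cell; zcases => // -> [E _]; move: E; rewrite hb => -[]; by case: b {hb}.
Qed.

Definition run_assignment (w : seq bool) : assignment cvar := fun v t a =>
  match v with
  | inl s => tcell w t a == s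
  | inr (s, s') => [&& 0 < a, tcell w t a.-1 == s & tcell w t a == s']
  end.

Lemma exists3 (R : 'I_3 -> Prop) k (hk : k < 3) : R (Ordinal hk) -> exists i, R i.
Proof. by exists (Ordinal hk). Qed.

Lemma tableau_complete w : size w <= W -> accepts w true ->
  forall (j : 'I_(size clauses)) t a, gsem tab_params (clause_at j).1 t a ->
  exists k, lit_true (run_assignment w) ((clause_at j).2 k) t a.
Proof.
move=> sw acc; rewrite /clause_at -(holdall_tnth (fun c => forall t a,
  gsem tab_params c.1 t a -> exists k, lit_true (run_assignment w) (c.2 k) t a)).
have U g s b : (forall t a, gsem tab_params g t a -> (tcell w t a == s) = b) ->
    forall t a, gsem tab_params (unit_clause g s b).1 t a ->
    exists k, lit_true (run_assignment w) ((unit_clause g s b).2 k) t a.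
  by move=> H t a /H E; exists ord0; rewrite /lit_true /= !addn0 E.
have sX := size_tab_X; have sp := size_word_prefix.
rewrite /clauses !holdall_cat !holdall_enum; do !split.
- move=> [s s'] t a _.
  case: (eqVneq (tcell w t a) s) => [E|ne]; last first.
    by apply: (@exists3 _ 0 isT); rewrite /lit_true /= !addn0 (negbTE ne).
  case: (eqVneq (tcell w t (a + 1)) s') => [E'|ne]; last first.
    by apply: (@exists3 _ 1 isT); rewrite /lit_true /= !addn0 (negbTE ne).
  by apply: (@exists3 _ 2 isT); rewrite /lit_true /= !addn0 addn1 /= E -E' addn1 !eqxx.
- move=> [[s s'] s''] t a _.
  case: (boolP [&& 0 < a, tcell w t a.-1 == s & tcell w t a == s']) => [|ne]; last first.
    by apply: (@exists3 _ 0 isT); rewrite /lit_true /= !addn0 (negbTE ne).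
  move=> /and3P [a0 /eqP E1 /eqP E2].
  case: (eqVneq (tcell w t (a + 1)) s'') => [E'|ne]; last first.
    by apply: (@exists3 _ 1 isT); rewrite /lit_true /= !addn0 (negbTE ne).
  apply: (@exists3 _ 2 isT); rewrite /lit_true /= addn1 addn0 tcell_next // E1 E2.
  by rewrite -E' addn1 eqxx.
- move=> b; apply: U => t a /= /andP [/andP [/eqP -> /eqP ->] /eqP <-].
  rewrite tcell0 eqxx ltnn onth_cat subnn; have -> : 0 < size word_prefix by lia.
  by have := @pbit_tab O; rewrite subnn => ->; rewrite ?eqxx // leqnn sX; lia.
- move=> b; apply: U => t a /= /andP [/andP [/eqP -> /andP [Oa aX]] /eqP <-].
  rewrite tcell0 ltnNge (ltnW Oa) /= onth_cat; have -> : a - O < size word_prefix by lia.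
  rewrite pbit_tab ?(ltnW Oa) //; have -> : (a == O) = false by lia.
  by rewrite eqxx.
- move=> q; apply: U => t a /= /eqP tN; apply/negP => /eqP E.
  have tE : t = (pN tab_params).-1 by rewrite /=; lia.
  by have := @final_head w true acc q a; rewrite -tE E.
- by apply: U => t a /= /eqP ->; rewrite (tcell_left t acc) eqxx.
- by apply: U => t a /= /eqP aN; rewrite (tcell_right t acc sw) ?eqxx // aN.
- apply: U => t a /= /andP [/eqP -> aO]; rewrite tcell0 aO.
  by have -> : (a == O) = false by lia.
- apply: U => t a /= /andP [/eqP -> aE]; rewrite tcell0.
  have -> : (a == O) = false by lia.
  have -> : (a < O) = false by lia.
  by rewrite onth_size // size_cat; lia.
- move=> t a /= /andP [/eqP -> /andP [aX aE]].
  have E : exists c, tcell w 0 a = (c, None).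
    rewrite tcell0; have -> : (a == O) = false by lia.
    by eexists.
  case: E => -[[]|] E.
  + by apply: (@exists3 _ 0 isT); rewrite /lit_true /= !addn0 E.
  + by apply: (@exists3 _ 1 isT); rewrite /lit_true /= !addn0 E.
  + by apply: (@exists3 _ 2 isT); rewrite /lit_true /= !addn0 E.
- move=> t a /= /andP [/eqP -> aX].
  case: (boolP (tcell w 0 a == blank)) => [|ne]; last first.
    by apply: (@exists3 _ 0 isT); rewrite /lit_true /= !addn0 (negbTE ne).
  move=> /eqP; rewrite tcell0; have -> : (a < O) = false by lia.
  have -> : (a == O) = false by lia.
  (* A blank in column a says that the word has ended, so the next column is blank too. *)
  move=> [E]; apply: (@exists3 _ 1 isT); rewrite /lit_true /= addn0 tcell0.
  have -> : (a + 1 < O) = false by lia.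
  have -> : (a + 1 == O) = false by lia.
  have h1 : size (word_prefix ++ w) <= a - O by rewrite leqNgt -onth_lt E.
  by rewrite onth_size //; lia.
Qed.

Lemma exists3_nth (A : Type) (R : A -> bool) (a b c : A) :
  (exists k : 'I_3, R (nth a [:: a; b; c] k)) -> [|| R a, R b | R c].
Proof. by move=> [[[|[|[|k]]] hk]] //= ->; rewrite ?orbT. Qed.

(** A word is read off the guessed region of row 0; the clauses then force the assignment to be true
    on every cell of the run on that word, whatever else it makes true. The hypothesis that each
    word gets an answer keeps the run within the tableau. *)
Lemma tableau_sound (al : assignment cvar) :
  (forall w, size w <= W -> exists b, accepts w b) ->
  (forall (j : 'I_(size clauses)) t a, t < pN tab_params -> a < pN tab_params ->
     gsem tab_params (clause_at j).1 t a -> exists k,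
       lit_outside tab_params ((clause_at j).2 k) t a || lit_true al ((clause_at j).2 k) t a) ->
  exists2 w, size w <= W & accepts w true.
Proof.
move=> halts; rewrite /clause_at -(holdall_tnth (fun c => forall t a,
  t < pN tab_params -> a < pN tab_params -> gsem tab_params c.1 t a -> exists k,
  lit_outside tab_params (c.2 k) t a || lit_true al (c.2 k) t a)).
set N := pN tab_params.
have sX := size_tab_X; have sp := size_word_prefix.
have NE : N = size tab_X + W + O + 3 by [].
have use g l1 l2 l3 : (forall t a, t < N -> a < N -> gsem tab_params (mkclause g l1 l2 l3).1 t a ->
      exists k, lit_outside tab_params ((mkclause g l1 l2 l3).2 k) t a ||
                lit_true al ((mkclause g l1 l2 l3).2 k) t a) ->
    forall t a, t < N -> a < N -> gsem tab_params g t a ->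
      [|| lit_outside tab_params l1 t a || lit_true al l1 t a,
          lit_outside tab_params l2 t a || lit_true al l2 t a |
          lit_outside tab_params l3 t a || lit_true al l3 t a].
  move=> H t a tN aN hg; have := H t a tN aN hg.
  exact: (exists3_nth (R := fun l => lit_outside tab_params l t a || lit_true al l t a)).
have useU g c b : (forall t a, t < N -> a < N -> gsem tab_params (unit_clause g c b).1 t a ->
      exists k, lit_outside tab_params ((unit_clause g c b).2 k) t a ||
                lit_true al ((unit_clause g c b).2 k) t a) ->
    forall t a, t < N -> a < N -> gsem tab_params g t a -> al (inl c) t a = b.
  move=> H t a tN aN hg; have := use _ _ _ _ H t a tN aN hg.
  by rewrite !orbb /lit_outside /lit_true !addn0 -/N (leqNgt N) tN (leqNgt N) aN => /eqP.
rewrite /clauses !holdall_cat !holdall_enum => -[C1 [C2 [CH [CI [CF CR]]]]].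
have [CL [CRt [CLB [CRB [CG [CM _]]]]]] := CR; clear CR.
have {}C1 c c' t a : t < N -> a + 1 < N -> al (inl c) t a -> al (inl c') t (a + 1) ->
    al (inr (c, c')) t (a + 1).
  move=> tN aN h1 h2; have := use _ _ _ _ (C1 (c, c')) t a tN _ isT.
  rewrite /lit_outside /lit_true /= !addn0 -/N h1 h2 /= !(leqNgt N) tN aN.
  have -> : a < N by lia.
  by move=> /(_ isT) /= /eqP.
have {}C2 c c' c'' t a : t + 1 < N -> a + 1 < N -> al (inr (c, c')) t a ->
    al (inl c'') t (a + 1) -> al (inl (next c c' c'')) (t + 1) a.
  move=> tN aN h1 h2; have := use _ _ _ _ (C2 (c, c', c'')) t a _ _ isT.
  rewrite /lit_outside /lit_true /= !addn0 -/N h1 h2 /= !(leqNgt N) tN aN.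
  have -> : a < N by lia.
  have -> : t < N by lia.
  by move=> /(_ isT isT) /= /eqP.
have {}CH b := useU _ _ _ (CH b); have {}CI b := useU _ _ _ (CI b).
have {}CF q := useU _ _ _ (CF q); have {}CL := useU _ _ _ CL; have {}CRt := useU _ _ _ CRt.
have {}CLB := useU _ _ _ CLB; have {}CRB := useU _ _ _ CRB.
have {}CG a : size tab_X <= a < size tab_X + W -> [|| al (inl (Some true, None)) 0 a,
    al (inl (Some false, None)) 0 a | al (inl blank) 0 a].
  move=> ha; have := use _ _ _ _ CG 0 a.
  rewrite /lit_outside /lit_true /= !addn0 -/N.
  have -> : (N <= 0) = false by lia.
  have -> : (N <= a) = false by lia.
  rewrite !eqb_id /=; apply; lia.
have {}CM a : size tab_X <= a -> a + 1 < N -> al (inl blank) 0 a -> al (inl blank) 0 (a + 1).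
  move=> ha aN h1; have := use _ _ _ _ CM 0 a.
  rewrite /lit_outside /lit_true /= !addn0 -/N h1.
  have -> : (N <= 0) = false by lia.
  have -> : (N <= a) = false by lia.
  have -> : (N <= a + 1) = false by lia.
  by rewrite !eqb_id /= orbb; apply; lia.
(* The word ends at the first column of the region where blank is true. Before it one of the two
   letters is true by [CG]; if both are, [true] is taken. *)
pose s := [seq al (inl blank) 0 (size tab_X + i) | i <- iota 0 W].
pose m := find id s.
pose w := [seq al (inl (Some true, None)) 0 (size tab_X + i) | i <- iota 0 m].
have mW : m <= W by rewrite /m; apply: leq_trans (find_size _ _) _; rewrite size_map size_iota.
have sw : size w = m by rewrite size_map size_iota.
have before i : i < m -> al (inl blank) 0 (size tab_X + i) = false.
  move=> im; have := before_find false im.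
  by rewrite (nth_map 0) ?nth_iota ?size_iota ?add0n //; lia.
(* [CM] propagates blanks to the right, so the rest of the region agrees with the chosen word. *)
have after i : m <= i < W -> al (inl blank) 0 (size tab_X + i).
  elim: i => [|i IH] /andP [mi iW].
    have m0 : m = 0 by lia.
    have hs : has id s by rewrite has_find -/m size_map size_iota m0.
    by have := nth_find false hs; rewrite -/m m0 (nth_map 0) ?nth_iota ?size_iota.
  case: (eqVneq m i.+1) => [E|ne].
    have hs : has id s by rewrite has_find -/m size_map size_iota E.
    by have := nth_find false hs; rewrite -/m E (nth_map 0) ?nth_iota ?size_iota.
  have -> : size tab_X + i.+1 = size tab_X + i + 1 by lia.
  by apply: CM; [lia|lia|apply: IH; lia].
have [b acc] : exists b, accepts w b by apply: halts; rewrite sw.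
exists w; first by rewrite sw.
have row0 a : a < N -> al (inl (tcell w 0 a)) 0 a.
  move=> aN; rewrite tcell0; case: (ltngtP a O) => aO.
  - by apply: CLB; rewrite //= ?aO //; lia.
  - case: (ltnP a (size tab_X)) => aX.
      rewrite onth_cat; have -> : a - O < size word_prefix by lia.
      rewrite pbit_tab ?(ltnW aO) //.
      by apply: CI; rewrite //= ?aO ?aX ?eqxx //; lia.
    case: (ltnP a (size tab_X + W)) => aE; last first.
      rewrite onth_size; last by rewrite size_cat sw; lia.
      by apply: CRB; rewrite //= -?leqNgt ?aE //; lia.
    rewrite onth_cat; have -> : (a - O < size word_prefix) = false by lia.
    have [i Ei] : exists i, a = size tab_X + i by exists (a - size tab_X); lia.
    have -> : a - O - size word_prefix = i by lia.
    case: (ltnP i m) => im; last first.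
      by rewrite onth_size ?sw // Ei; apply: after; lia.
    have -> : onth w i = Some (al (inl (Some true, None)) 0 a).
      by rewrite onth_nth_map (nth_map false) ?sw // (nth_map 0) ?nth_iota ?size_iota // -Ei.
    have := CG a; rewrite {5}Ei before // aX aE orbF => /(_ isT).
    by case E1: (al (inl (Some true, None)) 0 a) => //= ->.
  - rewrite aO onth_cat subnn; have -> : 0 < size word_prefix by lia.
    have := @pbit_tab O; rewrite subnn leqnn => ->; last lia.
    by apply: CH; rewrite //= ?eqxx //; lia.
(* Border columns follow from their unit clauses; an inner cell follows from the pair clause for its
   left neighbour and itself and then the transition clause. *)
have rows t : t < N -> forall a, a < N -> al (inl (tcell w t a)) t a.
  elim: t => [_|t IH tN] a aN; first exact: row0.
  case: (posnP a) => [->|a0].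
    by rewrite (tcell_left _ acc); apply: CL => //; lia.
  case: (eqVneq (a + 1) N) => [aE|ne].
    by rewrite (tcell_right _ acc) ?sw //; apply: CRt => //=; apply/eqP.
  rewrite tcell_next // -[t.+1]addn1.
  have E1 : a = a.-1 + 1 by lia.
  apply: C2; try lia; last by rewrite -addn1; apply: IH; lia.
  rewrite {2 3}E1; apply: C1; try lia; first by apply: IH; lia.
  by rewrite -E1; apply: IH; lia.
(* If the answer were [false], the last row would be forced to contain a head scanning [false],
   which [CF] forbids. *)
case: b acc => // acc; exfalso.
have [t0 [lt [ht hb]]] := acc.
have tE : N.-1 < N by rewrite NE; lia.
pose p := (conf w N.-1).2; have hp := head_bound N.-1 acc; rewrite -/p in hp.
pose a := Z.to_nat (p + Z.of_nat O).
have aN : a < N by rewrite /a NE; lia.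
have Ea : tcell w N.-1 a = (Some false, Some (conf w N.-1).1.1).
  rewrite /tcell; have -> : (Z.of_nat a - Z.of_nat O)%Z = p by rewrite /a; lia.
  rewrite /cell /p Z.eqb_refl; congr (_, _).
  by rewrite (conf_after ht) //; rewrite NE; lia.
have := rows _ tE _ aN; rewrite Ea CF //=.
by apply/eqP; rewrite -/N NE; lia.
Qed.
End Tableau.

(** * The reduction *)

(** Concrete states as lists, so that the effect of the setup on the stacks is found by
    computation. *)
Definition st (l : seq (seq bool)) : state := nth [::] l.

Lemma set_st l i v : set (st l) i v = st (set_nth [::] l i v).
Proof. by apply: functional_extensionality => r; rewrite /st nth_set_nth. Qed.

Lemma size_st l V r : all (fun v => size v <= V) l -> size (st l r) <= V.
Proof.
move=> /allP h; case: (ltnP r (size l)) => hr; first by apply/h/mem_nth.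
by rewrite /st nth_default.
Qed.

Lemma st_default l i : size l <= 18 -> 17 < i -> st l i = [::].
Proof. by move=> sl hi; rewrite /st nth_default //; lia. Qed.

(** * Unary arithmetic by loops *)

Definition ones (n : nat) : seq bool := nseq n true.

Lemma rcons_ones n : rcons (ones n) true = ones n.+1.
Proof. by rewrite -cats1 /ones -[[:: true]]/(nseq 1 true) -nseqD addn1. Qed.

Lemma ones_cat m n : ones m ++ ones n = ones (m + n).
Proof. by rewrite /ones nseqD. Qed.

Definition pushn (m r : nat) : cmd := seqs [seq Push r true | _ <- iota 0 m].

Lemma flatten_ones (A : Type) (l : seq A) m : flatten [seq ones m | _ <- l] = ones (size l * m).
Proof. by elim: l => //= a l ->; rewrite ones_cat mulSn. Qed.

Lemma emits_pushn m r s : emits r (pushn m r) s (ones m).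
Proof.
have -> : ones m = flatten [seq ones 1 | _ <- iota 0 m].
  by rewrite flatten_ones size_iota muln1.
by apply: emits_seqs => _; apply: emits_push.
Qed.

Lemma size_tuples k N : size (tuples k N) = N ^ k.
Proof.
elim: k => //= k IH; rewrite expnS -IH.
by rewrite [tuples _ _]/(allpairs _ _ _) size_allpairs size_iota.
Qed.

(** D nested loops with limit w write a monomial in unary without any arithmetic. Their counters
    start at stack 18, above the stacks with a fixed purpose. *)
Lemma emits_power D w C r s : w < 18 -> r < 18 -> w != r -> (forall i, 17 < i -> s i = [::]) ->
  emits r (loops (iota 18 D) w (pushn C r)) s (ones (size (s w) ^ D * C)).
Proof.
move=> w18 r18 wr s0.
have := @emits_loops r (iota 18 D) w (pushn C r) s (fun=> ones C).
rewrite flatten_ones size_tuples size_iota; apply.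
- exact: iota_uniq.
- by rewrite mem_iota; lia.
- by [].
- by rewrite mem_iota; lia.
- by move=> i; rewrite mem_iota => hi; apply: s0; lia.
- by move=> l _; apply: emits_pushn.
Qed.

Lemma emits_copy v w r b s : v != r -> w != r -> v != w -> s v = [::] ->
  emits r (For v w (Push r b)) s (nseq (size (s w)) b).
Proof.
move=> vr wr vw sv.
have := @emits_for r v w (Push r b) s (fun=> [:: b]) vr wr vw sv.
have -> : flatten [seq [:: b] | _ <- iota 0 (size (s w))] = nseq (size (s w)) b.
  by rewrite flatten_map1 -{2}(size_iota 0 (size (s w))); elim: (iota _ _) => //= a l ->.
by apply=> i _; apply: emits_push.
Qed.

(** [Unload] delivers the input from its end, so stack 1 receives the word reversed; unloading stack
    1 in [double] restores the order. *)
Definition load_bit (b : bool) : cmd := Seq (Push 1 b) (Seq (Push 3 true) (Push 4 true)).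
Definition load : cmd := Unload 0 (load_bit false) (load_bit true).
Definition double_bit (b : bool) : cmd := Seq (Push 2 b) (Push 2 b).
Definition double : cmd := Unload 1 (double_bit false) (double_bit true).

Lemma exec_load x : exec load (st [:: x]) =
  st [:: [::]; rev x; [::]; ones (size x); ones (size x)].
Proof.
have -> : st [:: x] = st [:: rev (rev x); [::]; [::]; ones 0; ones 0].
  by apply: functional_extensionality => -[|[|[|[|[|r]]]]] //=; rewrite /st /= ?revK ?nth_nil.
cbn [exec load]; rewrite [st _ 0]/= (revK (rev x)).
set F := fun s' b => _.
have H l a i : foldl F (st [:: rev l; a; [::]; ones i; ones i]) l =
    st [:: [::]; a ++ l; [::]; ones (i + size l); ones (i + size l)].
  elim: l a i => [|b l IH] a i; first by rewrite /= cats0 addn0.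
  rewrite [size _]/= addnS -addSn -cat_rcons -IH [foldl _ _ (b :: l)]/=; congr (foldl _ _ l).
  by rewrite /F; case: b; rewrite /= /push /pop !set_st /= !rcons_ones rev_cons popl_rcons.
by rewrite H size_rev.
Qed.

Lemma exec_double x X p q o : exec double (st [:: [::]; rev x; X; p; q; o]) =
  st [:: [::]; [::]; X ++ flatten [seq [:: b; b] | b <- x]; p; q; o].
Proof.
cbn [exec double]; rewrite [st _ 1]/= revK.
elim: x X => [|b l IH] X; first by rewrite /= cats0.
rewrite [foldl _ _ _]/= [flatten _]/= -[b :: b :: _]/([:: b; b] ++ _) catA -IH.
congr (foldl _ _ l).
by case: b; rewrite /= /push /pop !set_st /= rev_cons popl_rcons -!cats1 -catA.
Qed.

Lemma cost_seq c1 c2 s s' B1 B2 : exec c1 s = s' -> cost c1 s <= B1 -> cost c2 s' <= B2 ->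
  cost (Seq c1 c2) s <= B1 + B2 + 1.
Proof. by move=> /= ->; lia. Qed.

Definition separate (c : cmd) : Prop := forall r, r \in bounds c -> r \notin pushes c.

Lemma cost_st K c V l : wf K c -> separate c -> all (fun v => size v <= V) l ->
  cost c (st l) <= scost c V.
Proof. by move=> w d h; apply: cost_scost w d _ => r _; apply: size_st. Qed.

Lemma pushes_pushn m r : all (pred1 r) (pushes (pushn m r)).
Proof. by apply: all_pushes_seqs => _ /=; rewrite eqxx. Qed.

Lemma bounds_pushn m r : bounds (pushn m r) = [::].
Proof. by rewrite /pushn; elim: (iota 0 m). Qed.

Lemma mods_pushn m r : all (pred1 r) (mods (pushn m r)).
Proof. by apply: all_mods_seqs => _ /=; rewrite eqxx. Qed.

Lemma wf_pushn K m r : r < K -> wf K (pushn m r).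
Proof. by move=> rK; apply: wf_seqs. Qed.

Lemma wf_power K D w C r : 0 < w < 18 -> r < 18 -> w != r -> 18 + D <= K ->
  wf K (loops (iota 18 D) w (pushn C r)).
Proof.
move=> w18 r18 wr KD; have M i : i != r -> i \notin mods (pushn C r).
  by move=> ir; apply/negP => /(allP (mods_pushn C r)) /= /eqP E; rewrite E eqxx in ir.
apply: wf_loops.
- exact: iota_uniq.
- by apply/allP => i; rewrite mem_iota; lia.
- lia.
- by rewrite mem_iota; lia.
- exact: M.
- by apply/allP => i; rewrite mem_iota => hi; apply: M; lia.
- by apply: wf_pushn; lia.
Qed.

Lemma separate_power D w C r : w < 18 -> r < 18 -> w != r ->
  separate (loops (iota 18 D) w (pushn C r)).
Proof.
move=> w18 r18 wr i.
have -> : pushes (loops (iota 18 D) w (pushn C r)) = pushes (pushn C r).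
  by elim: (iota 18 D).
have -> : (i \in bounds (loops (iota 18 D) w (pushn C r))) = ((0 < D) && (i == w)) || (i \in iota 18 D).
  elim: D 18 => [|D IH] m /=; first by rewrite bounds_pushn.
  by rewrite !inE IH; case: (i == m); case: (i == w); rewrite ?orbT ?andbF.
move=> hi; apply/negP => /(allP (pushes_pushn C r)) /= /eqP E.
by move: hi; rewrite E mem_iota => /orP [/andP [_]|]; [rewrite eq_sym (negbTE wr)|lia].
Qed.

Lemma size_word_prefixE x : size (word_prefix x) = 2 * size x + 2.
Proof. by rewrite size_cat; elim: x => //= b x; lia. Qed.

(** * Computing the parameters from the input *)

Section Setup.
Variables (c k C D : nat) (out : cmd).

Definition setup_tail4 : cmd :=
  Seq (For 17 6 (Push 7 true)) (Seq (For 17 5 (Push 7 true)) (Seq (pushn 3 7) out)).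
Definition setup_tail3 : cmd :=
  Seq (For 17 2 (Push 6 true))
  (Seq (loops (iota 18 k) 3 (pushn c 6)) (Seq (pushn c 6) setup_tail4)).
Definition setup_tail2 : cmd :=
  Seq double (Seq (Push 2 false) (Seq (Push 2 true) setup_tail3)).
Definition setup : cmd :=
  Seq load (Seq (Push 4 true) (Seq (loops (iota 18 D) 4 (pushn C 5))
  (Seq (For 17 5 (Push 2 false)) setup_tail2))).

Definition boundW (n : nat) : nat := c * n ^ k + c.
Definition boundO (n : nat) : nat := C * n.+1 ^ D.
(** The explicit value of [pN]; it also bounds the heights of all stacks during the setup. *)
Definition boundN (n : nat) : nat := (boundO n + (2 * n + 2) + boundW n) + boundO n + 3.

Definition setup_cost (V : nat) : nat :=
  scost load V + 1 + scost (loops (iota 18 D) 4 (pushn C 5)) V +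
  scost (For 17 5 (Push 2 false)) V + scost double V + 2 +
  scost (For 17 2 (Push 6 true)) V + scost (loops (iota 18 k) 3 (pushn c 6)) V +
  scost (pushn c 6) V + scost (For 17 6 (Push 7 true)) V + scost (For 17 5 (Push 7 true)) V +
  scost (pushn 3 7) V + scost out V + 20.

Definition ready (x : seq bool) : state :=
  let n := size x in let P := tab_params x (boundW n) (boundO n) in
  st [:: [::]; [::]; pX P; ones n; ones n.+1; ones (pO P); ones (pE P); ones (pN P)].

Variable K : nat.
Hypotheses (KD : 18 + D <= K) (Kk : 18 + k <= K) (wout : wf K out) (sout : separate out).

Lemma setup_wf : wf K setup.
Proof.
have K18 : 18 <= K by lia.
cbn [wf setup setup_tail2 setup_tail3 setup_tail4 load double load_bit double_bit].
rewrite !wf_power ?wf_pushn ?wout //; try lia.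
rewrite /=; lia.
Qed.

Lemma setup_run x : exec setup (st [:: x]) = exec out (ready x) /\
  cost setup (st [:: x]) <= setup_cost (boundN (size x)).
Proof.
pose n := size x; pose O := boundO n; pose W := boundW n; pose N := boundN n.
have K18 : 18 <= K by lia.
have sp := size_word_prefixE x.
have NE : N = O + (2 * n + 2) + W + O + 3 by [].
(* The chain of intermediate states serves both claims: it gives the final state, and it bounds each
   command's cost at the state where the command starts. *)
have e1 := exec_load x.
have e2 : exec (Push 4 true) (st [:: [::]; rev x; [::]; ones n; ones n]) =
    st [:: [::]; rev x; [::]; ones n; ones n.+1].
  by rewrite /= /push set_st /= rcons_ones.
have e3 : exec (loops (iota 18 D) 4 (pushn C 5)) (st [:: [::]; rev x; [::]; ones n; ones n.+1]) =
    st [:: [::]; rev x; [::]; ones n; ones n.+1; ones O].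
  rewrite (emits_exec (emits_power _ _ _ _ _ _)) //; last by move=> i; apply: st_default.
  by rewrite set_st /= size_nseq mulnC.
have e4 : exec (For 17 5 (Push 2 false)) (st [:: [::]; rev x; [::]; ones n; ones n.+1; ones O]) =
    st [:: [::]; rev x; nseq O false; ones n; ones n.+1; ones O].
  by rewrite (emits_exec (emits_copy _ _ _ _ _)) // set_st /= size_nseq.
have e5 := exec_double x (nseq O false) (ones n) (ones n.+1) (ones O).
set X' := nseq O false ++ _ in e5.
have e6 : exec (Push 2 false) (st [:: [::]; [::]; X'; ones n; ones n.+1; ones O]) =
    st [:: [::]; [::]; rcons X' false; ones n; ones n.+1; ones O].
  by rewrite /= /push set_st.
pose X := tab_X x O.
have e7 : exec (Push 2 true) (st [:: [::]; [::]; rcons X' false; ones n; ones n.+1; ones O]) =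
    st [:: [::]; [::]; X; ones n; ones n.+1; ones O].
  by rewrite /= /push set_st /= /X /tab_X /word_prefix -!cats1 -!catA.
have sX : size X = O + (2 * n + 2) by rewrite size_tab_X sp.
have e8 : exec (For 17 2 (Push 6 true)) (st [:: [::]; [::]; X; ones n; ones n.+1; ones O]) =
    st [:: [::]; [::]; X; ones n; ones n.+1; ones O; ones (size X)].
  by rewrite (emits_exec (emits_copy _ _ _ _ _)) // set_st.
have e9 : exec (loops (iota 18 k) 3 (pushn c 6))
      (st [:: [::]; [::]; X; ones n; ones n.+1; ones O; ones (size X)]) =
    st [:: [::]; [::]; X; ones n; ones n.+1; ones O; ones (size X + n ^ k * c)].
  rewrite (emits_exec (emits_power _ _ _ _ _ _)) //; last by move=> i; apply: st_default.
  by rewrite set_st /= size_nseq ones_cat.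
have e10 : exec (pushn c 6)
      (st [:: [::]; [::]; X; ones n; ones n.+1; ones O; ones (size X + n ^ k * c)]) =
    st [:: [::]; [::]; X; ones n; ones n.+1; ones O; ones (size X + W)].
  by rewrite (emits_exec (emits_pushn _ _ _)) set_st /= ones_cat -addnA [n ^ k * c]mulnC.
have e11 : exec (For 17 6 (Push 7 true))
      (st [:: [::]; [::]; X; ones n; ones n.+1; ones O; ones (size X + W)]) =
    st [:: [::]; [::]; X; ones n; ones n.+1; ones O; ones (size X + W); ones (size X + W)].
  by rewrite (emits_exec (emits_copy _ _ _ _ _)) // set_st /= size_nseq.
have e12 : exec (For 17 5 (Push 7 true))
      (st [:: [::]; [::]; X; ones n; ones n.+1; ones O; ones (size X + W); ones (size X + W)]) =
    st [:: [::]; [::]; X; ones n; ones n.+1; ones O; ones (size X + W); ones (size X + W + O)].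
  by rewrite (emits_exec (emits_copy _ _ _ _ _)) // set_st /= size_nseq ones_cat.
have e13 : exec (pushn 3 7)
      (st [:: [::]; [::]; X; ones n; ones n.+1; ones O; ones (size X + W); ones (size X + W + O)]) =
    ready x.
  by rewrite (emits_exec (emits_pushn _ _ _)) set_st ones_cat.
split.
  have XS a b s s' : exec a s = s' -> exec (Seq a b) s = exec b s' by move=> <-.
  rewrite /setup (XS _ _ _ _ e1) (XS _ _ _ _ e2) (XS _ _ _ _ e3) (XS _ _ _ _ e4).
  rewrite /setup_tail2 (XS _ _ _ _ e5) (XS _ _ _ _ e6) (XS _ _ _ _ e7).
  rewrite /setup_tail3 (XS _ _ _ _ e8) (XS _ _ _ _ e9) (XS _ _ _ _ e10).
  by rewrite /setup_tail4 (XS _ _ _ _ e11) (XS _ _ _ _ e12) (XS _ _ _ _ e13).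
have sX' : size X' <= N.
  by rewrite /X' size_cat size_nseq; move: sp; rewrite /word_prefix size_cat /=; lia.
have Wk : n ^ k * c <= W by rewrite /W /boundW; lia.
pose small := fun v : seq bool => size v <= N.
rewrite -/N.
have B cc l : wf K cc -> separate cc -> all small l -> cost cc (st l) <= scost cc N.
  exact: cost_st.
apply: leq_trans (_ : scost load N + (1 + (scost (loops (iota 18 D) 4 (pushn C 5)) N +
  (scost (For 17 5 (Push 2 false)) N + (scost double N + (1 + (1 +
  (scost (For 17 2 (Push 6 true)) N + (scost (loops (iota 18 k) 3 (pushn c 6)) N +
  (scost (pushn c 6) N + (scost (For 17 6 (Push 7 true)) N + (scost (For 17 5 (Push 7 true)) N +
  (scost (pushn 3 7) N + scost out N + 1) + 1) + 1) + 1) + 1) + 1) + 1) + 1) + 1) + 1) + 1) + 1) + 1 <= _);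
  last by rewrite /setup_cost; lia.
have FS v w r b : v != r -> w != r -> separate (For v w (Push r b)).
  by move=> vr wr i; rewrite /= !inE => /orP [] /eqP ->.
have PS m r : separate (pushn m r) by move=> i; rewrite bounds_pushn.
have nN : n.+1 <= N by lia.
have nN' : n <= N by lia.
have ON : O <= N by lia.
apply: (cost_seq e1).
  apply: B; [by rewrite /=; lia|by move=> i; rewrite /= !inE => /eqP ->|].
  by rewrite /small /= nN'.
apply: (cost_seq e2) => //.
apply: (cost_seq e3).
  apply: B; [by apply: wf_power|by apply: separate_power|].
  by rewrite /small /= size_rev !size_nseq nN nN'.
apply: (cost_seq e4).
  apply: B; [by rewrite /=; lia|exact: FS|].
  by rewrite /small /= size_rev !size_nseq nN nN' ON.
apply: (cost_seq e5).
  apply: B; [by rewrite /=; lia|by move=> i; rewrite /= !inE => /eqP ->|].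
  by rewrite /small /= size_rev !size_nseq nN nN' ON.
apply: (cost_seq e6) => //.
apply: (cost_seq e7) => //.
apply: (cost_seq e8).
  apply: B; [by rewrite /=; lia|exact: FS|].
  rewrite /small /= !size_nseq nN nN' ON /=; lia.
apply: (cost_seq e9).
  apply: B; [by apply: wf_power|by apply: separate_power|].
  rewrite /small /= !size_nseq nN nN' ON /=; lia.
apply: (cost_seq e10).
  apply: B; [by apply: wf_pushn; lia|exact: PS|].
  rewrite /small /= !size_nseq nN nN' ON /=; lia.
apply: (cost_seq e11).
  apply: B; [by rewrite /=; lia|exact: FS|].
  rewrite /small /= !size_nseq nN nN' ON /=; lia.
apply: (cost_seq e12).
  apply: B; [by rewrite /=; lia|exact: FS|].
  rewrite /small /= !size_nseq nN nN' ON /=; lia.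
apply: (cost_seq e13).
  apply: B; [by apply: wf_pushn; lia|exact: PS|].
  rewrite /small /= !size_nseq nN nN' ON /=; lia.
apply: B => //.
rewrite /small /= !size_nseq nN nN'; rewrite -/n -/O -/W -/X; lia.
Qed.

Lemma polyb_setup_cost : polyb (fun n => setup_cost (boundN n)).
Proof.
have A := polyb_add; have S := polyb_const.
have pW : polyb boundW.
  by apply: A (S c); apply: polyb_mul (S c) (polyb_exp k polyb_id).
have pO : polyb boundO by exists C, D.
have pN : polyb boundN.
  rewrite /boundN; apply: (A _ _ (A _ _ (A _ _ (A _ _ pO _) pW) pO) (S 3)).
  by apply: (A _ _ _ (S 2)); apply: polyb_mul (S 2) polyb_id.
apply: (polyb_comp _ pN); rewrite /setup_cost.
by do 13!(apply: polyb_add; [|first [exact: polyb_scost|exact: polyb_const]]); exact: polyb_scost.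
Qed.
End Setup.

Lemma halted_accepts (M : TM) x w O t b : t < O ->
  halted_with (iter t (tm_step M) (tm_init M (pair_enc x w))) [:: b] ->
  @accepts M x O w b.
Proof.
move=> tO; have [p] := tm_iter_gstep (tm_init M (pair_enc x w)) 0 t.
rewrite tm_init_tape -/(conf M x w t).
case: (iter t _ _) => [[[s l] a] r] Ec [hs hr]; exists t; split=> //.
rewrite -Ec /=; split=> //.
rewrite /tape_of Z.ltb_irrefl Z.eqb_refl.
by case: a hr {Ec} => [a|] //= [->].
Qed.

Lemma accepts_inj (M : TM) x w O b b' :
  @accepts M x O w b -> @accepts M x O w b' -> b = b'.
Proof.
move=> [t [_ [ht hb]]] [t' [_ [ht' hb']]].
have E : conf M x w t = conf M x w t'.
  by case: (leqP t t') => le; [rewrite (conf_after ht le)|rewrite (conf_after ht' (ltnW le))].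
by move: hb; rewrite E hb' => -[].
Qed.

Theorem mainTheorem9 (h : nat) (hh : 4 <= h) :
  NP_hard_promise (yes_inst h) (no_inst h).
Proof.
move=> L [V [c [k [[M [c' [k' HM]]] HL]]]].
(* [2 * n + 2 + boundW c k n] bounds the length of the verifier's input; the final 1 makes O
   strictly larger than the running time. *)
pose time n := c' * (2 * n + 2 + boundW c k n) ^ k' + c' + 1.
have [C [D HO]] : polyb time.
  have A := polyb_add; have S := polyb_const.
  apply: (A _ _ (A _ _ (polyb_mul (S c') (polyb_exp _ _)) (S c')) (S 1)).
  apply: (A _ _ (A _ _ (polyb_mul (S 2) polyb_id) (S 2))).
  by apply: A (S c); apply: polyb_mul (S c) (polyb_exp k polyb_id).
pose CL := clauses M; pose out := out_prog h CL.
(* Stacks 0 to 17, and room for the counters from 18 on of the loops that compute powers with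
   exponents D and k. *)
pose K := 18 + D + k.
have wout : wf K out by apply: out_prog_wf; rewrite /K; lia.
have sout : separate out.
  move=> r /(allP (out_prog_bounds h CL)) hb; apply/negP.
  move=> /(allP (out_prog_pushes h CL)) /= /eqP r0.
  by rewrite r0 in hb.
pose prog := setup c k C D out.
have KD : 18 + D <= K by rewrite /K; lia.
have Kk : 18 + k <= K by rewrite /K; lia.
have init x : init_state x = st [:: x].
  by apply: functional_extensionality => -[|r]; rewrite /init_state /set /st //= nth_nil.
exists (fun x => exec prog (init_state x) 0); split.
  apply: (cmd_poly_time (K := K) (c := prog) _ _ (polyb_setup_cost c k C D out)).
  - by rewrite /K; lia.
  - exact: setup_wf.
  - by move=> x; rewrite init; have [] := setup_run c C KD Kk wout sout x.
move=> x; rewrite init; have [-> _] := setup_run c C KD Kk wout sout x.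
pose n := size x; pose W := boundW c k n; pose O := boundO C D n.
pose P := tab_params x W O.
have N0 : 0 < pN P by rewrite /=; lia.
have Es : env P (ready c k C D x).
  by split; rewrite /ready /= ?size_nseq.
have se r : 8 < r < 17 -> ready c k C D x r = [::].
  by move=> hr; rewrite /ready /st nth_default //=; lia.
rewrite (emits_exec (out_prog_emits h CL Es se)) set_eq [ready _ _ _ _ _ 0]/= cat0s.
have [m [e [<- pr nh hcolE]]] := reduction_graph CL hh N0.
(* Every word within the length bound gets its answer in time; soundness needs this for the word
   read off a colouring. *)
have halts w : size w <= W -> @accepts M x O w (V (pair_enc x w)).
  move=> sw; have [t [tle ht]] := HM (pair_enc x w).
  apply: halted_accepts ht; apply: leq_ltn_trans tle _.
  apply: leq_trans (HO n); rewrite /time addn1 ltnS leq_add2r leq_mul2l leq_expl ?orbT //.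
  by rewrite pair_encE size_cat size_word_prefixE leq_add2l.
split=> [/HL [w [sw Vw]]|nL].
- exists m, e; split=> //; apply/hcolE.
  have acc : @accepts M x O w true by rewrite -Vw; apply: halts.
  apply: (sat_hcol hh (al := run_assignment x O w)) => j t a.
  exact: (tableau_complete (W := W) sw acc).
(* A model would give a colouring, an assignment and a certificate for x, so outside L the graph is
   not in [h,2,1]. *)
- exists m, e; split=> // -[/hcolE /(hcol_sat hh N0) [al sat] _]; apply: nL.
  have [w sw acc] := tableau_sound (fun w sw => ex_intro _ _ (halts w sw)) sat.
  apply/HL; exists w; split=> //.
  by rewrite (accepts_inj (halts w sw) acc).
Qed.
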